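(* Let $T_n=((\tau_{j-i}))_{0\le i,j\le n-1}$ be the non-symmetric Toeplitz matrix generated by i.i.d. real random variables $\{\tau_j\}_{j\in\mathbb{Z}}$ with mean $0$, variance $1$ and finite moments of every order. Then there exist an NCP $(\mathcal{A},\varphi)$ and standard complex Gaussian variables $N,\tilde N\in\mathcal{A}$ such that $n^{-1/2}T_n$, as an element of $(\mathcal{M}_n,\varphi_n=n^{-1}\mathbb{E}\,\mathrm{Tr}(\cdot))$, converges in $*$-distribution to $(N+\tilde N)/\sqrt2$. Moreover, the joint moments of $N$ and $\tilde N$ are finite sums of integrals of exponential type (defined in the context), and they are dominated by Gaussian moments: there is a centered Gaussian random variable $G$ (of some variance) such that the absolute value of any joint moment of order $2m$ of $\{N,\tilde N\}$ is at most $\mathbb{E}[G^{2m}]$, $m\ge1$.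
   Context: $\iota=\sqrt{-1}$. An NCP (non-commutative $*$-probability space) $(\mathcal{A},\varphi)$ is a unital complex $*$-algebra with a complex linear functional $\varphi$ satisfying $\varphi(1_{\mathcal{A}})=1$. A joint moment of order $p$ of variables is the value of $\varphi$ on a monomial of degree $p$ in the variables and their adjoints. Elements $a_n$ of NCPs $(\mathcal{A}_n,\varphi_n)$ converge in $*$-distribution to $a\in\mathcal{A}$ if $\varphi_n(Q(a_n))\to\varphi(Q(a))$ for every monomial $Q$ in the non-commuting indeterminates $x,x^*$. $\mathcal{M}_n$ is the $*$-algebra of $n\times n$ random matrices all of whose entries have finite moments of all orders. A variable $a\in\mathcal{A}$ is a standard complex Gaussian variable if it is normal ($aa^*=a^*a$) and $\varphi(a^k a^{*l})=\mathbb{E}[G_0^k\overline{G_0}^{\,l}]$ for all $k,l\ge 0$, where $G_0=X+\iota Y$ with $X,Y$ independent real Gaussian random variables of mean $0$ and variance $1/2$. An integral of exponential type is an integral of one of the two forms $$\int_{[0,1]^{m+1}}\exp\big(\iota\theta(k_1x_1+\dots+k_{m+1}x_{m+1})\big)\,\mathrm{d}x_1\cdots\mathrm{d}x_{m+1},$$ $$\int_{[0,1]^{m+1}}\exp\big(\iota\theta\,(k_1x_1+\dots+k_{m+1}x_{m+1})\,(\mathrm{mod}\ 1)\big)\prod_{r=1}^{2m}\mathbb{I}\{0\le l_r(x_1,\dots,x_{m+1})\le1\}\,\mathrm{d}x_1\cdots\mathrm{d}x_{m+1},$$ where $m\ge1$, $\theta\in[-\pi,\pi]$, $k_1,\dots,k_{m+1}\in\mathbb{Z}$,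 each $l_r$ is a linear combination of $x_1,\dots,x_{m+1}$, and the reduction mod $1$ is applied to $k_1x_1+\dots+k_{m+1}x_{m+1}$. *)

(* Defs.v *)
From HB Require Import structures.
From mathcomp Require Import all_boot all_order all_algebra.
From mathcomp Require Import all_classical all_reals all_analysis.
From mathcomp Require Import measurable_realfun complex.
Set Implicit Arguments.
Unset Strict Implicit.
Unset Printing Implicit Defensive.
Import Order.TTheory GRing.Theory Num.Theory.
Import numFieldNormedType.Exports.
Local Open Scope classical_set_scope.
Local Open Scope ring_scope.
Local Open Scope complex_scope.

Definition cabs (R : rcfType) (z : R[i]) : R := complex.Re `|z|.

Definition cexpi (R : realType) (t : R) : R[i] := cos t +i* sin t.

Definition cintegral d (T : measurableType d) (R : realType)
    (mu : {measure set T -> \bar R}) (D : set T) (f : T -> R[i]) : R[i] :=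
  (\int[mu]_(x in D) complex.Re (f x)) +i* (\int[mu]_(x in D) complex.Im (f x)).

(* Non-commutative *-probability spaces. [algType] demands 1 <> 0, which
   [ncp_phi 1 = 1] forces anyway. *)
Record ncp (R : realType) := NCP {
  ncp_alg :> algType R[i];
  ncp_star : ncp_alg -> ncp_alg;
  ncp_starD : forall a b, ncp_star (a + b) = ncp_star a + ncp_star b;
  ncp_starZ : forall (c : R[i]) a, ncp_star (c *: a) = c^* *: ncp_star a;
  ncp_starM : forall a b, ncp_star (a * b) = ncp_star b * ncp_star a;
  ncp_starK : forall a, ncp_star (ncp_star a) = a;
  ncp_phi : {scalar ncp_alg};
  ncp_phi1 : ncp_phi 1 = 1 }.

(* A word is a monomial in the indeterminates x_i, x_i^*; a letter (i, true)
   stands for x_i^*. *)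
Definition star_word (R : realType) (A : ncp R) (I : Type) (x : I -> A)
    (w : seq (I * bool)) : A :=
  \prod_(l <- w) (if l.2 then ncp_star (x l.1) else x l.1).

Definition joint_moment (R : realType) (A : ncp R) (I : Type) (x : I -> A)
    (w : seq (I * bool)) : R[i] :=
  ncp_phi A (star_word x w).

Definition cvg_star_distribution (R : realType) (An : nat -> ncp R)
    (an : forall n, An n) (A : ncp R) (a : A) : Prop :=
  forall w : seq (unit * bool),
    (fun n => joint_moment (fun=> an n) w : R[i]^o) @ \oo -->
      (joint_moment (fun=> a) w : R[i]^o).

(* E[G0^k conj(G0)^l] for G0 = X + iY, with (X, Y) the coordinates of R^2 under
   the product of two centered normal laws of variance 1/2; [normal_prob] takes
   the standard deviation as its second argument. *)
Definition std_cgauss_moment (R : realType) (k l : nat) : R[i] :=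
  let g : probability _ R := normal_prob (0 : R) (Num.sqrt 2^-1) in
  cintegral (product_measure1 g g) setT
    (fun z : R * R => (z.1 +i* z.2) ^+ k * ((z.1 +i* z.2)^*) ^+ l).

Definition standard_complex_gaussian (R : realType) (A : ncp R) (a : A) : Prop :=
  a * ncp_star a = ncp_star a * a /\
  forall k l : nat,
    ncp_phi A (a ^+ k * ncp_star a ^+ l) = std_cgauss_moment R k l.

Definition finite_moments d (T : measurableType d) (R : realType)
    (P : probability T R) (X : T -> R) : Prop :=
  forall p : nat, ('E_P[(fun w => `|X w| ^+ p)%R] < +oo)%E.

Definition cfinite_moments d (T : measurableType d) (R : realType)
    (P : probability T R) (Z : T -> R[i]) : Prop :=
  [/\ measurable_fun setT (fun w => complex.Re (Z w)),
      measurable_fun setT (fun w => complex.Im (Z w)) &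
      finite_moments P (fun w => cabs (Z w))].

Section complex_random_variables.
Context d (T : measurableType d) (R : realType) (P : probability T R).
Local Notation C := R[i].
Implicit Types (Z W : T -> C).

Lemma cabs_ge0 (z : C) : 0 <= cabs z.
Proof. by rewrite /cabs normc_def/= sqrtr_ge0. Qed.

Lemma cabsE (z : C) : `|z| = (cabs z)%:C.
Proof. by rewrite /cabs normc_def. Qed.

Lemma cabsM (z w : C) : cabs (z * w) = cabs z * cabs w.
Proof. by rewrite /cabs normrM !normc_def/= mulr0 subr0. Qed.

Lemma cabsD (z w : C) : cabs (z + w) <= cabs z + cabs w.
Proof.
by have := ler_normD z w; rewrite !cabsE -rmorphD/= lecR.
Qed.

Lemma cabsJ (z : C) : cabs (z^*) = cabs z.
Proof. by rewrite /cabs normcJ. Qed.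

Lemma cabs_Re (z : C) : `|complex.Re z| <= cabs z.
Proof. by have := normc_ge_Re z; rewrite cabsE lecR. Qed.

Lemma cabs_Im (z : C) : `|complex.Im z| <= cabs z.
Proof.
by rewrite /cabs normc_def/= -sqrtr_sqr ler_wsqrtr// lerDr sqr_ge0.
Qed.

Lemma measurable_cabs Z : measurable_fun setT (fun w => complex.Re (Z w)) ->
  measurable_fun setT (fun w => complex.Im (Z w)) ->
  measurable_fun setT (fun w => cabs (Z w)).
Proof.
move=> mr mi; rewrite /cabs.
rewrite (_ : (fun w => _) = Num.sqrt \o
   (fun w => complex.Re (Z w) ^+ 2 + complex.Im (Z w) ^+ 2)); last first.
  by apply/funext => w; rewrite normc_def.
apply: measurableT_comp => //.
  by apply: continuous_measurable_fun; exact: sqrt_continuous.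
by apply: measurable_funD; exact: measurable_funX.
Qed.

Lemma cfin_integrable Z p : cfinite_moments P Z ->
  P.-integrable setT (EFin \o (fun w => cabs (Z w) ^+ p)).
Proof.
move=> [mr mi fm]; apply/integrableP; split.
  by apply/measurable_EFinP; apply: measurable_funX; exact: measurable_cabs.
apply: le_lt_trans (fm p); rewrite unlock; apply: ge0_le_integral => //.
- do 2 apply: measurableT_comp => //.
  by apply: measurable_funX; exact: measurable_cabs.
- apply/measurable_EFinP/measurable_funX; apply: measurableT_comp => //.
  exact: measurable_cabs.
- by move=> w _ /=; rewrite normrX.
Qed.

Lemma cfin_dominated Z (X : nat -> T -> R) :
  measurable_fun setT (fun w => complex.Re (Z w)) ->
  measurable_fun setT (fun w => complex.Im (Z w)) ->
  (forall p, P.-integrable setT (EFin \o X p)) ->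
  (forall p w, cabs (Z w) ^+ p <= X p w) -> cfinite_moments P Z.
Proof.
move=> mr mi iX ZX; split=> // p; rewrite unlock.
have /integrableP[mX] := iX p; apply: le_lt_trans.
apply: ge0_le_integral => //.
- apply/measurable_EFinP/measurable_funX; apply: measurableT_comp => //.
  exact: measurable_cabs.
- by apply: measurableT_comp.
- move=> w _ /=; rewrite lee_fin (ger0_norm (cabs_ge0 _)).
  exact: le_trans (ZX p w) (ler_norm _).
Qed.

Lemma cfin_cst (c : C) : cfinite_moments P (fun=> c).
Proof.
apply: (@cfin_dominated _ (fun p _ => cabs c ^+ p)) => //.
by move=> p; exact: finite_measure_integrable_cst.
Qed.

Lemma cfin_add Z W : cfinite_moments P Z -> cfinite_moments P W ->
  cfinite_moments P (fun w => Z w + W w).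
Proof.
move=> fZ fW; have [mrZ miZ _] := fZ; have [mrW miW _] := fW.
apply: (@cfin_dominated _
  (fun p w => 2 ^+ p * (cabs (Z w) ^+ p + cabs (W w) ^+ p))).
- rewrite (_ : (fun w => _) = (fun w => complex.Re (Z w) + complex.Re (W w))).
    exact: measurable_funD.
  by apply/funext => w; case: (Z w); case: (W w).
- rewrite (_ : (fun w => _) = (fun w => complex.Im (Z w) + complex.Im (W w))).
    exact: measurable_funD.
  by apply/funext => w; case: (Z w); case: (W w).
- move=> p; rewrite (_ : _ \o _ = (fun w => (2 ^+ p)%:E *
      ((cabs (Z w) ^+ p)%:E + (cabs (W w) ^+ p)%:E))%E); last first.
    by apply/funext.
  apply: integrableZl => //; apply: integrableD => //; exact: cfin_integrable.
- move=> p w; apply: (@le_trans _ _ ((cabs (Z w) + cabs (W w)) ^+ p)).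
    by apply: lerXn2r (cabsD _ _); rewrite nnegrE ?addr_ge0// cabs_ge0.
  have [le|/ltW le] := leP (cabs (Z w)) (cabs (W w)).
  + apply: (@le_trans _ _ ((2 * cabs (W w)) ^+ p)).
      apply: lerXn2r; rewrite ?nnegrE ?addr_ge0 ?mulr_ge0 ?cabs_ge0//.
      by rewrite mulr_natl mulr2n lerD2r.
    by rewrite exprMn ler_wpM2l ?exprn_ge0// lerDr exprn_ge0// cabs_ge0.
  + apply: (@le_trans _ _ ((2 * cabs (Z w)) ^+ p)).
      apply: lerXn2r; rewrite ?nnegrE ?addr_ge0 ?mulr_ge0 ?cabs_ge0//.
      by rewrite mulr_natl mulr2n lerD2l.
    by rewrite exprMn ler_wpM2l ?exprn_ge0// lerDl exprn_ge0// cabs_ge0.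
Qed.

Lemma cfin_mul Z W : cfinite_moments P Z -> cfinite_moments P W ->
  cfinite_moments P (fun w => Z w * W w).
Proof.
move=> fZ fW; have [mrZ miZ _] := fZ; have [mrW miW _] := fW.
apply: (@cfin_dominated _
  (fun p w => cabs (Z w) ^+ (p * 2) + cabs (W w) ^+ (p * 2))).
- rewrite (_ : (fun w => _) = (fun w => complex.Re (Z w) * complex.Re (W w)
     - complex.Im (Z w) * complex.Im (W w))).
    by apply: measurable_funB; exact: measurable_funM.
  by apply/funext => w; case: (Z w); case: (W w).
- rewrite (_ : (fun w => _) = (fun w => complex.Re (Z w) * complex.Im (W w)
     + complex.Im (Z w) * complex.Re (W w))).
    by apply: measurable_funD; exact: measurable_funM.
  by apply/funext => w; case: (Z w); case: (W w).
- move=> p; rewrite (_ : _ \o _ = (fun w =>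
      ((cabs (Z w) ^+ (p * 2))%:E + (cabs (W w) ^+ (p * 2))%:E))%E); last first.
    by apply/funext.
  by apply: integrableD => //; exact: cfin_integrable.
- move=> p w; rewrite cabsM exprMn !exprM.
  have := exprn_ge0 p (cabs_ge0 (Z w)); have := exprn_ge0 p (cabs_ge0 (W w)).
  move: (_ ^+ p) (cabs (Z w) ^+ p) => a b a0 b0.
  have [le|/ltW le] := leP a b.
    by rewrite (@le_trans _ _ (b ^+ 2))// ?lerDl ?sqr_ge0// expr2 ler_wpM2l.
  by rewrite (@le_trans _ _ (a ^+ 2))// ?lerDr ?sqr_ge0// expr2 ler_wpM2r.
Qed.

Lemma cfin_sum (I : Type) (s : seq I) (Z : I -> T -> C) :
  (forall i, cfinite_moments P (Z i)) ->
  cfinite_moments P (fun w => \sum_(i <- s) Z i w).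
Proof.
move=> fZ; elim: s => [|i s IH].
  by under eq_fun do rewrite big_nil; exact: cfin_cst.
by under eq_fun do rewrite big_cons; exact: cfin_add.
Qed.

Lemma cfin_conj Z : cfinite_moments P Z -> cfinite_moments P (fun w => (Z w)^*).
Proof.
move=> fZ; have [mrZ miZ _] := fZ.
apply: (@cfin_dominated _ (fun p w => cabs (Z w) ^+ p)).
- by rewrite (_ : (fun w => _) = (fun w => complex.Re (Z w)))//;
    apply/funext => w; case: (Z w).
- rewrite (_ : (fun w => _) = (fun w => - complex.Im (Z w))).
    exact: measurableT_comp.
  by apply/funext => w; case: (Z w).
- by move=> p; exact: cfin_integrable.
- by move=> p w; rewrite cabsJ.
Qed.

Lemma cfin_real (X : T -> R) : measurable_fun setT X ->
  finite_moments P X -> cfinite_moments P (fun w => (X w)%:C).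
Proof.
move=> mX fX; split=> // p.
rewrite (_ : (fun w => _) = (fun w => `|X w| ^+ p)); first exact: fX.
apply/funext => w; rewrite (ger0_norm (cabs_ge0 _)) /cabs normc_def/=.
by rewrite expr0n/= addr0 sqrtr_sqr.
Qed.

Lemma cfin_Re_integrable Z : cfinite_moments P Z ->
  P.-integrable setT (EFin \o (fun w => complex.Re (Z w))).
Proof.
move=> fZ; have [mr mi _] := fZ.
apply: (le_integrable measurableT _ _ (cfin_integrable 1 fZ)).
  exact/measurable_EFinP.
by move=> w _ /=; rewrite lee_fin expr1 (ger0_norm (cabs_ge0 _)) cabs_Re.
Qed.

Lemma cfin_Im_integrable Z : cfinite_moments P Z ->
  P.-integrable setT (EFin \o (fun w => complex.Im (Z w))).
Proof.
move=> fZ; have [mr mi _] := fZ.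
apply: (le_integrable measurableT _ _ (cfin_integrable 1 fZ)).
  exact/measurable_EFinP.
by move=> w _ /=; rewrite lee_fin expr1 (ger0_norm (cabs_ge0 _)) cabs_Im.
Qed.

Lemma cintegralD Z W : cfinite_moments P Z -> cfinite_moments P W ->
  cintegral P setT (fun w => Z w + W w) =
  cintegral P setT Z + cintegral P setT W.
Proof.
move=> fZ fW; rewrite /cintegral.
rewrite (_ : (fun w => complex.Re (Z w + W w)) =
   (fun w => complex.Re (Z w) + complex.Re (W w))); last first.
  by apply/funext => w; case: (Z w); case: (W w).
rewrite (_ : (fun w => complex.Im (Z w + W w)) =
   (fun w => complex.Im (Z w) + complex.Im (W w))); last first.
  by apply/funext => w; case: (Z w); case: (W w).
by rewrite !RintegralD//; do ?[exact: cfin_Re_integrable|exact: cfin_Im_integrable].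
Qed.

Lemma cintegralZ (c : C) Z : cfinite_moments P Z ->
  cintegral P setT (fun w => c * Z w) = c * cintegral P setT Z.
Proof.
move=> fZ; have iR := cfin_Re_integrable fZ; have iI := cfin_Im_integrable fZ.
case: c => a b; rewrite /cintegral.
rewrite (_ : (fun w => complex.Re _) =
   (fun w => a * complex.Re (Z w) - b * complex.Im (Z w))); last first.
  by apply/funext => w; case: (Z w).
rewrite (_ : (fun w => complex.Im _) =
   (fun w => a * complex.Im (Z w) + b * complex.Re (Z w))); last first.
  by apply/funext => w; case: (Z w).
have iZ (r : R) (f : T -> R) : P.-integrable setT (EFin \o f) ->
    P.-integrable setT (EFin \o (fun w => r * f w)).
  move=> fi; rewrite (_ : _ \o _ = (fun w => r%:E * (f w)%:E)%E).
    exact: integrableZl.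
  by apply/funext.
rewrite RintegralB ?RintegralD// ?RintegralZl//; try exact: iZ.
Qed.

End complex_random_variables.

Section function_algebra.
Context (T : pointedType) (K : pzRingType).

Lemma fct_scalerAl (A : lalgType K) (k : K) (f g : T -> A) :
  k *: (f * g) = k *: f * g.
Proof. by apply/funext => x; exact: scalerAl. Qed.

HB.instance Definition _ (A : lalgType K) :=
  GRing.Lmodule_isLalgebra.Build K (T -> A) (@fct_scalerAl A).

Lemma fct_scalerAr (A : algType K) (k : K) (f g : T -> A) :
  k *: (f * g) = f * (k *: g).
Proof. by apply/funext => x; exact: scalerAr. Qed.

HB.instance Definition _ (A : algType K) :=
  GRing.Lalgebra_isAlgebra.Build K (T -> A) (@fct_scalerAr A).

End function_algebra.

(* The *-algebra M_(n.+1): a unital algebra of matrices needs size >= 1. *)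
Section random_matrices.
Context d (T : measurableType d) (R : realType) (P : probability T R) (n : nat).
Local Notation C := R[i].

Definition rmx_pred : pred (T -> 'M[C]_n.+1) :=
  fun f => `[< forall i j, cfinite_moments P (fun w => f w i j) >].

Record random_mx := RandomMx {
  rmx_val :> T -> 'M[C]_n.+1 ;
  rmx_valP : rmx_pred rmx_val }.

HB.instance Definition _ := [isSub for rmx_val].
HB.instance Definition _ := [Choice of random_mx by <:].

Lemma rmx_subalg_closed : subalg_closed rmx_pred.
Proof.
split.
- apply/asboolP => i j.
  rewrite (_ : (fun w => _) = (fun=> (1%:M : 'M[C]_n.+1) i j)) //.
  exact: cfin_cst.
- move=> c f g /asboolP fP /asboolP gP; apply/asboolP => i j.
  rewrite (_ : (fun w => _) = (fun w => c * f w i j + g w i j)); last first.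
    by apply/funext => w; rewrite !mxE.
  by apply: cfin_add => //; apply: cfin_mul => //; exact: cfin_cst.
- move=> f g /asboolP fP /asboolP gP; apply/asboolP => i j.
  rewrite (_ : (fun w => _) = (fun w => \sum_k f w i k * g w k j)); last first.
    by apply/funext => w; rewrite !mxE.
  by apply: cfin_sum => k; exact: cfin_mul.
Qed.

HB.instance Definition _ := GRing.isSubalgClosed.Build C (T -> 'M[C]_n.+1)
  rmx_pred rmx_subalg_closed.
HB.instance Definition _ := [SubChoice_isSubAlgebra of random_mx by <:].

Lemma rmx_star_proof (A : random_mx) :
  rmx_pred (fun w => (map_mx (@conjc R) (A w))^T).
Proof.
apply/asboolP => i j.
rewrite (_ : (fun w => _) = (fun w => (A w j i)^*)).
  by apply: cfin_conj; move/asboolP: (rmx_valP A); exact.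
by apply/funext => w; rewrite !mxE.
Qed.

Definition rmx_star (A : random_mx) : random_mx := RandomMx (rmx_star_proof A).

Definition rmx_phi (A : random_mx) : C :=
  n.+1%:R^-1 * cintegral P setT (fun w => \tr (A w)).

Lemma rmx_starD A B : rmx_star (A + B) = rmx_star A + rmx_star B.
Proof.
by apply/val_inj/funext => w; apply/matrixP => i j; rewrite !mxE rmorphD.
Qed.

Lemma rmx_starZ (c : C) A : rmx_star (c *: A) = c^* *: rmx_star A.
Proof.
by apply/val_inj/funext => w; apply/matrixP => i j; rewrite !mxE rmorphM.
Qed.

Lemma rmx_starM A B : rmx_star (A * B) = rmx_star B * rmx_star A.
Proof.
apply/val_inj/funext => w; apply/matrixP => i j; rewrite !mxE rmorph_sum.
by apply: eq_bigr => k _; rewrite rmorphM mulrC !mxE.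
Qed.

Lemma rmx_starK A : rmx_star (rmx_star A) = A.
Proof.
by apply/val_inj/funext => w; apply/matrixP => i j; rewrite !mxE conjcK.
Qed.

Lemma cfin_trace (A : random_mx) : cfinite_moments P (fun w => \tr (A w)).
Proof. by apply: cfin_sum => i; move/asboolP: (rmx_valP A); exact. Qed.

Lemma rmx_phi_linear : scalar rmx_phi.
Proof.
move=> c A B; rewrite /rmx_phi.
rewrite (_ : (fun w => _) = (fun w => c * \tr (A w) + \tr (B w))); last first.
  by apply/funext => w; rewrite -mxtraceZ -mxtraceD.
rewrite cintegralD; last exact: cfin_trace; last first.
  by apply: cfin_mul; [exact: cfin_cst|exact: cfin_trace].
rewrite cintegralZ; last exact: cfin_trace.
by rewrite mulrDr mulrCA.
Qed.

HB.instance Definition _ :=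
  GRing.isLinear.Build C random_mx C *%R rmx_phi rmx_phi_linear.

Lemma rmx_phi1 : rmx_phi 1 = 1.
Proof.
rewrite /rmx_phi (_ : (fun w => _) = (fun=> n.+1%:R)); last first.
  by apply/funext => w; rewrite mxtrace1.
rewrite (_ : cintegral _ _ _ = n.+1%:R) ?mulVf ?pnatr_eq0//.
rewrite /cintegral !Rintegral_cst//= probability_setT !mulr1.
by case: (n.+1%:R).
Qed.

Definition random_mx_ncp : ncp R :=
  @NCP R random_mx rmx_star rmx_starD rmx_starZ rmx_starM rmx_starK
    rmx_phi rmx_phi1.

End random_matrices.

Definition toeplitz_fun d (T : measurableType d) (R : realType)
    (P : probability T R) (tau : int -> {RV P >-> R}) (n : nat) (w : T) :
    'M[R[i]]_n.+1 :=
  \matrix_(i, j) (tau (j%:Z - i%:Z) w)%:C.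

Lemma toeplitz_proof d (T : measurableType d) (R : realType)
    (P : probability T R) (tau : int -> {RV P >-> R})
    (tau_fin : forall j, finite_moments P (tau j)) (n : nat) :
  rmx_pred P (@toeplitz_fun _ _ _ P tau n).
Proof.
apply/asboolP => i j.
rewrite (_ : (fun w => _) = (fun w => (tau (j%:Z - i%:Z) w)%:C)).
  exact: cfin_real.
by apply/funext => w; rewrite mxE.
Qed.

(* T_(n.+1), as an element of M_(n.+1). *)
Definition toeplitz d (T : measurableType d) (R : realType)
    (P : probability T R) (tau : int -> {RV P >-> R})
    (tau_fin : forall j, finite_moments P (tau j)) (n : nat) :
    random_mx_ncp P n :=
  RandomMx (@toeplitz_proof _ _ _ P tau tau_fin n).

Definition mutually_independent d (T : measurableType d) (R : realType)
    (P : probability T R) (I : choiceType) (X : I -> {RV P >-> R}) : Prop :=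
  forall (s : seq I) (B : I -> set R), uniq s ->
    (forall i, measurable (B i)) ->
    P (\big[setI/setT]_(i <- s) (X i @^-1` B i)) =
      (\prod_(i <- s) P (X i @^-1` B i))%E.

Definition identically_distributed d (T : measurableType d) (R : realType)
    (P : probability T R) (I : Type) (X : I -> {RV P >-> R}) : Prop :=
  forall i j (B : set R), measurable B -> P (X i @^-1` B) = P (X j @^-1` B).

Definition centered_gaussian d (T : measurableType d) (R : realType)
    (P : probability T R) (G : {RV P >-> R}) : Prop :=
  exists2 sigma : R, 0 < sigma &
    forall B : set R, measurable B -> P (G @^-1` B) = normal_prob 0 sigma B.

(* Integral over [0,1]^N, as an iterated integral: the integrands below are
   bounded and measurable, so Fubini applies. *)
Fixpoint cube_integral (R : realType) (N : nat) :
    (N.-tuple R -> R[i]) -> R[i] :=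
  match N return (N.-tuple R -> R[i]) -> R[i] with
  | 0 => fun F => F [tuple]
  | N'.+1 => fun F => cintegral lebesgue_measure `[0, 1]
      (fun x : R => cube_integral (fun t : N'.-tuple R => F [tuple of x :: t]))
  end.

Definition frac_part (R : realType) (t : R) : R := t - (Num.floor t)%:~R.

Definition int_form (R : realType) (N : nat) (k : 'I_N -> int)
    (x : N.-tuple R) : R := \sum_(i < N) (k i)%:~R * tnth x i.

Definition real_form (R : realType) (N : nat) (l : 'I_N -> R)
    (x : N.-tuple R) : R := \sum_(i < N) l i * tnth x i.

Definition exp_integral1 (R : realType) (m : nat) (theta : R)
    (k : 'I_m.+1 -> int) : R[i] :=
  cube_integral (fun x => cexpi (theta * int_form k x)).

(* The reduction mod 1 acts on the integer form, before multiplication by theta;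
   the linear forms l_r have arbitrary real coefficients. *)
Definition exp_integral2 (R : realType) (m : nat) (theta : R)
    (k : 'I_m.+1 -> int) (l : 'I_(2 * m) -> 'I_m.+1 -> R) : R[i] :=
  cube_integral (fun x => cexpi (theta * frac_part (int_form k x)) *
    \prod_(r < 2 * m) (if 0 <= real_form (l r) x <= 1 then 1 else 0)).

Definition exp_type_integral (R : realType) (z : R[i]) : Prop :=
  exists (m : nat) (theta : R) (k : 'I_m.+1 -> int),
    [/\ (1 <= m)%N, - pi <= theta <= pi &
        z = exp_integral1 theta k \/
        exists l : 'I_(2 * m) -> 'I_m.+1 -> R, z = exp_integral2 theta k l].

(* Main.v *)
From HB Require Import structures.
Require Import Defs.
From mathcomp Require Import all_boot all_order all_algebra.
From mathcomp Require Import all_classical all_reals all_analysis.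
From mathcomp Require Import measurable_realfun complex.
From mathcomp Require Import zify ring lra.
Import Order.TTheory GRing.Theory Num.Theory.
Import numFieldNormedType.Exports.
Local Open Scope classical_set_scope.
Local Open Scope ring_scope.
Local Open Scope complex_scope.
Set Implicit Arguments.
Unset Strict Implicit.
Unset Printing Implicit Defensive.

(** Write [m] for the size of the matrix and let
    [freq (+/-) e = tau_e +/- tau_(e - m)] for [0 <= e < m]. The Toeplitz matrix
    is half the sum of the circulant matrix and the skew-circulant matrix whose
    first rows are these two sequences ([circulant_sum]). Divided by
    [sqrt (2 m)], the two matrices are the prelimits of [N] and [N'], and the
    identity [(N + N') / sqrt 2 = T / sqrt m] holds exactly for every size. It
    therefore suffices to find the limits of the joint moments of the pair; the
    convergence of [T / sqrt m] then follows by expanding words in a sum.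

    An entry of a product of such matrices is a sum over walks on the integers
    ([word_row]): a letter shifts the position by a frequency, backwards when
    the letter is adjoint, and each skew-circulant letter contributes a sign
    whenever the shift changes the period in which the walk lies. The trace
    keeps the walks which close up modulo [m].
    The expectation of the product of the noises met by a walk is given by a sum
    over pairings of the letters, unless the frequencies of the walk coincide
    more often than a pairing requires ([freq_moment_wick]); those exceptional
    walks are too few to matter ([grid_defect_count]). Frequencies of different
    kind are uncorrelated, as [tau_e tau_e] and [tau_(e - m) tau_(e - m)] enter
    with opposite signs, so only letters of one kind are paired.

    For a fixed pairing there remains an average, over the lattice points of a
    cube, of a function of the floors of integer linear forms divided by the
    mesh. Refining the mesh changes these floors only near the walls of
    finitely many hyperplane families, so the averages form a Cauchy sequence
    ([lattice_average_cvg]); if the walk of a pairing closes only under a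
    nontrivial linear condition, the average tends to zero
    ([lattice_average_congr_cvg0]). Hence all joint moments converge, and each
    limit of order [2 m] is at most the number of pairings in modulus, which is
    the moment of order [2 m] of a standard Gaussian variable.

    On words in one variable the signs multiply to one around closed walks, so
    that a limit moment counts the pairings of plain letters with adjoint ones
    ([limit_moment_pure]). This count satisfies the recursion which integration
    by parts gives for the moments of the standard complex Gaussian law
    ([wick_power_word]). Each of the two matrix families is normal, and the
    limit space, spanned by words in sequences of matrices, inherits this
    relation ([ncp_limit]).

    The representation by integrals of exponential type holds for every complex
    number ([exp_sum_any]): already the integrals of [exp (i s x)] over the unit
    interval generate the complex numbers under addition. *)

(** * Tuples, grids and their refinement *)

Definition insert (A : Type) (j : nat) (z : A) (s : seq A) : seq A :=
  take j s ++ z :: drop j s.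

Definition remove (A : Type) (j : nat) (s : seq A) : seq A :=
  take j s ++ drop j.+1 s.

Lemma size_insert (A : Type) j (z : A) s : size (insert j z s) = (size s).+1.
Proof. by rewrite /insert size_cat/= addnS -size_cat cat_take_drop. Qed.

Lemma size_remove (A : Type) j (s : seq A) : (j < size s)%N ->
  size (remove j s) = (size s).-1.
Proof. by move=> js; rewrite /remove size_cat size_take size_drop js; lia. Qed.

Lemma remove_insert (A : Type) j (z : A) s : (j <= size s)%N ->
  remove j (insert j z s) = s.
Proof.
move=> js; rewrite /remove /insert -cat1s catA.
have s1 : size (take j s) = j by rewrite size_takel.
rewrite -catA take_size_cat// drop_cat s1 ltnNge leqnSn/= subSnn/=.
by rewrite drop0 cat_take_drop.
Qed.

Lemma nth_insert (A : Type) (x0 : A) j (z : A) s : (j <= size s)%N ->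
  nth x0 (insert j z s) j = z.
Proof. by move=> js; rewrite /insert nth_cat size_takel// ltnn subnn. Qed.

Lemma perm_remove (A : eqType) (x0 : A) j (s : seq A) : (j < size s)%N ->
  perm_eq s (nth x0 s j :: remove j s).
Proof.
move=> js; rewrite -[s in perm_eq s](cat_take_drop j) (drop_nth x0)//.
by rewrite /remove -cat1s perm_catCA.
Qed.

Lemma map_insert (A B : Type) (f : A -> B) j z (s : seq A) :
  map f (insert j z s) = insert j (f z) (map f s).
Proof. by rewrite /insert map_cat/= map_take map_drop. Qed.

Lemma map_remove (A B : Type) (f : A -> B) j (s : seq A) :
  map f (remove j s) = remove j (map f s).
Proof. by rewrite /remove map_cat map_take map_drop. Qed.

Fixpoint grid (D n : nat) : seq (seq nat) :=
  if D is D'.+1 then [seq j :: v | j <- iota 0 n, v <- grid D' n]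
  else [:: [::]].

Lemma mem_grid D n v :
  (v \in grid D n) = (size v == D) && all (fun j => j < n)%N v.
Proof.
elim: D v => [|D IH] [|j v] //=.
  by apply/allpairsP => -[[a b] /= [_ _]].
apply/allpairsP/idP.
  move=> [[a b] /= [aP bP [-> ->]]].
  by move: aP bP; rewrite IH mem_iota/= add0n => -> /andP[/eqP-> ->]; rewrite eqxx.
move=> /andP[sv /andP[jn vn]]; exists (j, v) => /=; split => //.
  by rewrite mem_iota.
by rewrite IH -eqSS sv.
Qed.

Lemma size_grid D n : size (grid D n) = (n ^ D)%N.
Proof. by elim: D => //= D IH; rewrite size_allpairs size_iota IH expnS. Qed.

Section grid_sums.
Variable V : zmodType.

Lemma grid_sumS D n (F : seq nat -> V) :
  \sum_(v <- grid D.+1 n) F v =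
  \sum_(j <- iota 0 n) \sum_(v <- grid D n) F (j :: v).
Proof. by rewrite /= big_allpairs_dep. Qed.

Lemma grid_sum_insert D n j (F : seq nat -> V) : (j <= D)%N ->
  \sum_(v <- grid D.+1 n) F v =
  \sum_(z <- iota 0 n) \sum_(v <- grid D n) F (insert j z v).
Proof.
elim: j D F => [|j IH] D F jD.
  rewrite grid_sumS; apply: eq_bigr => z _; apply: eq_bigr => v _.
  by rewrite /insert take0 drop0.
case: D jD => // D jD; rewrite grid_sumS.
under eq_bigr do rewrite IH//.
rewrite exchange_big; apply: eq_bigr => z _.
by rewrite grid_sumS; apply: eq_bigr => x _; apply: eq_bigr.
Qed.

(** A lattice point of mesh [1 / (n k)] splits into the point [a] of mesh [1 / n]
    that indexes its cell and its position [e] inside the cell. *)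
Definition refine k (a e : seq nat) : seq nat :=
  [seq (x.1 * k + x.2)%N | x <- zip a e].

Lemma grid_sum_refine D n k (F : seq nat -> V) :
  \sum_(v <- grid D (n * k)) F v =
  \sum_(a <- grid D n) \sum_(e <- grid D k) F (refine k a e).
Proof.
elim: D F => [|D IH] F; first by rewrite !big_seq1.
rewrite !grid_sumS.
under eq_bigr do rewrite IH.
have iE m : iota 0 m = index_iota 0 m by rewrite /index_iota subn0.
rewrite iE big_nat_mul -iE.
rewrite [LHS](_ : _ = \sum_(j <- iota 0 n) \sum_(i <- iota 0 k)
    \sum_(a <- grid D n) \sum_(e <- grid D k)
      F ((j * k + i)%N :: refine k a e)); last first.
  rewrite !iE; apply: eq_bigr => j _.
  rewrite -{1}(add0n (j * k)%N) mulSnr big_addn addKn.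
  by apply: eq_bigr => i _; rewrite addnC.
apply: eq_bigr => j _; rewrite exchange_big/=; apply: eq_bigr => a _.
by rewrite grid_sumS.
Qed.

End grid_sums.

(** * Integer linear forms on grids *)

Fixpoint dot (c : nat -> int) (v : seq nat) : int :=
  if v is x :: v' then c 0%N * x%:Z + dot (c \o S) v' else 0.

Lemma dotD c c' v : dot (fun i => c i + c' i) v = dot c v + dot c' v.
Proof.
elim: v c c' => [|x v IH] c c' /=; first by rewrite addr0.
by rewrite (IH (c \o S) (c' \o S)) mulrDl addrACA.
Qed.

Lemma dot_unit s l v : dot (fun i => s * (i == l)%:Z) v = s * (nth 0%N v l)%:Z.
Proof.
elim: v l => [|x v IH] [|l] /=; rewrite ?mulr0 ?mulr1 ?mul0r ?add0r //.
  rewrite (_ : dot _ v = 0) ?addr0//.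
  by elim: v {IH} => //= y v ->; rewrite mulr0 mul0r.
exact: (IH l).
Qed.

Lemma dot_refine c k a e : size a = size e ->
  dot c (refine k a e) = k%:Z * dot c a + dot c e.
Proof.
elim: a e c => [|x a IH] [|y e] c //=; first by rewrite mulr0.
by move=> [/(IH _ (c \o S)) ->]; rewrite PoszD PoszM; ring.
Qed.

(** The Lipschitz constant of the form for the maximum norm: it bounds how far
    the form varies inside one cell, and vanishes exactly when the form does. *)
Definition mass (c : nat -> int) D : nat := (\sum_(i < D) `|c i|)%N.

Lemma dot_bound c D n v : v \in grid D n -> `|dot c v| <= (mass c D * n)%:Z.
Proof.
rewrite mem_grid => /andP[/eqP <-]; elim: v c => [|x v IH] c //= /andP[xn vn].
rewrite /mass big_ord_recl mulnDl.
rewrite PoszD (le_trans (ler_normD _ _))// lerD ?IH//.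
by rewrite normrM PoszM abszE ler_wpM2l//= ltW.
Qed.

Lemma dot_mass0 c D v : size v = D -> mass c D = 0%N -> dot c v = 0.
Proof.
move=> <-; elim: v c => [|x v IH] c //=.
rewrite /mass big_ord_recl => /eqP; rewrite addn_eq0 absz_eq0.
by move=> /andP[/eqP -> /eqP m0]; rewrite mul0r add0r IH.
Qed.

Lemma sum_eqz_le1 (R : numDomainType) (a b : int) n : a != 0 ->
  \sum_(j <- iota 0 n) (a * j%:Z == b)%:R <= 1 :> R.
Proof.
move=> a0; elim: n => [|n IH]; first by rewrite big_nil.
rewrite -addn1 iotaD big_cat/= big_seq1 add0n.
have [an|] := eqVneq (a * n%:Z) b; last by rewrite addr0.
rewrite big_seq big1 ?add0r// => j; rewrite mem_iota add0n => /andP[_ jn].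
rewrite -an; case: eqP => // /(mulfI a0) [] jE; by rewrite jE ltnn in jn.
Qed.

(** A nonzero integer form determines one coordinate from the others and
    from its value. *)
Lemma grid_level_le (R : numDomainType) c D n (z : int) : mass c D.+1 != 0%N ->
  \sum_(v <- grid D.+1 n) (dot c v == z)%:R <= n%:R ^+ D :> R.
Proof.
elim: D c z => [|D IH] c z.
  rewrite /mass big_ord1 => c0; rewrite grid_sumS expr0.
  under eq_bigr do rewrite big_seq1/= addr0.
  by apply: sum_eqz_le1; rewrite absz_eq0 in c0.
rewrite /mass big_ord_recl addn_eq0 negb_and absz_eq0 grid_sumS.
have [c0 /= mc|c0 _] := eqVneq (c ord0) 0.
  apply: (@le_trans _ _ (\sum_(j <- iota 0 n) n%:R ^+ D)).
    apply: ler_sum => j _ /=; under eq_bigr do rewrite c0 mul0r add0r.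
    exact: IH.
  rewrite big_const_seq count_predT size_iota iter_addr_0 exprS.
  by rewrite mulr_natl.
rewrite exchange_big/=.
apply: (@le_trans _ _ (\sum_(v <- grid D.+1 n) 1)).
  apply: ler_sum => v _.
  apply: le_trans (@sum_eqz_le1 R _ (z - dot (c \o S) v) n c0).
  by apply: ler_sum => j _; rewrite [X in _ <= (nat_of_bool X)%:R]eq_sym subr_eq eq_sym.
by rewrite big_const_seq count_predT size_grid iter_addr_0 natrX.
Qed.

Definition irange (Q : nat) : seq int := [seq i%:Z - Q%:Z | i <- iota 0 (2 * Q).+1].

Lemma mem_irange Q (z : int) : (z \in irange Q) = (`|z| <= Q%:Z).
Proof.
apply/mapP/idP => [[j]|zQ].
  by rewrite mem_iota => jQ ->; lia.
by exists (absz (z + Q%:Z)); rewrite ?mem_iota; lia.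
Qed.

(** Bounding the multiple by [Q] makes this a finite disjunction, so that its
    instances can be counted level by level. *)
Definition near_multiple (n Q K : nat) (z : int) : bool :=
  has (fun q => has (fun r => z == n%:Z * q + r) (irange K)) (irange Q).

Lemma near_multipleP n Q K z q r : `|q| <= Q%:Z -> `|r| <= K%:Z ->
  z = n%:Z * q + r -> near_multiple n Q K z.
Proof.
rewrite -!mem_irange => qQ rK zE; apply/hasP; exists q => //.
by apply/hasP; exists r => //; exact/eqP.
Qed.

Lemma has_le_sum (R : numDomainType) (A : Type) (p : pred A) s :
  (has p s)%:R <= \sum_(x <- s) (p x)%:R :> R.
Proof.
elim: s => [|x s IH]; first by rewrite big_nil.
rewrite big_cons /=; case: (p x) => /=; last by rewrite add0r.
by rewrite lerDl sumr_ge0.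
Qed.

Lemma near_multiple_count (R : numDomainType) c D n Q K : mass c D.+1 != 0%N ->
  \sum_(v <- grid D.+1 n) (near_multiple n Q K (dot c v))%:R <=
  ((2 * Q).+1 * (2 * K).+1)%:R * n%:R ^+ D :> R.
Proof.
move=> mc; apply: (@le_trans _ _ (\sum_(v <- grid D.+1 n)
    \sum_(q <- irange Q) \sum_(r <- irange K) (dot c v == n%:Z * q + r)%:R)).
  apply: ler_sum => v _; apply: le_trans (has_le_sum _ _ _) _.
  by apply: ler_sum => q _; exact: has_le_sum.
rewrite exchange_big/=; under eq_bigr do rewrite exchange_big/=.
apply: (@le_trans _ _ (\sum_(q <- irange Q) \sum_(r <- irange K) n%:R ^+ D)).
  by apply: ler_sum => q _; apply: ler_sum => r _; exact: grid_level_le.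
rewrite !big_const_seq !count_predT !size_map !size_iota !iter_addr_0.
by rewrite -mulrnA mulnC mulr_natl.
Qed.

(** The cell of a lattice point [a] is cut into the points [refine k a e]; a
    form crosses a multiple of the mesh inside that cell only if its value at
    [a] is within its mass of such a multiple. *)
Lemma floor_refine c D n k a e : (0 < n)%N -> (0 < k)%N ->
  a \in grid D n -> e \in grid D k ->
  ~~ near_multiple n (mass c D).+1 (mass c D) (dot c a) ->
  (dot c (refine k a e) %/ (n * k)%:Z)%Z = (dot c a %/ n%:Z)%Z.
Proof.
move=> n0 k0 an ek /negP nnear.
have sae : size a = size e.
  by move: an ek; rewrite !mem_grid => /andP[/eqP-> _] /andP[/eqP->].
rewrite dot_refine//.
have := dot_bound c an; have := dot_bound c ek.
move: (mass c D) (dot c a) (dot c e) nnear => K z f nnear fK zK.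
have nz0 : n%:Z != 0 by lia.
have zE := divz_eq z n%:Z; have r0 := modz_ge0 z nz0.
have rn : (z %% n%:Z)%Z < n%:Z by rewrite ltz_pmod// ltz_nat.
move: (z %/ n%:Z)%Z (z %% n%:Z)%Z zE r0 rn => q r zE r0 rn.
have qK : `|q| <= K%:Z by nia.
(* Away from the multiples of [n], the remainder leaves room [K] on both sides for
   the variation of the form inside the cell. *)
have Kr : K%:Z < r.
  rewrite ltNge; apply/negP => rK; apply: nnear.
  by apply: (@near_multipleP _ _ _ _ q r); lia.
have rKn : r < n%:Z - K%:Z.
  rewrite ltNge; apply/negP => rK; apply: nnear.
  by apply: (@near_multipleP _ _ _ _ (q + 1) (r - n%:Z)); lia.
rewrite (_ : _ + f = q * (n * k)%:Z + (k%:Z * r + f)); last first.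
  by rewrite zE PoszM; ring.
rewrite divzMDl; last by lia.
by rewrite divz_small ?addr0//; nia.
Qed.

(** * Averages over lattice points of a cube *)

Section lattice_averages.
Variable R : realType.

Definition floors (cs : seq (nat -> int)) (n : nat) (v : seq nat) : seq int :=
  [seq (dot c v %/ n%:Z)%Z | c <- cs].

Definition lattice_average D n (F : seq nat -> R) : R :=
  (n%:R ^+ D)^-1 * \sum_(v <- grid D n) F v.

Lemma lattice_average_norm D n (F : seq nat -> R) :
  (forall v, v \in grid D n -> `|F v| <= 1) -> `|lattice_average D n F| <= 1.
Proof.
move=> F1; rewrite normrM ger0_norm ?invr_ge0 ?exprn_ge0//.
have [->|n0] := eqVneq (n%:R ^+ D : R) 0; first by rewrite invr0 mul0r.
rewrite ler_pdivrMl ?lt0r ?n0 ?exprn_ge0// mulr1.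
apply: le_trans (ler_norm_sum _ _ _) _.
apply: (@le_trans _ _ (\sum_(v <- grid D n) 1)).
  by rewrite big_seq [leRHS]big_seq; exact: ler_sum.
by rewrite big_const_seq count_predT size_grid iter_addr_0 natrX.
Qed.

(** The sum, over the forms, of the number of levels in [near_multiple]. *)
Definition boundary_const D (cs : seq (nat -> int)) : R :=
  \sum_(c <- cs) ((2 * (mass c D).+1).+1 * (2 * mass c D).+1)%:R.

Lemma boundary_const_ge0 D cs : 0 <= boundary_const D cs.
Proof. exact: sumr_ge0. Qed.

(** Zero forms are left out: they have constant floors, while their value is
    near a multiple of the mesh everywhere. *)
Definition near_boundary D n (cs : seq (nat -> int)) (v : seq nat) : bool :=
  has (fun c => (mass c D != 0%N) &&
    near_multiple n (mass c D).+1 (mass c D) (dot c v)) cs.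

(** Each level of a nonzero form contains at most a fraction [1 / n] of the grid.
    The factor [n] stands on the left to keep the statement free of division. *)
Lemma near_boundary_count D n cs :
  n%:R * \sum_(v <- grid D n) (near_boundary D n cs v)%:R <=
  boundary_const D cs * n%:R ^+ D.
Proof.
apply: (@le_trans _ _ (n%:R * \sum_(v <- grid D n) \sum_(c <- cs)
  ((mass c D != 0%N) &&
    near_multiple n (mass c D).+1 (mass c D) (dot c v))%:R)).
  by rewrite ler_wpM2l//; apply: ler_sum => v _; exact: has_le_sum.
rewrite exchange_big/= mulr_sumr mulr_suml; apply: ler_sum => c _.
have [->|c0] := eqVneq (mass c D) 0%N.
  by rewrite big1 ?mulr0 ?mulr_ge0 ?exprn_ge0.
case: D c0 => [|D] c0; first by rewrite /mass big_ord0 in c0.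
rewrite exprS mulrCA ler_wpM2l//=; exact: near_multiple_count.
Qed.

Lemma floors_refine D n k cs a e : (0 < n)%N -> (0 < k)%N ->
  a \in grid D n -> e \in grid D k -> ~~ near_boundary D n cs a ->
  floors cs (n * k) (refine k a e) = floors cs n a.
Proof.
move=> n0 k0 an ek; rewrite /floors /near_boundary.
elim: cs => //= c cs IH; rewrite negb_or => /andP[nc /IH ->]; congr (_ :: _).
move: nc; have [c0 _|_ /= nc] := eqVneq (mass c D) 0%N.
  move: an ek; rewrite !mem_grid => /andP[/eqP sa _] /andP[/eqP se _].
  have sr : size (refine k a e) = D by rewrite size_map size_zip sa se minnn.
  by rewrite !(dot_mass0 _ c0)// !div0z.
exact: (floor_refine n0 k0 an ek).
Qed.

Lemma lattice_average_refine D n k cs (G : seq int -> R) :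
  (forall s, `|G s| <= 1) -> (0 < n)%N -> (0 < k)%N ->
  `|lattice_average D (n * k) (G \o floors cs (n * k)) -
    lattice_average D n (G \o floors cs n)| <=
  2 * boundary_const D cs / n%:R.
Proof.
move=> G1 n0 k0; have nR : 0 < n%:R :> R by rewrite ltr0n.
have kR : 0 < k%:R :> R by rewrite ltr0n.
rewrite /lattice_average grid_sum_refine natrM exprMn.
rewrite (_ : _ - _ = (n%:R ^+ D * k%:R ^+ D)^-1 *
    \sum_(a <- grid D n) \sum_(e <- grid D k)
      (G (floors cs (n * k) (refine k a e)) - G (floors cs n a))); last first.
  under [in RHS]eq_bigr do rewrite sumrB.
  rewrite sumrB mulrBr; congr (_ - _).
  under [in RHS]eq_bigr => a _.
    rewrite big_const_seq count_predT size_grid iter_addr_0 -mulr_natl natrX.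
    over.
  rewrite -mulr_sumr mulrA invfM divfK//.
  by rewrite expf_neq0// gt_eqF.
rewrite normrM ger0_norm ?invr_ge0 ?mulr_ge0 ?exprn_ge0//.
rewrite ler_pdivrMl ?mulr_gt0 ?exprn_gt0//.
apply: le_trans (ler_norm_sum _ _ _) _.
apply: (@le_trans _ _ (\sum_(a <- grid D n) (k%:R ^+ D * 2) *
   (near_boundary D n cs a)%:R)).
  rewrite big_seq [leRHS]big_seq; apply: ler_sum => a an.
  apply: le_trans (ler_norm_sum _ _ _) _.
  apply: (@le_trans _ _ (\sum_(e <- grid D k) 2 * (near_boundary D n cs a)%:R)).
    rewrite big_seq [leRHS]big_seq; apply: ler_sum => e ek.
    case: (boolP (near_boundary D n cs a)) => [_|nb]; rewrite ?mulr1 ?mulr0.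
      by rewrite (le_trans (ler_normB _ _))// (le_trans (lerD (G1 _) (G1 _))).
    by rewrite (floors_refine n0 k0 an ek nb) subrr normr0.
  by rewrite big_const_seq count_predT size_grid iter_addr_0
    -[_ *+ (_ ^ _)%N]mulr_natl natrX mulrA.
rewrite -mulr_sumr.
have := near_boundary_count D n cs; move: (\sum_(v <- _) _) => S nS.
rewrite -(ler_pM2l nR) mulrCA.
rewrite (_ : n%:R * (_ * _) = (k%:R ^+ D * 2) * (boundary_const D cs * n%:R ^+ D)).
  by rewrite ler_wpM2l// mulr_ge0 ?exprn_ge0.
by field; rewrite gt_eqF.
Qed.

(** The sequence is Cauchy: two meshes are compared through their common
    refinement, and the bound for one refinement depends on the coarse mesh
    only. *)
Lemma lattice_average_cvg D cs (G : seq int -> R) :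
  (forall s, `|G s| <= 1) ->
  cvgn (fun n => lattice_average D n.+1 (G \o floors cs n.+1)).
Proof.
move=> G1; set u := fun n => _; set B := 2 * boundary_const D cs.
have B0 : 0 <= B by rewrite mulr_ge0// boundary_const_ge0.
have uE n m : `|u m - u n| <= B / m.+1%:R + B / n.+1%:R.
  have h1 := @lattice_average_refine D m.+1 n.+1 cs G G1 isT isT.
  have h2 := @lattice_average_refine D n.+1 m.+1 cs G G1 isT isT.
  rewrite mulnC in h2; apply: le_trans (lerD h1 h2).
  rewrite -/(u n) -/(u m); set x := lattice_average _ _ _.
  by rewrite (_ : u m - u n = - (x - u m) + (x - u n)) ?(le_trans (ler_normD _ _)) ?normrN//; ring.
apply/cauchy_cvgP; apply: cauchy_exP => e e0.
(* Any index with boundary error below [e / 2] serves as centre of a ball that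
   contains the tail of the sequence. *)
have [N NP] : exists N : nat, B / N.+1%:R < e / 2.
  exists (Num.truncn (B / (e / 2))).
  by rewrite ltr_pdivrMr// mulrC -ltr_pdivrMr ?divr_gt0// truncnS_gt.
exists (u N); rewrite -ball_normE.
suff : \forall n \near \oo, `|u N - u n| < e by [].
near=> n.
apply: le_lt_trans (uE n N) _; rewrite [ltRHS]splitr ltr_leD//.
apply: le_trans (ltW NP); rewrite ler_wpM2l// lef_pV2 ?posrE ?ltr0n// ler_nat ltnS.
by near: n; exists N.
Unshelve. all: by end_near. Qed.

(** A congruence modulo the mesh imposed on a nonzero form loses a factor of
    the mesh. *)
Lemma lattice_average_congr_cvg0 D c (F : nat -> seq nat -> R) :
  mass c D != 0%N ->
  (forall n v, v \in grid D n.+1 -> `|F n v| <= (n.+1%:Z %| dot c v)%Z%:R) ->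
  lattice_average D n.+1 (F n) @[n --> \oo] --> (0 : R).
Proof.
case: D => [|D] mc FP; first by rewrite /mass big_ord0 in mc.
set K := mass c D.+1; set B : R := ((2 * K).+1 * (2 * 0).+1)%:R.
have FB n : `|lattice_average D.+1 n.+1 (F n)| <= B / n.+1%:R.
  rewrite normrM ger0_norm ?invr_ge0 ?exprn_ge0//.
  rewrite ler_pdivrMl ?exprn_gt0 ?ltr0n//.
  rewrite (_ : _ * (B / _) = B * n.+1%:R ^+ D); last first.
    by rewrite exprSr -mulrA [_ * (B / _)]mulrCA divff ?pnatr_eq0// mulr1 mulrC.
  apply: le_trans (@near_multiple_count R c D n.+1 K 0 mc).
  apply: le_trans (ler_norm_sum _ _ _) _.
  rewrite big_seq [leRHS]big_seq; apply: ler_sum => v vn.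
  apply: le_trans (FP _ _ vn) _; rewrite ler_nat.
  case: (boolP (_ %| _)%Z) => //= /dvdzP[q qE].
  rewrite (@near_multipleP _ _ _ _ q 0)//; last by rewrite qE; ring.
  have := dot_bound c vn; rewrite -/K qE; nia.
apply/cvgrPdist_lt => e e0; near=> n.
rewrite sub0r normrN; apply: le_lt_trans (FB n) _.
rewrite ltr_pdivrMr ?ltr0n// mulrC -ltr_pdivrMr//.
rewrite (@lt_le_trans _ _ (Num.truncn (B / e)).+1%:R) ?truncnS_gt// ler_nat ltnS.
by near: n; exists (Num.truncn (B / e)).
Unshelve. all: by end_near. Qed.

End lattice_averages.

(** * Pairings and Wick sums *)

(** A pairing of [p] points is encoded by listing, for the first unpaired point
    again and again, the position of its partner among the other points that
    are still unpaired. *)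
Fixpoint codes (p : nat) : seq (seq nat) :=
  match p with
  | 0 => [:: [::]]
  | 1 => [::]
  | p'.+2 => [seq j :: J | j <- iota 0 p'.+1, J <- codes p']
  end.

Fixpoint wfcode (J : seq nat) : bool :=
  if J is j :: J' then (j < (size J').*2.+1)%N && wfcode J' else true.

Lemma codesSS p :
  codes p.+2 = [seq j :: J | j <- iota 0 p.+1, J <- codes p].
Proof. by []. Qed.

Lemma mem_codes p J : J \in codes p -> wfcode J /\ (size J).*2 = p.
Proof.
have [n] := ubnP p; elim: n p J => // n IH [|[|p]] J pn //.
  by rewrite inE => /eqP ->.
move=> /allpairsP[[j J'] [/[!mem_iota] /andP[_ jP] J'P ->]].
have [|wf sJ] := IH p J' _ J'P; first by lia.
by rewrite [wfcode _]/= wf sJ doubleS sJ andbT.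
Qed.

Fixpoint odd_fact (m : nat) : nat := if m is k.+1 then (k.*2.+1 * odd_fact k)%N else 1.

Lemma size_codes m : size (codes m.*2) = odd_fact m.
Proof.
elim: m => // m IH; rewrite doubleS.
by rewrite [LHS]size_allpairs size_iota IH.
Qed.

Section wick.
Variable R : numDomainType.

Fixpoint weight (A : Type) (c : A -> A -> R) (J : seq nat) (s : seq A) : R :=
  match J, s with
  | [::], [::] => 1
  | j :: J', x :: s' => c x (nth x s' j) * weight c J' (remove j s')
  | _, _ => 0
  end.

Definition wick (A : Type) (c : A -> A -> R) (s : seq A) : R :=
  \sum_(J <- codes (size s)) weight c J s.

Lemma wick_cons (A : Type) (c : A -> A -> R) x s :
  wick c (x :: s) =
  \sum_(j <- iota 0 (size s)) c x (nth x s j) * wick c (remove j s).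
Proof.
case: s => [|y s]; first by rewrite /wick/= !big_nil.
rewrite /wick; set t := y :: s.
rewrite [LHS](_ : _ = \sum_(J <- codes (size s).+2) weight c J (x :: t))//.
rewrite codesSS big_allpairs_dep big_seq [RHS]big_seq.
apply: eq_bigr => j; rewrite mem_iota => /andP[_ js].
by rewrite mulr_sumr size_remove//; apply: eq_bigr.
Qed.

Lemma weight_map (A B : Type) (f : B -> A) (c : A -> A -> R) J s :
  weight c J (map f s) = weight (fun x y => c (f x) (f y)) J s.
Proof.
elim: J s => [|j J IH] [|x s] //=; rewrite -map_remove IH; congr (c _ _ * _).
by elim: s j => [|y s IHs] [|j] //=; rewrite ?nth_nil//.
Qed.

Lemma weight_mul (A : Type) (c c' : A -> A -> R) J s :
  weight (fun x y => c x y * c' x y) J s = weight c J s * weight c' J s.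
Proof.
elim: J s => [|j J IH] [|x s] //=; rewrite ?mulr1 ?mulr0//.
by rewrite IH mulrACA.
Qed.

Lemma weight_const (A : Type) (k : R) J (s : seq A) : wfcode J ->
  size s = (size J).*2 -> weight (fun _ _ => k) J s = k ^+ size J.
Proof.
elim: J s => [|j J IH] [|x s] //= /andP[jJ wJ] [sJ].
by rewrite IH ?exprS// size_remove sJ.
Qed.

Lemma weight_norm_le1 (A : Type) (c : A -> A -> R) J s :
  (forall x y, `|c x y| <= 1) -> `|weight c J s| <= 1.
Proof.
move=> c1; elim: J s => [|j J IH] [|x s] //=; rewrite ?normr0 ?normr1//.
by rewrite normrM mulr_ile1.
Qed.

Lemma wick_norm (A : Type) (c : A -> A -> R) k s :
  (forall x y, `|c x y| <= k) -> 0 <= k ->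
  `|wick c s| <= (size (codes (size s)))%:R * k ^+ (size s)./2.
Proof.
move=> ck k0; apply: le_trans (ler_norm_sum _ _ _) _.
apply: (@le_trans _ _ (\sum_(J <- codes (size s)) k ^+ (size s)./2)); last first.
  by rewrite big_const_seq count_predT iter_addr_0 mulr_natl.
rewrite big_seq [leRHS]big_seq; apply: ler_sum => J /mem_codes[_].
move=> /(congr1 half); rewrite doubleK => <-.
elim: J s => [|j J IH] [|x s] //=; rewrite ?normr0 ?normr1 ?mulr_ge0 ?exprn_ge0//.
by rewrite normrM exprS ler_pM.
Qed.

End wick.

(** Assigns one value to each pair and spreads it to the two points of the pair:
    the sequences constant on the pairs of the pairing. *)
Fixpoint expand (A : Type) (J : seq nat) (s : seq A) : seq A :=
  match J, s with
  | j :: J', x :: s' => x :: insert j x (expand J' s')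
  | _, _ => [::]
  end.

Lemma size_expand (A : Type) J (s : seq A) : size s = size J ->
  size (expand J s) = (size J).*2.
Proof.
by elim: J s => [|j J IH] [|x s] //= [sJ]; rewrite size_insert IH.
Qed.

Lemma map_expand (A B : Type) (f : A -> B) J s :
  map f (expand J s) = expand J (map f s).
Proof. by elim: J s => [|j J IH] [|x s] //=; rewrite map_insert IH. Qed.

Lemma sum_iota_eq (R : numDomainType) n j (F : nat -> R) : (j < n)%N ->
  \sum_(z <- iota 0 n) (j == z)%:R * F z = F j.
Proof.
move=> jn; rewrite (bigD1_seq j)/= ?mem_iota ?iota_uniq//=.
by rewrite eqxx mul1r big1 ?addr0// => z /negPf zj; rewrite eq_sym zj mul0r.
Qed.

(** The weight is the indicator of being constant on pairs, and such a sequence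
    is determined by its value on each pair. *)
Lemma grid_sum_expand (R : numDomainType) J n (H : seq nat -> R) : wfcode J ->
  \sum_(d <- grid (size J).*2 n) weight (fun x y => (x == y)%:R) J d * H d =
  \sum_(e <- grid (size J) n) H (expand J e).
Proof.
elim: J H => [|j J IH] H; first by rewrite /= !big_seq1 mul1r.
move=> /andP[jJ wJ]; rewrite [size _]/= doubleS !grid_sumS big_seq [RHS]big_seq.
apply: eq_bigr => x; rewrite mem_iota add0n => /andP[_ xn].
rewrite (@grid_sum_insert _ (size J).*2 n j)//.
rewrite -(IH (fun d => H (x :: insert j x d)))//.
rewrite exchange_big big_seq [RHS]big_seq; apply: eq_bigr => d.
rewrite mem_grid => /andP[/eqP sd _].
under eq_bigr do rewrite /= remove_insert ?sd// nth_insert ?sd// -mulrA.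
by rewrite (sum_iota_eq (fun z => weight _ J d * H (x :: insert j z d))).
Qed.

(** * Functionals that agree with Wick sums *)

Lemma mem_remove (A : eqType) (x0 : A) (s : seq A) j z :
  (z < size s)%N -> z != j -> nth x0 s z \in remove j s.
Proof.
rewrite /remove mem_cat neq_ltn => zs /orP[zj|jz].
  by rewrite -(nth_take x0 zj) mem_nth// size_take_min leq_min zj.
rewrite orbC (_ : nth _ _ _ = nth x0 (drop j.+1 s) (z - j.+1)).
  by rewrite mem_nth// size_drop ltn_sub2r// (leq_ltn_trans jz).
by rewrite nth_drop subnKC.
Qed.

(** An expectation of products, abstracted to what the pairing argument uses:
    factors with different keys are independent, lone factors are centered and
    [c] is the covariance. All this is required only of factors
    satisfying [ok]. *)
Section moment_functional.
Variables (R : numDomainType) (A : eqType) (ok : pred A) (key : A -> nat).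
Variables (F : seq A -> R) (c : A -> A -> R).
Hypothesis F_perm : forall s t, perm_eq s t -> F s = F t.
Hypothesis F_nil : F [::] = 1.
Hypothesis F_lone : forall x s, all ok (x :: s) -> key x \notin map key s ->
  F (x :: s) = 0.
Hypothesis F_pair : forall x y s, all ok [:: x, y & s] -> key x = key y ->
  key x \notin map key s ->
  F [:: x, y & s] = c x y * F s.
Hypothesis c_key : forall x y, key x != key y -> c x y = 0.

Let count_remove (k : nat) x s j : (j < size s)%N ->
  count_mem k (map key s) =
  ((key (nth x s j) == k) + count_mem k (map key (remove j s)))%N.
Proof. by move=> js; have /(perm_map key)/permP -> := perm_remove x js. Qed.

Let ok_remove s j (x : A) : (j < size s)%N -> all ok s -> all ok (remove j s).
Proof.
by move=> js; rewrite (perm_all _ (perm_remove x js)) => /andP[].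
Qed.

(** If no key occurs three times, a single pairing can match equal keys; both
    sides vanish when some key is alone. *)
Lemma wick_matches s : all ok s -> (forall k, (count_mem k (map key s) <= 2)%N) ->
  F s = wick c s.
Proof.
have [n] := ubnP (size s); elim: n s => // n IH [|x s] sn oks cs.
  by rewrite F_nil /wick big_seq1.
have IHr j : (j < size s)%N -> F (remove j s) = wick c (remove j s).
  move=> js; apply: IH => [||k].
  - by rewrite size_remove//=; move: sn => /=; lia.
  - by case/andP: oks => _; exact: (ok_remove x).
  by apply: leq_trans (cs k); rewrite /= (count_remove k x js) addnA leq_addl.
rewrite wick_cons; have [kx|kx] := boolP (key x \in map key s); last first.
  rewrite F_lone// big_seq big1// => j; rewrite mem_iota add0n => /andP[_ js].
  rewrite c_key ?mul0r//; apply: contra kx => /eqP ->.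
  by apply: map_f; exact: mem_nth.
have /mapP[y ys xy] := kx; pose j := index y s.
have js : (j < size s)%N by rewrite index_mem.
have ny : nth x s j = y by rewrite nth_index.
have ps := perm_remove x js; rewrite ny in ps.
have kr : key x \notin map key (remove j s).
  apply/count_memPn; have := cs (key x).
  by rewrite /= (count_remove _ x js) ny -xy !eqxx !add1n !ltnS leqn0 => /eqP.
have -> : F (x :: s) = F [:: x, y & remove j s].
  by apply: F_perm; rewrite perm_cons.
rewrite F_pair//; last by move: oks; rewrite /= (perm_all _ ps).
rewrite (bigD1_seq j) ?mem_iota ?iota_uniq//= ny IHr//.
rewrite big_seq_cond big1 ?addr0// => z /andP[]; rewrite mem_iota add0n.
move=> /andP[_ zs] zj; rewrite c_key ?mul0r//.
by apply: contra kr => /eqP ->; apply: map_f; exact: mem_remove.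
Qed.

Lemma wick_lone s k : all ok s -> count_mem k (map key s) = 1%N -> F s = 0 /\ wick c s = 0.
Proof.
move=> oks ck; split.
  have /mapP[x xs kE] : k \in map key s by rewrite -has_pred1 has_count ck.
  have ps := perm_to_rem xs; rewrite (F_perm ps) F_lone//.
    by rewrite -(perm_all _ ps).
  rewrite -kE.
  apply/count_memPn; move: ck; have /(perm_map key)/permP -> := ps.
  by rewrite /= -kE eqxx add1n => -[].
have [n] := ubnP (size s); elim: n s ck {oks} => // n IH [|x s]//= ck sn.
rewrite wick_cons big_seq big1// => j; rewrite mem_iota add0n => /andP[_ js].
have [kxj|] := eqVneq (key x) (key (nth x s j)); last first.
  by move=> kxj; rewrite c_key ?mul0r.
rewrite IH ?mulr0//; last by rewrite size_remove//; lia.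
move: ck; rewrite (count_remove k x js) -kxj.
by case: (key x == k).
Qed.

(** [F] and the Wick sum agree unless every key occurs at least twice and some
    key three times, which leaves fewer than half as many keys as factors. *)
Lemma wick_defect s : all ok s -> F s != wick c s -> ((size (undup (map key s))).*2 < size s)%N.
Proof.
move=> oks Fs; set ks := map key s.
have c2 k : k \in undup ks -> (2 <= count_mem k ks)%N.
  rewrite mem_undup -has_pred1 has_count leq_eqVlt => /orP[/eqP ck|//].
  by have [F0 w0] := wick_lone oks (esym ck); rewrite F0 w0 eqxx in Fs.
have [k0 k3] : exists k, (2 < count_mem k ks)%N.
  apply/not_existsP => h; case/eqP: Fs; apply: wick_matches => // k.
  by rewrite leqNgt; apply/negP/h.
have -> : size s = (\sum_(k <- undup ks) count_mem k ks)%N.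
  rewrite -(size_map key) -/ks -(perm_size (perm_count_undup ks)) size_flatten.
  rewrite sumnE !big_map; apply: eq_bigr => k _; by rewrite size_nseq.
have k0u : k0 \in undup ks.
  by rewrite mem_undup -has_pred1 has_count; apply: leq_trans k3.
rewrite (bigD1_seq k0) ?undup_uniq//=.
rewrite -muln2 mulnC -sum1_size big_distrr/= (bigD1_seq k0) ?undup_uniq//=.
rewrite -addSn leq_add// big_seq_cond [leqRHS]big_seq_cond.
by apply: leq_sum => k /andP[ku _]; exact: c2.
Qed.

End moment_functional.

Lemma sum_iota_mem_le (R : numDomainType) n (v : seq nat) :
  \sum_(j <- iota 0 n) (j \in v)%:R <= (size v)%:R :> R.
Proof.
rewrite -natr_sum ler_nat -big_mkcond sum1_count -size_filter.
apply: uniq_leq_size => [|j]; first by rewrite filter_uniq ?iota_uniq.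
by rewrite mem_filter => /andP[].
Qed.

(** Induction on the length: a new entry either repeats one of at most [p]
    earlier values, or takes one of [n] values and adds to the number of
    distinct ones. *)
Lemma grid_undup_count (R : numDomainType) p n r :
  \sum_(d <- grid p n) (size (undup d) == r)%:R <= (p`!)%:R * n%:R ^+ r :> R.
Proof.
elim: p r => [|p IH] r.
  rewrite big_seq1/= fact0 mul1r; case: r => [|r]/=; first by rewrite expr0.
  by rewrite exprn_ge0.
rewrite grid_sumS.
apply: (@le_trans _ _ (\sum_(j <- iota 0 n) \sum_(v <- grid p n)
   ((j \in v)%:R * (size (undup v) == r)%:R + ((size (undup v)).+1 == r)%:R))).
  apply: ler_sum => j _; apply: ler_sum => v _ /=.
  case: ifP => _; first by rewrite mul1r lerDl.
  by rewrite mul0r add0r.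
under eq_bigr do rewrite big_split/=.
rewrite big_split/= factS natrM -addn1 natrD mulrDl mulrDl mul1r lerD//.
  rewrite exchange_big/=; apply: (@le_trans _ _
      (\sum_(v <- grid p n) p%:R * (size (undup v) == r)%:R)).
    rewrite big_seq [leRHS]big_seq; apply: ler_sum => v.
    rewrite mem_grid => /andP[/eqP sv _]; rewrite -mulr_suml ler_wpM2r//.
    by rewrite -[in leRHS]sv sum_iota_mem_le.
  by rewrite -mulr_sumr -mulrA ler_wpM2l.
rewrite big_const_seq count_predT size_iota iter_addr_0 -[X in X <= _]mulr_natl.
case: r => [|r]; first by rewrite big1// mulr0 mulr_ge0.
under eq_bigr do rewrite eqSS.
by rewrite exprS mulrCA ler_wpM2l.
Qed.

(** A tuple with [r] distinct values, [2 r < p], costs [n ^ r]; as [2 r <= p - 1]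
    this is smaller than [sqrt n ^ p] by a factor [sqrt n]. *)
Lemma grid_defect_count (R : realType) p n : (0 < n)%N ->
  Num.sqrt n%:R * \sum_(d <- grid p n) ((size (undup d)).*2 < p)%:R <=
  (p * p`!)%:R * Num.sqrt n%:R ^+ p :> R.
Proof.
move=> n0; set q : R := Num.sqrt n%:R.
have q0 : 0 <= q by exact: sqrtr_ge0.
have q2 : q ^+ 2 = n%:R by rewrite sqr_sqrtr.
have q1 : 1 <= q by rewrite -sqrtr1 ler_sqrt// ler1n.
apply: (@le_trans _ _ (q * \sum_(d <- grid p n) \sum_(r <- iota 0 p)
    (r.*2 < p)%:R * (size (undup d) == r)%:R)).
  rewrite ler_wpM2l//; apply: ler_sum => d _; case: ltnP => [dp|_]; last first.
    by apply: sumr_ge0 => r _; rewrite mulr_ge0.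
  rewrite (bigD1_seq (size (undup d))) ?iota_uniq ?mem_iota//=; last first.
    by rewrite add0n (leq_ltn_trans _ dp)// -addnn leq_addr.
  by rewrite dp eqxx mulr1 lerDl sumr_ge0// => r _; rewrite mulr_ge0.
rewrite exchange_big mulr_sumr.
apply: (@le_trans _ _ (\sum_(r <- iota 0 p) (p`!)%:R * q ^+ p)); last first.
  by rewrite big_const_seq count_predT size_iota iter_addr_0 natrM -mulrA
    [leRHS]mulr_natl.
apply: ler_sum => r _; rewrite -mulr_sumr.
case: ltnP => [rp|_]; last by rewrite mul0r mulr0 mulr_ge0 ?exprn_ge0.
rewrite mul1r; apply: le_trans (ler_wpM2l q0 (grid_undup_count _ _ _ _)) _.
by rewrite mulrCA ler_wpM2l// -q2 -exprM -exprS ler_weXn2l// mul2n.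
Qed.

(** * Closed walks and their averages *)

(** A letter is a pair of booleans: the first is true for the circulant variable
    and false for the skew-circulant one, the second marks adjoints. *)
Definition dir (l : bool * bool) : int := if l.2 then -1 else 1.

Fixpoint walk (y : int) (w : seq (bool * bool)) (d : seq nat) : seq int :=
  match w, d with
  | l :: w', j :: d' => y :: walk (y + dir l * j%:Z) w' d'
  | _, _ => [:: y]
  end.

Fixpoint drift (w : seq (bool * bool)) (d : seq nat) : int :=
  match w, d with
  | l :: w', j :: d' => dir l * j%:Z + drift w' d'
  | _, _ => 0
  end.

Lemma last_walk z y w d : last z (walk y w d) = y + drift w d.
Proof.
elim: w y d z => [|l w IH] y [|j d] z //=; rewrite ?addr0//.
by rewrite IH addrA.
Qed.

Lemma walk_head y w d : head 0 (walk y w d) = y.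
Proof. by case: w d => [|l w] [|j d]. Qed.

Lemma drift_insert l j x e w : (j < size w)%N -> size e = (size w).-1 ->
  drift w (insert j x e) = dir (nth l w j) * x%:Z + drift (remove j w) e.
Proof.
elim: j w e => [|j IH] [|k w] e //=; rewrite ?ltnS => jw.
  by rewrite /insert /remove take0 drop0/= drop0.
case: w jw => [|k' w] // jw; case: e => [|y e] //= [se].
have := IH (k' :: w) e jw se.
by rewrite /insert /remove/= => ->; rewrite addrCA.
Qed.

(** [qs] lists the periods visited by the walk; a skew-circulant letter yields
    the parity of the number of periods it crosses. *)
Fixpoint holonomy (R : pzRingType) (w : seq (bool * bool)) (qs : seq int) : R :=
  match w, qs with
  | l :: w', q :: ((q' :: _) as qs') =>
      (if l.1 then 1 else (-1) ^+ `|q' - q|%N) * holonomy R w' qs'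
  | _, _ => 1
  end.

Lemma holonomy_norm (R : realDomainType) w qs : `|holonomy R w qs| <= 1.
Proof.
elim: w qs => [|l w IH] [|q [|q' qs]] //=; rewrite ?normr1//.
rewrite normrM mulr_ile1 ?normr_ge0 ?IH//.
by case: ifP; rewrite ?normr1// normrX normrN1 expr1n.
Qed.

Lemma holonomy_circulant (R : pzRingType) w qs : all fst w ->
  holonomy R w qs = 1.
Proof.
by elim: w qs => [|l w IH] [|q [|q' qs]] //= /andP[-> /IH ->]; rewrite mulr1.
Qed.

Lemma sign_dist (R : pzRingType) (a b c : int) :
  (-1 : R) ^+ `|b - a|%N * (-1) ^+ `|c - b|%N = (-1) ^+ `|c - a|%N.
Proof.
rewrite -exprD -[LHS]signr_odd -[RHS]signr_odd oddD.
have := odd_double_half `|b - a|%N; have := odd_double_half `|c - b|%N.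
have := odd_double_half `|c - a|%N; rewrite -!muln2.
by do 3!case: (odd _); rewrite //=; lia.
Qed.

(** Parities of successive crossings add up, so that only the end points
    remain. *)
Lemma holonomy_skew (R : pzRingType) w q qs : all (fun l => ~~ l.1) w ->
  size qs = size w -> holonomy R w (q :: qs) = (-1) ^+ `|last q qs - q|%N.
Proof.
elim: w q qs => [|l w IH] q [|q' qs] //=; first by rewrite subrr.
by move=> /andP[/negPf -> wS] [sw]; rewrite IH// sign_dist.
Qed.

Lemma size_walk y w d : size w = size d -> size (walk y w d) = (size w).+1.
Proof. by elim: w y d => [|l w IH] y [|j d] //= [sw]; rewrite IH. Qed.

(** The positions of a walk as linear forms in its starting point and in the
    frequencies of the pairs, [labs] telling the coordinate of each letter. *)
Fixpoint walk_forms (c : nat -> int) (w : seq (bool * bool)) (labs : seq nat) :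
    seq (nat -> int) :=
  match w, labs with
  | l :: w', a :: labs' =>
      c :: walk_forms (fun i => c i + dir l * (i == a)%:Z) w' labs'
  | _, _ => [:: c]
  end.

Lemma walk_formsE c w labs v :
  [seq dot f v | f <- walk_forms c w labs] =
  walk (dot c v) w [seq nth 0%N v a | a <- labs].
Proof.
elim: w c labs => [|l w IH] c [|a labs] //=.
by rewrite IH dotD dot_unit.
Qed.

Section pairing_average.
Variable R : realType.
Implicit Types (w : seq (bool * bool)) (J : seq nat).

Definition loop_weight n w (x : nat) (d : seq nat) : R :=
  (n%:Z %| drift w d)%Z%:R *
  holonomy R w [seq (y %/ n%:Z)%Z | y <- walk x%:Z w d].

Lemma loop_weight_norm n w x d :
  `|loop_weight n w x d| <= (n%:Z %| drift w d)%Z%:R.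
Proof.
by rewrite normrM ger0_norm// ler_piMr// holonomy_norm.
Qed.

(** The coordinates are the starting point and one frequency for each pair. *)
Definition pairing_average J w n : R :=
  lattice_average (size J).+1 n
    (fun v => loop_weight n w (head 0%N v) (expand J (behead v))).

Let labels J := expand J (iota 1 (size J)).
Let start : nat -> int := fun i => 1 * (i == 0%N)%:Z.

Let forms J w := walk_forms start w (labels J).

Let formsE J w v : size v = (size J).+1 ->
  [seq dot f v | f <- forms J w] = walk (head 0%N v)%:Z w (expand J (behead v)).
Proof.
case: v => [//|x e] [se].
rewrite walk_formsE dot_unit mul1r map_expand -se; congr (walk _ _ (expand _ _)).
have -> : iota 1 (size e) = [seq k.+1 | k <- iota 0 (size e)].
  by rewrite (iotaDl 1 0).
by rewrite -map_comp -[RHS](mkseq_nth 0%N).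
Qed.

(** The displacement along the whole walk; the walk is a loop when the mesh
    divides its value. *)
Let closing J w : nat -> int := fun i => last start (forms J w) i + - start i.

Let dotN c v : dot (fun i => - c i) v = - dot c v.
Proof.
elim: v c => [|x v IH] c /=; first by rewrite oppr0.
by rewrite (IH (c \o S)) mulNr opprD.
Qed.

Let closingE J w v : size v = (size J).+1 ->
  dot (closing J w) v = drift w (expand J (behead v)).
Proof.
move=> sv; rewrite (dotD (last start (forms J w)) (fun i => - start i)) dotN.
rewrite -(last_map (fun f => dot f v)) formsE// last_walk.
by case: v sv => // x v _; rewrite dot_unit mul1r/= addrC addKr.
Qed.

(** Either the walk closes up identically and the summand is a function of
    floors only, or closing up is a nontrivial congruence. *)
Lemma pairing_average_cvg J w : cvgn (fun n => pairing_average J w n.+1).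
Proof.
have [m0|m0] := eqVneq (mass (closing J w) (size J).+1) 0%N.
  rewrite (_ : (fun n => _) = (fun n => lattice_average (size J).+1 n.+1
      (holonomy R w \o floors (forms J w) n.+1))).
    exact: (@lattice_average_cvg R _ _ _ (@holonomy_norm R w)).
  apply/funext => n; congr (_ * _); rewrite big_seq [RHS]big_seq.
  apply: eq_bigr => v; rewrite mem_grid => /andP[/eqP sv _].
  rewrite /loop_weight -closingE// (dot_mass0 sv m0) dvdz0 mul1r.
  by rewrite /= /floors -formsE// -map_comp.
apply/cvg_ex; exists 0.
apply: (lattice_average_congr_cvg0 m0) => n v.
rewrite mem_grid => /andP[/eqP sv _].
by rewrite closingE//; exact: loop_weight_norm.
Qed.

Lemma pairing_average_norm J w n : `|pairing_average J w n| <= 1.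
Proof.
apply: lattice_average_norm => v _; apply: le_trans (loop_weight_norm _ _ _ _) _.
by rewrite lern1 leq_b1.
Qed.

(** Paired letters share their frequency, so the two shifts cancel exactly when
    one of the letters is adjoint and the other is not. *)
Definition opposite (l l' : bool * bool) : R := (l.2 != l'.2)%:R.

Let dir_opp l l' : (dir l + dir l' == 0) = (l.2 != l'.2).
Proof. by rewrite /dir; case: l.2; case: l'.2. Qed.

Let weight_opp01 J w : weight opposite J w = 0 \/ weight opposite J w = 1.
Proof.
elim: J w => [|j J IH] [|l w] /=; auto.
rewrite /opposite; case: (_ != _); rewrite ?mul1r ?mul0r; auto.
Qed.

Let drift_expand0 J w e : weight opposite J w = 1 -> wfcode J ->
  size w = (size J).*2 -> size e = size J -> drift w (expand J e) = 0.
Proof.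
elim: J w e => [|j J IH] [|l w] [|x e] //= W /andP[jJ wJ] [sw] [se].
rewrite (drift_insert l)// ?sw// ?size_expand// addrA -mulrDl.
move: W; rewrite /opposite -dir_opp; have [->|_] := eqVneq _ 0; last first.
  by rewrite mul0r => /esym/eqP; rewrite oner_eq0.
by rewrite mul1r mul0r add0r => W; apply: IH => //; rewrite size_remove sw.
Qed.

Let drift_expand_neq0 J w : weight opposite J w = 0 -> wfcode J ->
  size w = (size J).*2 ->
  exists e, size e = size J /\ drift w (expand J e) != 0.
Proof.
elim: J w => [|j J IH] [|l w] //= W.
  by move/eqP: W; rewrite oner_eq0.
move=> /andP[jJ wJ] [sw].
have swr : size (remove j w) = (size J).*2 by rewrite size_remove sw.
move: W; rewrite /opposite -dir_opp; have [d0|d0 _] := eqVneq _ 0.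
  rewrite mul1r => W; have [e [se eP]] := IH _ W wJ swr.
  exists (0%N :: e); rewrite /= se; split => //.
  by rewrite (drift_insert l)// ?sw// ?size_expand// addrA -mulrDl d0 mul0r add0r.
pose z := nseq (size J) 0%N.
exists (1%N :: z); rewrite /= size_nseq; split => //.
rewrite (drift_insert l)// ?sw// ?size_expand ?size_nseq// addrA -mulrDl mulr1.
rewrite (_ : drift _ _ = 0) ?addr0//.
have : all (pred1 0%N) (expand J z).
  rewrite /z; elim: (J) => //= k K IHK; rewrite /insert all_cat/=.
  by move: IHK; rewrite -{1}(cat_take_drop k (expand K _)) all_cat.
elim: (remove j w) (expand J z) => [|k s IHs] [|x v] //= /andP[/eqP -> /IHs ->].
by rewrite mulr0.
Qed.

(** When the signs are trivial, an average is one if the shifts cancel inside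
    each pair; otherwise the displacement is a nonzero form, as is seen by
    letting a single frequency be nonzero, and the average vanishes in the
    limit. *)
Lemma pairing_average_pure J w : wfcode J -> size w = (size J).*2 ->
  (forall qs, size qs = (size w).+1 -> last 0 qs = head 0 qs ->
     holonomy R w qs = 1) ->
  pairing_average J w n.+1 @[n --> \oo] --> weight opposite J w.
Proof.
move=> wJ sw hol; have [W|W] := weight_opp01 J w; rewrite W.
  have [e [se eP]] := drift_expand_neq0 W wJ sw.
  have m0 : mass (closing J w) (size J).+1 != 0%N.
    apply: contra eP => /eqP m0.
    have s0 : size (0%N :: e) = (size J).+1 by rewrite /= se.
    by have := dot_mass0 s0 m0; rewrite closingE//= => ->.
  apply: (lattice_average_congr_cvg0 m0) => n v.
  rewrite mem_grid => /andP[/eqP sv _].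
  by rewrite closingE//; exact: loop_weight_norm.
rewrite (_ : (fun n => _) = cst 1); first exact: cvg_cst.
apply/funext => n; rewrite /pairing_average /lattice_average.
have E v : v \in grid (size J).+1 n.+1 ->
    loop_weight n.+1 w (head 0%N v) (expand J (behead v)) = 1.
  rewrite mem_grid => /andP[/eqP sv _].
  have sb : size (behead v) = size J by rewrite size_behead sv.
  have d0 := drift_expand0 W wJ sw sb.
  rewrite /loop_weight d0 dvdz0 mul1r hol//.
    by rewrite size_map size_walk// size_expand.
  have := last_walk 0 (head 0%N v) w (expand J (behead v)); rewrite d0 addr0.
  have := size_walk (head 0%N v) (esym (etrans (size_expand sb) (esym sw))).
  have := walk_head (head 0%N v) w (expand J (behead v)).
  case: (walk _ _ _) => // y s /= -> _ yE.
  by rewrite (last_map (fun y => (y %/ n.+1%:Z)%Z)) yE.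
rewrite big_seq; under eq_bigr do rewrite E//.
rewrite -big_seq big_const_seq count_predT size_grid iter_addr_0 natrX mulVf//.
Qed.

End pairing_average.

(** * Expectations of products of independent variables *)

Section densities.
Local Open Scope ereal_scope.
Import HBNNSimple.

(** Monotone approximation by simple functions lifts to nonnegative functions
    an identity between measures; it is used below for densities and for
    independence. *)
Lemma ge0_integral_density d d' (T : measurableType d) (T' : measurableType d')
    (R : realType) (mu : {measure set T -> \bar R})
    (nu : {measure set T' -> \bar R})
    (X : T -> T') (H : T -> R) (c : \bar R) (f : T' -> R) :
  measurable_fun setT X -> measurable_fun setT H -> (forall t, (0 <= H t)%R) ->
  c \is a fin_num -> measurable_fun setT f -> (forall x, (0 <= f x)%R) ->
  (forall B, measurable B -> \int[mu]_t (\1_B (X t) * H t)%:E = nu B * c) ->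
  \int[mu]_t (f (X t) * H t)%:E = \int[nu]_x (f x)%:E * c.
Proof.
move=> mX mH H0 cfin mf f0 hyp.
have mf' : measurable_fun setT (EFin \o f) by exact/measurable_EFinP.
pose g := nnsfun_approx measurableT mf'.
have gf x : (g n x)%:E @[n --> \oo] --> (f x)%:E.
  by apply: (@cvg_nnsfun_approx _ _ _ _ measurableT _ mf') => // y _; rewrite lee_fin.
have mgX n : measurable_fun setT (fun t => g n (X t)).
  exact: (measurableT_comp (measurable_funPT (g n)) mX).
have simple n : \int[mu]_t (g n (X t) * H t)%:E = \int[nu]_x (g n x)%:E * c.
  have gE x : g n x = (\sum_(y \in range (g n)) y * \1_(g n @^-1` [set y]) x)%R.
    by rewrite [LHS]fimfunE.
  have m1 y : measurable_fun setT (fun t => \1_(g n @^-1` [set y]) (X t) : R).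
    exact: measurableT_comp.
  have y0 y : range (g n) y -> (0 <= y)%R by move=> [x _ <-].
  have y1 y x : (0 <= y * \1_(g n @^-1` [set y]) x)%R.
    have [xy|/negPf xy] := boolP (x \in g n @^-1` [set y]).
      rewrite indicE xy mulr1; apply: y0.
      by move: xy; rewrite inE/= => <-; exists x.
    by rewrite indicE xy mulr0.
  transitivity (\sum_(y \in range (g n)) \int[mu]_t
      (y * \1_(g n @^-1` [set y]) (X t) * H t)%:E).
    rewrite -ge0_integral_fsum//.
    - by apply: eq_integral => t _; rewrite gE fsumEFin// mulr_fsuml.
    - by move=> y; apply/measurable_EFinP; do 2 apply: measurable_funM => //.
    - by move=> y t _ /=; rewrite lee_fin mulr_ge0.
  transitivity ((\sum_(y \in range (g n)) \int[nu]_x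
      (y * (\1_(g n @^-1` [set y]) x))%:E) * c); last first.
    congr (_ * _); rewrite -ge0_integral_fsum//.
    - by apply: eq_integral => t _; rewrite gE fsumEFin.
    - by move=> y; apply/measurable_EFinP; apply: measurable_funM.
    - by move=> y t _ /=; rewrite lee_fin.
  rewrite ge0_mule_fsuml; last first.
    by move=> y; apply: integral_ge0 => t _; rewrite lee_fin.
  apply: eq_fsbigr => y /[!inE] /y0 yge0.
  under eq_integral do rewrite -mulrA EFinM.
  rewrite ge0_integralZl//; last 2 first.
    - by apply/measurable_EFinP; apply: measurable_funM.
    - by move=> t _; rewrite lee_fin mulr_ge0.
  under [in RHS]eq_integral do rewrite EFinM.
  rewrite [in RHS]ge0_integralZl//; last 1 first.
    exact/measurable_EFinP.
  by rewrite -muleA hyp// integral_indic ?setIT.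
have cvgL : \int[mu]_t (g n (X t) * H t)%:E @[n --> \oo] -->
    \int[mu]_t (f (X t) * H t)%:E.
  rewrite (_ : \int[mu]_t (f (X t) * H t)%:E =
    \int[mu]_t limn (fun n => (g n (X t) * H t)%:E)); last first.
    apply: eq_integral => t _; apply/esym/cvg_lim => //.
    rewrite EFinM; under eq_fun do rewrite EFinM.
    by apply: cvgeZr => //; exact: gf.
  apply: cvg_monotone_convergence => //.
  - by move=> n; apply/measurable_EFinP/measurable_funM.
  - by move=> n t _; rewrite lee_fin mulr_ge0.
  - move=> t _ a b ab; rewrite lee_fin ler_wpM2r//.
    exact/lefP/nd_nnsfun_approx.
have cvgR : \int[nu]_x (g n x)%:E @[n --> \oo] --> \int[nu]_x (f x)%:E.
  rewrite (_ : \int[nu]_x (f x)%:E =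
    \int[nu]_x limn (fun n => (g n x)%:E)); last first.
    by apply: eq_integral => t _; apply/esym/cvg_lim => //; exact: gf.
  apply: cvg_monotone_convergence => //.
  - by move=> n; exact/measurable_EFinP.
  - by move=> n t _; rewrite lee_fin.
  - by move=> t _ a b ab; rewrite lee_fin; exact/lefP/nd_nnsfun_approx.
have := cvgeZr cfin cvgR; under eq_fun do rewrite -simple.
by move=> /(cvg_unique _ cvgL) <-.
Qed.

Lemma integral_mul_indep d (T : measurableType d) (R : realType)
    (P : probability T R) (X : {RV P >-> R}) (H : T -> R) (f : R -> R) :
  measurable_fun setT H -> (forall t, (0 <= H t)%R) ->
  measurable_fun setT f -> (forall x, (0 <= f x)%R) ->
  \int[P]_t (H t)%:E \is a fin_num ->
  (forall B, measurable B ->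
     \int[P]_t (\1_B (X t) * H t)%:E = P (X @^-1` B) * \int[P]_t (H t)%:E) ->
  \int[P]_t (f (X t) * H t)%:E = \int[P]_t (f (X t))%:E * \int[P]_t (H t)%:E.
Proof.
move=> mH H0 mf f0 finH hyp.
rewrite (@ge0_integral_density _ _ _ _ _ P (distribution P X) X H
  (\int[P]_t (H t)%:E))//.
congr (_ * _); rewrite ge0_integral_distribution//.
exact/measurable_EFinP.
Qed.

End densities.

Section independent_products.
Context d (T : measurableType d) (R : realType) (P : probability T R).
Context (I : choiceType) (X : I -> {RV P >-> R}).
Hypothesis X_indep : mutually_independent X.

Let fupd (A : Type) (F : I -> A) (i : I) (G : A) : I -> A :=
  fun j => if j == i then G else F j.

Let fupdE (A : Type) (F : I -> A) i G : fupd F i G i = G.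
Proof. by rewrite /fupd eqxx. Qed.

Let fupdN (A : Type) (F : I -> A) i G j : j != i -> fupd F i G j = F j.
Proof. by rewrite /fupd => /negPf ->. Qed.

Let measurable_prod (s : seq I) (f : I -> T -> R) :
  (forall i, measurable_fun setT (f i)) ->
  measurable_fun setT (fun t => \prod_(i <- s) f i t).
Proof.
move=> mf; elim: s => [|i s IH].
  by under eq_fun do rewrite big_nil; exact: measurable_cst.
by under eq_fun do rewrite big_cons; exact: measurable_funM.
Qed.

Let prod_fin_num (s : seq I) (g : I -> \bar R) :
  (forall i, g i \is a fin_num)%E -> (\prod_(i <- s) g i \is a fin_num)%E.
Proof.
by move=> gf; elim: s => [|i s IH]; rewrite ?big_nil// big_cons fin_numM.
Qed.

(** The indicators carried along by [b] are what lets the induction on [a] start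
    from the independence of events and replace one indicator at a time by a
    function. *)
Lemma indep_prod_ge0 (f : I -> R -> R) (a b : seq I) (B : I -> set R) :
  (forall i, measurable_fun setT (f i)) -> (forall i x, 0 <= f i x) ->
  (forall i, \int[P]_t (f i (X i t))%:E \is a fin_num)%E ->
  uniq (a ++ b) -> (forall i, measurable (B i)) ->
  (\int[P]_t (\prod_(i <- a) f i (X i t) *
              \prod_(i <- b) \1_(B i) (X i t))%:E =
   \prod_(i <- a) \int[P]_t (f i (X i t))%:E *
   \prod_(i <- b) P (X i @^-1` B i))%E.
Proof.
move=> mf f0 ff; have mX i : measurable_fun setT (X i) by [].
have mfX i : measurable_fun setT (fun t => f i (X i t)).
  exact: (measurableT_comp (mf i) (mX i)).
elim: a b B => [|i a IH] b B.
  rewrite cat0s => ub mB.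
  rewrite big_nil mul1e -(X_indep ub mB).
  set E := \big[setI/setT]_(j <- b) _.
  have mE : measurable E.
    rewrite /E; elim: b {ub E} => [|j b IHb]; first by rewrite big_nil.
    by rewrite big_cons; apply: measurableI => //; exact: measurable_funPTI.
  rewrite -[in RHS](setIT E) -integral_indic//.
  apply: eq_integral => t _; rewrite big_nil mul1r; congr (_%:E).
  rewrite /E; elim: b {ub E mE} => [|j b IHb]; first by rewrite !big_nil indicT.
  by rewrite !big_cons IHb indicI.
rewrite cat_cons cons_uniq mem_cat negb_or => /andP[/andP[ia ib] uab] mB.
have mB1 j : measurable_fun setT (fun t => \1_(B j) (X j t) : R).
  exact: measurableT_comp.
under eq_integral do rewrite big_cons -mulrA.
rewrite (@integral_mul_indep _ _ _ _ (X i)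
  (fun t => \prod_(j <- a) f j (X j t) * \prod_(j <- b) \1_(B j) (X j t)))//.
- by rewrite IH// big_cons muleA.
- by apply: measurable_funM; exact: measurable_prod.
- by move=> t; rewrite mulr_ge0// prodr_ge0// => j _; rewrite indicE.
- rewrite IH// fin_numM// prod_fin_num// => j.
  by apply: fin_num_measure; exact: measurable_funPTI.
move=> B' mB'; have := IH (i :: b) (fupd B i B').
have eqb (V : Type) (idx : V) (op : V -> V -> V) (g : I -> set R -> V) :
    \big[op/idx]_(j <- b) g j (fupd B i B' j) = \big[op/idx]_(j <- b) g j (B j).
  apply: eq_big_seq => j jb; rewrite fupdN//.
  by apply: contraNneq ib => <-.
rewrite big_cons fupdE (eqb _ _ _ (fun j B => P (X j @^-1` B))) muleCA -IH// => <-.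
- apply: eq_integral => t _; rewrite big_cons fupdE mulrCA.
  by rewrite (eqb _ _ _ (fun j B => \1_B (X j t))).
- by rewrite -cat1s uniq_catCA/= mem_cat negb_or ia ib.
- by move=> j; rewrite /fupd; case: ifP.
Qed.

Lemma indep_prod_integrable (F : I -> R -> R) (s : seq I) :
  (forall i, measurable_fun setT (F i)) ->
  (forall i, P.-integrable setT (fun t => (F i (X i t))%:E)) -> uniq s ->
  P.-integrable setT (fun t => (\prod_(i <- s) F i (X i t))%:E).
Proof.
move=> mF iF us; apply/integrableP; split.
  apply/measurable_EFinP; apply: measurable_prod => i.
  by apply: (measurableT_comp (mF i)).
have := @indep_prod_ge0 (fun i x => `|F i x|) s [::] (fun=> setT).
rewrite cats0 big_nil mule1 => E.
rewrite (eq_integral (fun t => (\prod_(i <- s) `|F i (X i t)| *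
   \prod_(i <- [::]) \1_setT (X i t))%:E)) => [|t _]; last first.
  by rewrite big_nil mulr1 /= normr_prod.
have fF i : (\int[P]_t `|F i (X i t)|%:E \is a fin_num)%E.
  by have := integrable_fin_num measurableT (integrable_abse (iF i)).
rewrite E// ?ltey_eq ?prod_fin_num// => i.
exact: measurableT_comp (mF i).
Qed.

(** Positive and negative parts are split off one variable at a time; the
    auxiliary list [b] holds the variables whose functions are already
    nonnegative. *)
Lemma indep_prod (F : I -> R -> R) (s : seq I) :
  (forall i, measurable_fun setT (F i)) ->
  (forall i, P.-integrable setT (fun t => (F i (X i t))%:E)) -> uniq s ->
  \int[P]_t (\prod_(i <- s) F i (X i t)) =
  \prod_(i <- s) \int[P]_t F i (X i t).
Proof.
suff main a b G : (forall i, measurable_fun setT (G i)) ->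
    (forall i, P.-integrable setT (fun t => (G i (X i t))%:E)) ->
    (forall i x, i \in b -> 0 <= G i x) -> uniq (a ++ b) ->
    \int[P]_t (\prod_(i <- a ++ b) G i (X i t)) =
    \prod_(i <- a ++ b) \int[P]_t G i (X i t).
  by move=> mF iF us; have := main s [::] F mF iF; rewrite cats0; exact.
elim: a b G => [|i a IH] b G mG iG G0.
  rewrite cat0s => ub.
  have := @indep_prod_ge0 (fun i x => `|G i x|) b [::] (fun=> setT).
  rewrite cats0 big_nil mule1 => E.
  have fF i : (\int[P]_t `|G i (X i t)|%:E \is a fin_num)%E.
    by have := integrable_fin_num measurableT (integrable_abse (iG i)).
  rewrite /Rintegral (eq_integral (fun t => (\prod_(i <- b) `|G i (X i t)| *
     \prod_(i <- [::]) \1_setT (X i t))%:E)) => [|t _]; last first.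
    rewrite big_nil mulr1; congr (_%:E); apply: eq_big_seq => j jb.
    by rewrite ger0_norm// G0.
  rewrite E// => [|j]; last exact: measurableT_comp (mG j).
  rewrite [RHS](_ : _ = \prod_(j <- b) fine (\int[P]_t `|G j (X j t)|%:E)%E).
    elim: b {ub G0 E} => [|j b IHb]; first by rewrite !big_nil.
    by rewrite !big_cons fineM ?prod_fin_num// IHb.
  apply: eq_big_seq => j jb; congr fine; apply: eq_integral => t _.
  by rewrite ger0_norm// G0.
rewrite cat_cons cons_uniq mem_cat negb_or => /andP[/andP[ia ib] uab].
have step (f : R -> R) : measurable_fun setT f -> (forall x, 0 <= f x) ->
    P.-integrable setT (fun t => (f (X i t))%:E) ->
    P.-integrable setT (fun t => (f (X i t) * \prod_(j <- a ++ b) G j (X j t))%:E) /\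
    \int[P]_t (f (X i t) * \prod_(j <- a ++ b) G j (X j t)) =
    \int[P]_t f (X i t) * \prod_(j <- a ++ b) \int[P]_t G j (X j t).
  move=> mf f0 fi; pose G' := fupd G i f.
  have eqab (V : Type) (idx : V) (op : V -> V -> V) (g : I -> (R -> R) -> V) :
      \big[op/idx]_(j <- a ++ b) g j (G' j) = \big[op/idx]_(j <- a ++ b) g j (G j).
    apply: eq_big_seq => j jab; rewrite /G' fupdN//.
    by apply: contraTneq jab => ->; rewrite mem_cat negb_or ia.
  have mG' j : measurable_fun setT (G' j).
    by rewrite /G' /fupd; case: ifP.
  have iG' j : P.-integrable setT (fun t => (G' j (X j t))%:E).
    by rewrite /G' /fupd; case: eqP => [->|].
  have uiab : uniq (a ++ i :: b) by rewrite -cat1s uniq_catCA/= mem_cat negb_or ia ib.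
  have pE (g : I -> R) : \prod_(j <- a ++ i :: b) g j = g i * \prod_(j <- a ++ b) g j.
    by rewrite !big_cat big_cons/= mulrCA.
  have gE t : \prod_(j <- a ++ i :: b) G' j (X j t) =
      f (X i t) * \prod_(j <- a ++ b) G j (X j t).
    by rewrite pE (eqab _ _ _ (fun j g => g (X j t))) /G' fupdE.
  split.
    have := indep_prod_integrable mG' iG' uiab.
    by under eq_fun do rewrite gE.
  have := IH (i :: b) G' mG' iG'; rewrite pE.
  have G'i : G' i = f by rewrite /G' fupdE.
  rewrite (eqab _ _ _ (fun j g => \int[P]_t g (X j t))) G'i => <-//.
    by apply: eq_Rintegral => t _; rewrite gE.
  move=> j x; rewrite inE /G' /fupd; case: eqP => //= _ jb; exact: G0.
have mpos : measurable_fun setT ((G i)^\+) by exact: measurable_funrpos.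
have mneg : measurable_fun setT ((G i)^\-) by exact: measurable_funrneg.
have [ip Ep] := step _ mpos (funrpos_ge0 _)
  (integrable_funrpos (f := fun t => G i (X i t)) measurableT (iG i)).
have [ineg En] := step _ mneg (funrneg_ge0 _)
  (integrable_funrneg (f := fun t => G i (X i t)) measurableT (iG i)).
have GE x : G i x = (G i)^\+ x - (G i)^\- x.
  by rewrite -[in LHS](funrposBneg (G i)).
rewrite big_cons.
rewrite (_ : \int[P]_t G i (X i t) =
    \int[P]_t (G i)^\+ (X i t) - \int[P]_t (G i)^\- (X i t)); last first.
  rewrite -RintegralB//.
  - by apply: eq_Rintegral => t _; exact: GE.
  - exact: (integrable_funrpos (f := fun t => G i (X i t)) measurableT (iG i)).
  - exact: (integrable_funrneg (f := fun t => G i (X i t)) measurableT (iG i)).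
rewrite mulrBl -Ep -En -RintegralB//.
by apply: eq_Rintegral => t _; rewrite big_cons GE mulrBl.
Qed.

End independent_products.

(** * Moments of the noise *)

Section noise_moments.
Context d (T : measurableType d) (R : realType) (P : probability T R).
Variable tau : int -> {RV P >-> R}.
Hypothesis tau_indep : mutually_independent tau.
Hypothesis tau_ident : identically_distributed tau.
Hypothesis tau_mean : forall j : int, ('E_P[tau j] = 0)%E.
Hypothesis tau_var : forall j : int, ('V_P[tau j] = 1)%E.
Hypothesis tau_fin : forall j : int, finite_moments P (tau j).

Definition noise_moment (k : seq int) : R := \int[P]_t (\prod_(j <- k) tau j t).

Let mX c : measurable_fun setT (fun x : R => x ^+ c).
Proof. exact: measurable_funX. Qed.

Lemma integrable_tauX j c : P.-integrable setT (fun t => (tau j t ^+ c)%:E).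
Proof.
apply/integrableP; split.
  by apply/measurable_EFinP; exact: measurable_funX.
have := tau_fin j c; rewrite unlock; under eq_integral do rewrite -normrX.
by [].
Qed.

Lemma prod_count (k : seq int) t :
  \prod_(j <- k) tau j t = \prod_(j <- undup k) tau j t ^+ count_mem j k.
Proof. by rewrite -[LHS]big_undup_iterop_count. Qed.

Lemma integrable_tau_prod k :
  P.-integrable setT (fun t => (\prod_(j <- k) tau j t)%:E).
Proof.
under eq_fun do rewrite prod_count.
apply: (@indep_prod_integrable _ _ _ _ _ tau tau_indep (fun j x => x ^+ count_mem j k)).
- by move=> j; exact: mX.
- by move=> j; exact: integrable_tauX.
- exact: undup_uniq.
Qed.

Lemma noise_moment_undup k :
  noise_moment k = \prod_(j <- undup k) \int[P]_t (tau j t ^+ count_mem j k).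
Proof.
rewrite /noise_moment; under eq_Rintegral do rewrite prod_count.
apply: (@indep_prod _ _ _ _ _ tau tau_indep (fun j x => x ^+ count_mem j k)).
- by move=> j; exact: mX.
- by move=> j; exact: integrable_tauX.
- exact: undup_uniq.
Qed.

(** The basic form of independence: products over disjoint index sets
    factorise. *)
Lemma noise_moment_cat a b : {in a, forall j, j \notin b} ->
  noise_moment (a ++ b) = noise_moment a * noise_moment b.
Proof.
move=> ab; rewrite !noise_moment_undup undup_cat big_cat/=; congr (_ * _).
  rewrite (_ : [seq x <- undup a | x \notin b] = undup a); last first.
    by apply/all_filterP/allP => j; rewrite mem_undup => /ab.
  apply: eq_big_seq => j; rewrite mem_undup => /ab /count_memPn jb.
  by rewrite count_cat jb addn0.
apply: eq_big_seq => j; rewrite mem_undup => jb; rewrite count_cat.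
rewrite (_ : count_mem j a = 0%N)//; apply/count_memPn.
by apply/negP => /ab; rewrite jb.
Qed.

Lemma noise_moment0 : noise_moment [::] = 1.
Proof. by rewrite noise_moment_undup big_nil. Qed.

Lemma noise_moment1 j : noise_moment [:: j] = 0.
Proof.
rewrite /noise_moment; under eq_Rintegral do rewrite big_seq1.
by have := tau_mean j; rewrite unlock /Rintegral => ->.
Qed.

Lemma noise_moment2 j : noise_moment [:: j; j] = 1.
Proof.
rewrite /noise_moment; have := tau_var j.
rewrite /variance covariance.unlock tau_mean expectation.unlock => E.
rewrite /Rintegral -[RHS]/(fine 1) -E; congr fine.
apply: eq_integral => t _; rewrite !big_cons big_nil mulr1; congr (_%:E).
by rewrite !fctE /= subr0.
Qed.

Lemma tauX_ident i j c : \int[P]_t (tau i t ^+ c) = \int[P]_t (tau j t ^+ c).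
Proof.
rewrite /Rintegral; congr fine.
have mXE : measurable_fun setT (fun x : R => (x ^+ c)%:E).
  by apply/measurable_EFinP; exact: mX.
rewrite -[LHS](integral_distribution (X := tau i) mXE (integrable_tauX i c)).
rewrite -[RHS](integral_distribution (X := tau j) mXE (integrable_tauX j c)).
by apply: eq_measure_integral => B mB _; exact: tau_ident.
Qed.

(** The bound depends on the number of factors only, because the variables have
    the same law. *)
Lemma noise_moment_bounded : exists B : nat -> R,
  forall k, `|noise_moment k| <= B (size k).
Proof.
pose K p : R := 1 + \sum_(c < p.+1) `|\int[P]_t (tau 0 t ^+ c)|.
have K1 p : 1 <= K p by rewrite lerDl sumr_ge0.
exists (fun p => K p ^+ p) => k; rewrite noise_moment_undup normr_prod.
apply: (@le_trans _ _ (\prod_(j <- undup k) K (size k))).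
  apply: ler_prod => j _; rewrite normr_ge0/= (tauX_ident j 0).
  have cj : (count_mem j k < (size k).+1)%N by rewrite ltnS count_size.
  rewrite /K (bigD1 (Ordinal cj))//= addrA [1 + _]addrC -addrA lerDl.
  by rewrite addr_ge0// sumr_ge0.
rewrite big_const_seq count_predT.
rewrite -/(iterop _ _ _ _); have -> n x : iter n ( *%R x) 1 = x ^+ n :> R.
  by elim: n => [|n /= ->]; rewrite ?expr0 ?exprS.
by rewrite ler_weXn2l// size_undup.
Qed.

End noise_moments.

(** * Moments of the frequencies *)

Section frequency_moments.
Context d (T : measurableType d) (R : realType) (P : probability T R).
Variable tau : int -> {RV P >-> R}.
Hypothesis tau_indep : mutually_independent tau.
Hypothesis tau_ident : identically_distributed tau.
Hypothesis tau_mean : forall j : int, ('E_P[tau j] = 0)%E.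
Hypothesis tau_var : forall j : int, ('V_P[tau j] = 1)%E.
Hypothesis tau_fin : forall j : int, finite_moments P (tau j).
Variable n : nat.

Definition chi (b : bool) : R := if b then 1 else -1.

(** The entry at offset [z.2] of the first row of the circulant matrix (sign
    plus) or of the skew-circulant one (sign minus). *)
Definition freq (z : bool * nat) (t : T) : R :=
  tau z.2%:Z t + chi z.1 * tau (z.2%:Z - n%:Z) t.

Definition freq_moment (L : seq (bool * nat)) : R :=
  \int[P]_t (\prod_(z <- L) freq z t).

Definition freq_cov (z z' : bool * nat) : R :=
  2 * (z.1 == z'.1)%:R * (z.2 == z'.2)%:R.

(** Interpolates between products of noises and products of frequencies, so that
    frequencies can be expanded one at a time. *)
Let mixed (k : seq int) (L : seq (bool * nat)) (t : T) : R :=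
  \prod_(j <- k) tau j t * \prod_(z <- L) freq z t.

Let mixed_cons k z L t : mixed k (z :: L) t =
  mixed (z.2%:Z :: k) L t + chi z.1 * mixed (z.2%:Z - n%:Z :: k) L t.
Proof. by rewrite /mixed !big_cons /freq; ring. Qed.

Let mixed_integrable k L : P.-integrable setT (fun t => (mixed k L t)%:E).
Proof.
elim: L k => [|z L IH] k.
  rewrite /mixed; under eq_fun do rewrite big_nil mulr1.
  exact: integrable_tau_prod.
under eq_fun do rewrite mixed_cons EFinD.
apply: integrableD => //.
by under eq_fun do rewrite (EFinM (chi _)); exact: (integrableZl measurableT (chi z.1) (IH _)).
Qed.

Lemma integrable_freq_prod L :
  P.-integrable setT (fun t => (\prod_(z <- L) freq z t)%:E).
Proof.
have := mixed_integrable [::] L; rewrite /mixed.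
by under eq_fun do rewrite big_nil mul1r.
Qed.

Let M k L : R := \int[P]_t mixed k L t.

Let M_nil k : M k [::] = noise_moment tau k.
Proof. by apply: eq_Rintegral => t _; rewrite /mixed big_nil mulr1. Qed.

Let M_cons k z L :
  M k (z :: L) = M (z.2%:Z :: k) L + chi z.1 * M (z.2%:Z - n%:Z :: k) L.
Proof.
rewrite /M; under eq_Rintegral do rewrite mixed_cons.
rewrite RintegralD//; first by rewrite RintegralZl//; exact: mixed_integrable.
  exact: mixed_integrable.
exact: (integrableZl measurableT (chi z.1) (mixed_integrable _ _)).
Qed.

Let M_perm k k' L : perm_eq k k' -> M k L = M k' L.
Proof.
by move=> kk'; apply: eq_Rintegral => t _; rewrite /mixed (perm_big _ kk').
Qed.

Let MF L : M [::] L = freq_moment L.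
Proof. by apply: eq_Rintegral => t _; rewrite /mixed big_nil mul1r. Qed.

Let M_split a c L :
  {in a, forall j, j \notin c ++ flatten [seq [:: z.2%:Z; z.2%:Z - n%:Z] | z <- L]} ->
  M (a ++ c) L = noise_moment tau a * M c L.
Proof.
elim: L c => [|z L IH] c aL.
  rewrite !M_nil noise_moment_cat// => j /aL.
  by rewrite cats0.
have E e : e \in [:: z.2%:Z; z.2%:Z - n%:Z] ->
    M (e :: a ++ c) L = noise_moment tau a * M (e :: c) L.
  move=> ez; rewrite -IH; first by apply: M_perm; rewrite -cat1s perm_catCA.
  move=> j /aL; rewrite /= !(mem_cat, inE); move: ez; rewrite !inE.
  case/orP => /eqP -> /norP[/negPf h1 /norP[/negPf h2 /norP[/negPf h3 h4]]];
  by rewrite ?h1 ?h2 ?h3.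
by rewrite !M_cons !E ?inE ?eqxx ?orbT//; ring.
Qed.

Let valid : pred (bool * nat) := fun z => (z.2 < n)%N.

Let disjoint_freq i (a : seq int) L : (i < n)%N -> all valid L ->
  i \notin map snd L ->
  all (mem [:: i%:Z; i%:Z - n%:Z]) a ->
  {in a, forall j, j \notin [::] ++ flatten [seq [:: z.2%:Z; z.2%:Z - n%:Z] | z <- L]}.
Proof.
move=> iN /allP vL iL /allP aP j /aP /=; rewrite !inE => jE.
apply/flattenP => -[_ /mapP[z zL ->]].
have zi : z.2 != i by apply: contra iL => /eqP <-; exact: map_f.
have {}zi : z.2 <> i by apply/eqP.
have : (z.2 < n)%N by exact: vL zL.
move: (z.2) zi => m mi mn; rewrite !inE => /orP[] /eqP jz;
  by case/orP: jE => /eqP; rewrite jz; lia.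
Qed.

Lemma freq_moment_perm L L' : perm_eq L L' -> freq_moment L = freq_moment L'.
Proof. by move=> LL'; apply: eq_Rintegral => t _; rewrite (perm_big _ LL'). Qed.

Lemma freq_moment_nil : freq_moment [::] = 1.
Proof. by rewrite -MF M_nil noise_moment0. Qed.

Lemma freq_moment_lone z L : all valid (z :: L) -> z.2 \notin map snd L ->
  freq_moment (z :: L) = 0.
Proof.
move=> /= /andP[vz vL] zL; rewrite -MF M_cons.
rewrite (@M_split [:: _] [::]); last first.
  by apply: (disjoint_freq vz vL zL); rewrite /= inE eqxx.
rewrite (@M_split [:: _] [::]); last first.
  by apply: (disjoint_freq vz vL zL); rewrite /= !inE eqxx orbT.
by rewrite !noise_moment1// !mul0r mulr0 addr0.
Qed.

(** The cross terms vanish since the two noises in a frequency are distinct and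
    centered; the square terms have sum two for equal kinds and cancel for
    different kinds. *)
Lemma freq_moment_pair z z' L : all valid [:: z, z' & L] -> z.2 = z'.2 ->
  z.2 \notin map snd L ->
  freq_moment [:: z, z' & L] = freq_cov z z' * freq_moment L.
Proof.
move=> /= /and3P[vz _ vL] zz' zL; rewrite -MF !M_cons -!zz' /=.
have S a : all (mem [:: z.2%:Z; z.2%:Z - n%:Z]) a ->
    M a L = noise_moment tau a * freq_moment L.
  by move=> aP; rewrite -[a]cats0 M_split ?MF ?cats0//; exact: (disjoint_freq vz vL zL).
rewrite !S ?/= ?inE ?eqxx ?orbT// !noise_moment2//.
have d2 (i j : int) : i != j -> noise_moment tau [:: i; j] = 0.
  move=> ij; rewrite (@noise_moment_cat _ _ _ _ _ tau_indep tau_fin [:: i] [:: j]).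
    by rewrite noise_moment1// mul0r.
  by move=> x; rewrite !inE => /eqP ->.
rewrite !d2; try by move: vz; rewrite /valid; lia.
rewrite /freq_cov zz' eqxx /chi; case: z.1; case: z'.1 => /=; ring.
Qed.

Lemma freq_moment_le (B : nat -> R) L :
  (forall k, `|noise_moment tau k| <= B (size k)) ->
  `|freq_moment L| <= 2 ^+ size L * B (size L).
Proof.
move=> BP; rewrite -MF.
suff gen k : `|M k L| <= 2 ^+ size L * B (size k + size L)%N by exact: gen.
elim: L k => [|z L IH] k; first by rewrite M_nil mul1r addn0.
rewrite M_cons [size _]/= exprS -mulrA mulr_natl mulr2n addnS -addSn.
apply: le_trans (ler_normD _ _) _; apply: lerD; first exact: (IH (_ :: k)).
rewrite normrM (_ : `|chi z.1| = 1) ?mul1r; first exact: (IH (_ :: k)).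
by rewrite /chi; case: z.1; rewrite ?normrN normr1.
Qed.

(** Frequencies with different offsets in [0 .. n - 1] involve disjoint sets of
    noises, hence the validity condition. *)
Lemma freq_moment_wick L : all valid L ->
  freq_moment L != wick freq_cov L ->
  ((size (undup (map snd L))).*2 < size L)%N.
Proof.
apply: (@wick_defect _ _ valid snd) => //.
- exact: freq_moment_perm.
- exact: freq_moment_nil.
- exact: freq_moment_lone.
- exact: freq_moment_pair.
- by move=> z z' /negPf zz'; rewrite /freq_cov zz' mulr0.
Qed.

End frequency_moments.

(** * Circulant and skew-circulant matrices *)

Section circulants.
Context d (T : measurableType d) (R : realType) (P : probability T R).
Variable tau : int -> {RV P >-> R}.
Hypothesis tau_fin : forall j : int, finite_moments P (tau j).
Variable n : nat.
Local Notation m := n.+1.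
Implicit Types (w : seq (bool * bool)) (l : bool * bool) (y : int).

Definition circulant_entry (b : bool) (i j : nat) (t : T) : R :=
  if (i <= j)%N then freq tau m (b, (j - i)%N) t
  else chi R b * freq tau m (b, (j + m - i)%N) t.

Definition circulant (b : bool) (t : T) : 'M[R]_m :=
  \matrix_(i, j) circulant_entry b i j t.

Definition letter l (t : T) : 'M[R]_m :=
  if l.2 then (circulant l.1 t)^T else circulant l.1 t.

Definition residue y : 'I_m := inord `|(y %% m%:Z)%Z|%N.

Lemma residueE y : (residue y)%:Z = (y %% m%:Z)%Z.
Proof.
have m0 : m%:Z != 0 by [].
have y0 := modz_ge0 y m0; rewrite /residue inordK ?gez0_abs//.
by rewrite -ltz_nat gez0_abs// ltz_pmod.
Qed.

Lemma residue_eq y y' : (residue y == residue y') = (m%:Z %| y - y')%Z.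
Proof.
rewrite -eqz_mod_dvd -!residueE; apply/eqP/eqP => [->//|/eqP].
by rewrite eqz_nat => /eqP /val_inj.
Qed.

Let letter_sign l (q q' : int) : R :=
  if l.1 then 1 else (-1) ^+ `|q' - q|%N.

Let divz_decomp (q r : int) : 0 <= r < m%:Z -> ((q * m%:Z + r) %/ m%:Z)%Z = q.
Proof. by move=> r0; rewrite divzMDl// divz_small ?addr0// ger0_norm. Qed.

(** In the lifted coordinate [y] a letter shifts by a signed frequency, and a
    skew-circulant letter changes sign each time the shift crosses a period. *)
Lemma letter_row l t y j :
  letter l t (residue y) j =
  \sum_(e <- iota 0 m)
    letter_sign l (y %/ m%:Z)%Z ((y + dir l * e%:Z) %/ m%:Z)%Z *
    freq tau m (l.1, e) t * (residue (y + dir l * e%:Z) == j)%:R.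
Proof.
have yE := divz_eq y m%:Z; rewrite -residueE in yE.
set i := residue y in yE *; set q := (y %/ m%:Z)%Z in yE *.
have [im jm] : (i < m)%N /\ (j < m)%N by [].
(* [e0] is the only frequency that leads from [i] to [j], and [q0] the number of
   periods crossed by this shift. *)
pose e0 : nat := if l.2 then (if (j <= i)%N then i - j else i + m - j)%N
                 else (if (i <= j)%N then j - i else j + m - i)%N.
pose q0 : int := if l.2 then (if (j <= i)%N then 0 else -1)
                 else (if (i <= j)%N then 0 else 1).
have e0m : (e0 < m)%N by rewrite /e0; case: l.2; [case: (leqP j i)|case: (leqP i j)]; lia.
have e0E : y + dir l * e0%:Z = (q + q0) * m%:Z + j%:Z.
  rewrite yE mulrDl -!addrA; congr (_ + _).
  by rewrite /e0 /q0 /dir; case: l.2; [case: (leqP j i)|case: (leqP i j)]; lia.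
have rj : residue (y + dir l * e0%:Z) = j.
  apply/val_inj/eqP; rewrite -eqz_nat residueE e0E modzMDl modz_small//.
have e0i : e0 \in iota 0 m by rewrite mem_iota.
rewrite (bigD1_seq e0 e0i (iota_uniq _ _))/= big_seq_cond.
rewrite [X in _ + X]big1 ?addr0; last first.
  move=> e /andP[ei ee0]; have := ei : e \in iota 0 m.
  rewrite mem_iota add0n => /andP[_ em].
  rewrite (_ : (_ == _) = false) ?mulr0//; apply: contra_neqF ee0.
  rewrite -rj residue_eq => /dvdzP[k]; move: em e0m; move: (e0 : nat) (n.+1) => f p ep fp kE.
  have [k0 kN] : k < 1 /\ -1 < k by move: kE; rewrite /dir; case: l.2; split; nia.
  by move: kE; rewrite (_ : k = 0); [rewrite /dir; case: l.2|]; lia.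
rewrite rj eqxx mulr1 e0E divz_decomp; last by lia.
rewrite (_ : letter_sign _ _ _ = if q0 == 0 then 1 else chi R l.1); last first.
  rewrite /letter_sign /chi addrC addKr /q0.
  by case: l.1; case: l.2; case: leqP => //= _; rewrite expr1.
rewrite /letter /circulant /e0 /q0; case: l.2; rewrite !mxE /circulant_entry.
  by case: leqP; rewrite ?mul1r.
by case: leqP; rewrite ?mul1r.
Qed.

Definition word_matrix w t : 'M[R]_m := \prod_(l <- w) letter l t.

Lemma word_row w t y j :
  word_matrix w t (residue y) j =
  \sum_(e <- grid (size w) m)
    holonomy R w [seq (z %/ m%:Z)%Z | z <- walk y w e] *
    (\prod_(z <- zip (map fst w) e) freq tau m z t) *
    (residue (y + drift w e) == j)%:R.
Proof.
elim: w y => [|l w IH] y.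
  by rewrite /word_matrix big_nil /= big_seq1 /= big_nil !mul1r addr0 mxE.
rewrite (_ : word_matrix (l :: w) t = letter l t *m word_matrix w t); last first.
  by rewrite /word_matrix big_cons.
rewrite mxE [size _]/= grid_sumS.
under eq_bigr do rewrite letter_row mulr_suml.
rewrite exchange_big; apply: eq_bigr => e _ /=.
rewrite (bigD1 (residue (y + dir l * e%:Z)))//= eqxx mulr1.
rewrite [X in _ + X]big1 ?addr0; last first.
  by move=> i /negPf ri; rewrite eq_sym ri mulr0 mul0r.
rewrite [X in _ * X]IH mulr_sumr; apply: eq_bigr => v _.
rewrite big_cons -(addrA y).
by case: w v {IH} => [|l' w] [|e' v]; rewrite /= /letter_sign -!mulrA;
  congr (_ * _); exact: mulrCA.
Qed.

(** The diagonal selects the walks whose displacement is divisible by the size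
    of the matrix. *)
Lemma word_trace w t :
  \tr (word_matrix w t) =
  \sum_(x <- iota 0 m) \sum_(e <- grid (size w) m)
    loop_weight R m w x e * \prod_(z <- zip (map fst w) e) freq tau m z t.
Proof.
rewrite /mxtrace (_ : iota 0 m = index_iota 0 m); last by rewrite /index_iota subn0.
rewrite big_mkord; apply: eq_bigr => i _.
have ri : i = residue i%:Z.
  apply/val_inj/eqP; rewrite -eqz_nat residueE modz_small//.
  by rewrite ltz_nat ltn_ord.
rewrite {1}ri word_row; apply: eq_bigr => e _.
rewrite /loop_weight mulrC mulrA; congr (_%:R * _ * _).
by rewrite [in X in _ == X]ri residue_eq addrC addKr.
Qed.

End circulants.

Lemma Rintegral_sum_seq d (T : measurableType d) (R : realType)
    (P : probability T R) (I : Type) (s : seq I) (f : I -> T -> R) :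
  (forall i, P.-integrable setT (EFin \o f i)) ->
  P.-integrable setT (EFin \o (fun t => \sum_(i <- s) f i t)) /\
  \int[P]_t (\sum_(i <- s) f i t) = \sum_(i <- s) \int[P]_t f i t.
Proof.
move=> fi; elim: s => [|i s [IHi IHE]].
  rewrite (_ : (fun t => _) = cst 0); last by apply/funext => t; rewrite big_nil.
  split; last by rewrite big_nil Rintegral_cst// mul0r.
  exact: finite_measure_integrable_cst.
rewrite (_ : (fun t => _) = (fun t => f i t + \sum_(j <- s) f j t)); last first.
  by apply/funext => t; rewrite big_cons.
split; last by rewrite RintegralD// IHE big_cons.
rewrite (_ : _ \o _ = (fun t => (f i t)%:E + (\sum_(j <- s) f j t)%:E)%E)//.
by apply: integrableD => //; exact: fi.
Qed.

Section circulant_variables.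
Context d (T : measurableType d) (R : realType) (P : probability T R).
Variable tau : int -> {RV P >-> R}.
Hypothesis tau_fin : forall j : int, finite_moments P (tau j).
Variable n : nat.
Local Notation m := n.+1.
Implicit Types (w : seq (bool * bool)).

Definition circulant_scale : R := (Num.sqrt (2 * m%:R))^-1.

Definition scaled_circulant (b : bool) (t : T) : 'M[R[i]]_m :=
  map_mx (real_complex R) (circulant_scale *: circulant tau n b t).

Lemma cfin_freq z : cfinite_moments P (fun t => (freq tau m z t)%:C).
Proof.
rewrite (_ : (fun t => _) = (fun t => (tau z.2%:Z t)%:C +
    (chi R z.1)%:C * (tau (z.2%:Z - m%:Z) t)%:C)); last first.
  by apply/funext => t; rewrite /freq rmorphD rmorphM.
have cfin_tau j : cfinite_moments P (fun t => (tau j t)%:C).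
  by apply: cfin_real.
by apply: cfin_add => //; apply: cfin_mul => //; exact: cfin_cst.
Qed.

Lemma scaled_circulant_proof b : rmx_pred P (scaled_circulant b).
Proof.
apply/asboolP => i j.
pose e := if (i <= j)%N then (j - i)%N else (j + m - i)%N.
rewrite (_ : (fun t => _) = (fun t =>
    (circulant_scale * (if (i <= j)%N then 1 else chi R b))%:C *
    (freq tau m (b, e) t)%:C)).
  by apply: cfin_mul; [exact: cfin_cst|exact: cfin_freq].
apply/funext => t; rewrite !mxE /circulant_entry -rmorphM /e.
by case: leqP; rewrite ?mulr1// mulrA.
Qed.

Definition circulant_var (b : bool) : random_mx_ncp P n :=
  RandomMx (scaled_circulant_proof b).

Lemma star_word_circulant w t :
  rmx_val (star_word circulant_var w : random_mx P n) t =
  map_mx (real_complex R) (circulant_scale ^+ size w *: word_matrix tau n w t).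
Proof.
elim: w => [|l w IH].
  by rewrite /star_word /word_matrix !big_nil scale1r map_mx1.
rewrite /star_word /word_matrix !big_cons.
rewrite (_ : rmx_val _ t = rmx_val (if l.2 then rmx_star (circulant_var l.1)
    else circulant_var l.1 : random_mx P n) t *m
  rmx_val (star_word circulant_var w : random_mx P n) t)//.
rewrite IH -[_ * \prod_(_ <- w) _]/(letter tau n l t *m word_matrix tau n w t).
rewrite exprS -scalerA scalemxAr scalemxAl map_mxM; congr (_ *m _).
rewrite /letter; case: l.2 => //; apply/matrixP => i j.
by rewrite !mxE conjc_real.
Qed.

Definition noise_loop_sum (F : seq (bool * nat) -> R) w : R :=
  \sum_(x <- iota 0 m) \sum_(e <- grid (size w) m)
    loop_weight R m w x e * F (zip (map fst w) e).

Definition circulant_moment w : R :=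
  m%:R^-1 * circulant_scale ^+ size w * noise_loop_sum (freq_moment tau m) w.

Lemma circulant_joint_moment w : mutually_independent tau ->
  joint_moment circulant_var w = (circulant_moment w)%:C.
Proof.
move=> tau_indep.
have int_re (f : T -> R) : cintegral P setT (fun t => (f t)%:C) = (\int[P]_t f t)%:C.
  by rewrite /cintegral /=; congr (_ +i* _); rewrite Rintegral_cst//= mul0r.
have lw_int x e : P.-integrable setT (EFin \o (fun t =>
    loop_weight R m w x e * \prod_(z <- zip (map fst w) e) freq tau m z t)).
  rewrite (_ : _ \o _ = (fun t => (loop_weight R m w x e)%:E *
     (\prod_(z <- zip (map fst w) e) freq tau m z t)%:E)%E)//.
  by apply: integrableZl => //; exact: integrable_freq_prod.
have sum_int x := Rintegral_sum_seq (grid (size w) m) (lw_int x).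
have [tot_int totE] := Rintegral_sum_seq (iota 0 m) (fun x => (sum_int x).1).
have -> : joint_moment circulant_var w = m%:R^-1 * cintegral P setT
    (fun t => (circulant_scale ^+ size w * \sum_(x <- iota 0 m)
      \sum_(e <- grid (size w) m) loop_weight R m w x e *
      \prod_(z <- zip (map fst w) e) freq tau m z t)%:C).
  rewrite /joint_moment /= /rmx_phi; congr (_ * cintegral _ _ _).
  apply/funext => t; rewrite star_word_circulant trace_map_mx mxtraceZ.
  by rewrite word_trace.
rewrite int_re RintegralZl// totE /circulant_moment -mulrA [RHS]rmorphM.
congr (_ * _); first by rewrite fmorphV rmorph_nat.
congr (_ * _)%:C; apply: eq_bigr => x _; rewrite (sum_int x).2.
apply: eq_bigr => e _; rewrite RintegralZl//; exact: integrable_freq_prod.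
Qed.

(** Above the diagonal the sum of the two entries is [2 tau_(j - i)], the
    wrapped noises cancelling; below it the sign of the skew-circulant entry
    leaves the wrapped noise instead. *)
Lemma circulant_sum :
  ((Num.sqrt 2)^-1)%:C *: (circulant_var true + circulant_var false) =
  ((Num.sqrt m%:R)^-1)%:C *: toeplitz tau_fin n :> random_mx_ncp P n.
Proof.
apply/val_inj/funext => t; apply/matrixP => i j; rewrite !mxE.
rewrite -rmorphD -!rmorphM; congr (_%:C).
rewrite -mulrDr /circulant_scale sqrtrM// invfM; set a := (Num.sqrt 2)^-1.
have a2 : a * a = 2^-1 by rewrite /a -invfM -expr2 sqr_sqrtr.
set q := (Num.sqrt m%:R)^-1; set X := _ + _.
rewrite (_ : a * _ = q * (a * a * X)); last by ring.
congr (_ * _); rewrite a2 /X /circulant_entry /freq /chi.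
case: leqP => ij /=.
  rewrite (_ : (j - i)%N%:Z = j%:Z - i%:Z); last by rewrite subzn.
  by field.
rewrite (_ : (j + m - i)%N%:Z - m%:Z = j%:Z - i%:Z); last first.
  by have := ltn_ord i; lia.
by field.
Qed.

(** Two shifts in opposite directions commute: both products sum over the same
    pairs of frequencies, only the order in which they are met differs. *)
Lemma circulant_normal b :
  circulant_var b * ncp_star (circulant_var b) =
  ncp_star (circulant_var b) * circulant_var b.
Proof.
have wE (s s' : bool) : star_word circulant_var [:: (b, s); (b, s')] =
    (if s then ncp_star (circulant_var b) else circulant_var b) *
    (if s' then ncp_star (circulant_var b) else circulant_var b).
  by rewrite /star_word !big_cons big_nil mulr1.
rewrite -(wE false true) -(wE true false).
apply/val_inj/funext => t; rewrite [LHS]star_word_circulant [RHS]star_word_circulant.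
congr (map_mx _ (_ *: _)); apply/matrixP => i j.
have [y ->] : exists y, i = residue n y.
  by exists i%:Z; apply/val_inj/eqP; rewrite -eqz_nat residueE modz_small//
    ltz_nat ltn_ord.
rewrite !word_row !grid_sumS; under eq_bigr do rewrite grid_sumS.
under [RHS]eq_bigr do rewrite grid_sumS.
rewrite [RHS]exchange_big; apply: eq_bigr => e _; apply: eq_bigr => e' _.
rewrite !big_seq1.
congr (_ * _ * _).
- have [bt|bf] := boolP b.
    by rewrite !holonomy_circulant//= bt.
  rewrite !holonomy_skew//= ?bf//.
  by congr (_ ^+ `|(_ %/ _)%Z - _|%N); rewrite /dir /=; ring.
- by rewrite /= !big_cons big_nil !mulr1 mulrC.
- by congr ((residue n _ == _)%:R); rewrite /= /dir /=; ring.
Qed.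

End circulant_variables.

(** * Limits of the joint moments *)

Section moment_limit.
Context d (T : measurableType d) (R : realType) (P : probability T R).
Variable tau : int -> {RV P >-> R}.
Hypothesis tau_indep : mutually_independent tau.
Hypothesis tau_ident : identically_distributed tau.
Hypothesis tau_mean : forall j : int, ('E_P[tau j] = 0)%E.
Hypothesis tau_var : forall j : int, ('V_P[tau j] = 1)%E.
Hypothesis tau_fin : forall j : int, finite_moments P (tau j).
Implicit Types (w : seq (bool * bool)).

Definition same_kind (l l' : bool * bool) : R := (l.1 == l'.1)%:R.

Definition pairing_moment w n : R :=
  \sum_(J <- codes (size w)) weight same_kind J w * pairing_average R J w n.

Let scale_sq n : circulant_scale R n ^+ 2 = (2 * n.+1%:R)^-1.
Proof. by rewrite /circulant_scale exprVn sqr_sqrtr// mulr_ge0. Qed.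

(** Powers of the size balance: the scale contributes [(2 m) ^ - k] for [k]
    pairs, the covariances [2 ^ k], and the remaining [m ^ - (k + 1)] normalises
    the average over the starting point and [k] frequencies. *)
Lemma wick_loop_sum w n :
  n.+1%:R^-1 * circulant_scale R n ^+ size w *
    noise_loop_sum n (wick (freq_cov R)) w = pairing_moment w n.+1.
Proof.
rewrite /noise_loop_sum /pairing_moment /pairing_average /lattice_average.
have sizes e : e \in grid (size w) n.+1 -> size (map fst w) = size e.
  by rewrite mem_grid size_map => /andP[/eqP ->].
have -> : \sum_(x <- iota 0 n.+1) \sum_(e <- grid (size w) n.+1)
     loop_weight R n.+1 w x e * wick (freq_cov R) (zip (map fst w) e) =
   \sum_(J <- codes (size w)) \sum_(x <- iota 0 n.+1) 2 ^+ size J * weight same_kind J w *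
     \sum_(e <- grid (size w) n.+1)
       weight (fun x y => (x == y)%:R) J e * loop_weight R n.+1 w x e.
  rewrite [RHS]exchange_big; apply: eq_bigr => x _.
  under [RHS]eq_bigr do rewrite mulr_sumr.
  rewrite [RHS]exchange_big big_seq [RHS]big_seq; apply: eq_bigr => e eg.
  have se := sizes e eg.
  rewrite mulr_sumr size_zip -se minnn size_map big_seq [RHS]big_seq.
  apply: eq_bigr => J /mem_codes[wJ sJ].
  rewrite weight_mul weight_mul weight_const//; last first.
    by rewrite size_zip -se minnn size_map.
  rewrite -(weight_map snd (fun a b => (a == b)%:R)).
  rewrite -(weight_map fst (fun a b => (a == b)%:R)).
  rewrite -/(unzip1 _) -/(unzip2 _) unzip2_zip ?unzip1_zip ?se// weight_map.
  by rewrite /same_kind; ring.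
rewrite mulr_sumr big_seq [RHS]big_seq; apply: eq_bigr => J /mem_codes[wJ sJ].
rewrite -sJ -mulr_sumr; under eq_bigr do rewrite grid_sum_expand//.
rewrite grid_sumS /= -mul2n exprM scale_sq.
set S := \sum_(x <- _) _; set W := weight _ _ _.
rewrite exprVn exprMn exprS; field.
by rewrite !expf_neq0 ?pnatr_eq0 ?nat1r ?pnatr_eq0.
Qed.

(** Only the exceptional frequency tuples counted by [grid_defect_count]
    contribute, each by a bounded amount. *)
Lemma circulant_moment_approx w : exists C : R, forall n,
  `|circulant_moment tau n w - pairing_moment w n.+1| <= C / Num.sqrt n.+1%:R.
Proof.
have [B BP] := noise_moment_bounded tau_indep tau_ident tau_fin.
set p := size w.
(* [K] bounds a frequency moment plus the Wick sum replacing it. *)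
pose K := 2 ^+ p * B p + (size (codes p))%:R * 2 ^+ p./2.
have B0 : 0 <= B p.
  by have := BP (nseq p 0); rewrite size_nseq; apply: le_trans.
have K0 : 0 <= K by rewrite addr_ge0 ?mulr_ge0 ?exprn_ge0.
exists (K * (p * p`!)%:R) => n; rewrite -wick_loop_sum /circulant_moment -mulrBr.
set q : R := Num.sqrt n.+1%:R; set s := circulant_scale R n.
have q0 : 0 < q by rewrite sqrtr_gt0.
have s0 : 0 <= s by rewrite invr_ge0 sqrtr_ge0.
have sq : s <= q^-1.
  rewrite lef_pV2 ?posrE ?sqrtr_gt0 ?mulr_gt0// ler_wsqrtr//.
  by rewrite ler_peMl// ler1n.
pose D (e : seq nat) : R := ((size (undup e)).*2 < p)%:R.
have dle : `|noise_loop_sum n (freq_moment tau n.+1) w -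
    noise_loop_sum n (wick (freq_cov R)) w| <=
    \sum_(x <- iota 0 n.+1) \sum_(e <- grid p n.+1) K * D e.
  rewrite /noise_loop_sum -sumrB; apply: le_trans (ler_norm_sum _ _ _) _.
  apply: ler_sum => x _; rewrite -sumrB; apply: le_trans (ler_norm_sum _ _ _) _.
  rewrite big_seq [leRHS]big_seq; apply: ler_sum => e; rewrite mem_grid.
  move=> /andP[/eqP se /allP ve]; set L := zip _ _.
  have sew : size (map fst w) = size e by rewrite size_map se.
  have sL : size L = p by rewrite size_zip sew minnn.
  rewrite -mulrBr normrM -[leRHS]mul1r ler_pM//.
    by apply: le_trans (loop_weight_norm _ _ _ _ _) _; rewrite lern1 leq_b1.
  have [->|FW] := eqVneq (freq_moment tau n.+1 L) (wick (freq_cov R) L).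
    by rewrite subrr normr0 mulr_ge0.
  have vL : all (fun z => z.2 < n.+1)%N L.
    rewrite -(all_map snd (fun j => j < n.+1)%N) -/(unzip2 L) /L.
    by rewrite unzip2_zip ?sew//; exact/allP.
  have := freq_moment_wick tau_indep tau_mean tau_var tau_fin vL FW.
  rewrite -/(unzip2 L) sL [unzip2 L]unzip2_zip ?sew// /D => ->.
  rewrite mulr1 (le_trans (ler_normB _ _))// lerD//.
    by rewrite -sL; exact: freq_moment_le.
  rewrite -sL; apply: wick_norm => // z z'.
  rewrite /freq_cov; do 2!case: (_ == _); rewrite ?mulr1 ?mulr0 ?normr0//.
  by rewrite ger0_norm.
rewrite normrM ger0_norm ?mulr_ge0 ?invr_ge0 ?exprn_ge0//.
apply: le_trans (ler_wpM2l _ dle) _; first by rewrite mulr_ge0 ?invr_ge0 ?exprn_ge0.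
rewrite big_const_seq count_predT size_iota iter_addr_0 -mulr_sumr.
have := @grid_defect_count R p n.+1 isT; rewrite -/q -/D.
set S := \sum_(e <- _) _ => qS.
have S0 : 0 <= S by apply: sumr_ge0.
rewrite -[(K * S) *+ _]mulr_natl mulrACA mulVf ?pnatr_eq0// mul1r.
apply: (@le_trans _ _ (q^-1 ^+ p * (K * S))).
  by rewrite ler_wpM2r ?mulr_ge0// lerXn2r ?nnegrE ?invr_ge0// ltW.
rewrite mulrCA -mulrA ler_wpM2l// exprVn ler_pdivrMl ?exprn_gt0//.
by rewrite mulrA ler_pdivlMr// mulrC [leRHS]mulrC.
Qed.

Lemma pairing_moment_cvg w : cvgn (fun n => pairing_moment w n.+1).
Proof.
rewrite /pairing_moment; elim: (codes _) => [|J s IH].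
  rewrite (_ : (fun n => _) = cst 0); first exact: is_cvg_cst.
  by apply/funext => n; rewrite big_nil.
rewrite (_ : (fun n => _) = (fun n => weight same_kind J w * pairing_average R J w n.+1
  + \sum_(J <- s) weight same_kind J w * pairing_average R J w n.+1)).
  by apply: is_cvgD => //; apply: is_cvgMr; exact: pairing_average_cvg.
by apply/funext => n; rewrite big_cons.
Qed.

Lemma circulant_moment_cvg w (l : R) :
  pairing_moment w n.+1 @[n --> \oo] --> l ->
  circulant_moment tau n w @[n --> \oo] --> l.
Proof.
move=> pl; have [C CP] := circulant_moment_approx w.
rewrite (_ : (fun n => _) = (fun n => pairing_moment w n.+1 +
  (circulant_moment tau n w - pairing_moment w n.+1))); last first.
  by apply/funext => n; rewrite addrC subrK.
rewrite -[l]addr0; apply: cvgD => //.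
have C0 : 0 <= C.
  have := le_trans (normr_ge0 _) (CP 0%N).
  by rewrite pmulr_lge0// invr_gt0 sqrtr_gt0.
apply/cvgrPdist_lt => e e0; near=> n.
rewrite sub0r normrN; apply: le_lt_trans (CP n) _.
rewrite ltr_pdivrMr ?sqrtr_gt0// mulrC -ltr_pdivrMr//.
have -> : C / e = Num.sqrt ((C / e) ^+ 2).
  by rewrite sqrtr_sqr ger0_norm// divr_ge0// ltW.
rewrite ltr_sqrt//.
rewrite (@lt_le_trans _ _ (Num.truncn ((C / e) ^+ 2)).+1%:R) ?truncnS_gt// ler_nat ltnS.
by near: n; exists (Num.truncn ((C / e) ^+ 2)).
Unshelve. all: by end_near. Qed.

Definition limit_moment w : R := limn (fun n => pairing_moment w n.+1).

Lemma circulant_moment_lim w :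
  circulant_moment tau n w @[n --> \oo] --> limit_moment w.
Proof. by apply: circulant_moment_cvg; exact: pairing_moment_cvg. Qed.

Lemma limit_moment_norm w : `|limit_moment w| <= (size (codes (size w)))%:R.
Proof.
have := pairing_moment_cvg (w := w) => pc.
have npc : `|pairing_moment w n.+1| @[n --> \oo] --> `|limit_moment w|.
  exact: (cvg_norm pc).
rewrite -(cvg_lim _ npc)//; apply: limr_le; first by apply/cvg_ex; eexists; exact: npc.
apply: nearW => n; apply: le_trans (ler_norm_sum _ _ _) _.
apply: (@le_trans _ _ (\sum_(J <- codes (size w)) 1)).
  apply: ler_sum => J _; rewrite normrM mulr_ile1 ?pairing_average_norm//.
  apply: weight_norm_le1 => l l'; rewrite /same_kind.
  by case: (_ == _); rewrite ?normr1 ?normr0.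
by rewrite big_const_seq count_predT iter_addr_0.
Qed.

(** On words in a single variable the signs cancel around each closed loop. *)
Lemma limit_moment_pure (b : bool) w : all (fun l => l.1 == b) w ->
  limit_moment w = wick (opposite R) w.
Proof.
move=> wb; apply: cvg_lim => //.
have hol qs : size qs = (size w).+1 -> last 0 qs = head 0 qs -> holonomy R w qs = 1.
  move=> sq lq; case: b wb => wb.
    by apply: holonomy_circulant; apply: sub_all wb => l /eqP.
  case: qs sq lq => // q qs /= [sq] lq; rewrite holonomy_skew//.
    by rewrite lq subrr.
  by apply: sub_all wb => l /eqP ->.
have same J : wfcode J -> size w = (size J).*2 -> weight same_kind J w = 1.
  move=> wJ; elim: J w wb wJ {hol} => [|j J IH] [|l w] //= /andP[/eqP lb wb].
  move=> /andP[jJ wJ] [sw].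
  have jw : (j < size w)%N by rewrite sw.
  have wb' : all (fun l => l.1 == b) (nth l w j :: remove j w).
    by rewrite -(perm_all _ (perm_remove l jw)).
  case/andP: wb' => /eqP nb wb'.
  by rewrite IH ?size_remove ?sw// /same_kind lb nb eqxx mulr1.
rewrite /pairing_moment /wick.
have : {in codes (size w), forall J, wfcode J /\ (size J).*2 = size w}.
  by move=> J; exact: mem_codes.
elim: (codes _) => [_|J s IH sP].
  rewrite big_nil (_ : (fun n => _) = cst 0); first exact: cvg_cst.
  by apply/funext => n; rewrite big_nil.
rewrite big_cons.
rewrite (_ : (fun n => _) = (fun n => pairing_average R J w n.+1
  + \sum_(J <- s) weight same_kind J w * pairing_average R J w n.+1)); last first.
  apply/funext => n; rewrite big_cons same ?mul1r//.
    by case: (sP J (mem_head _ _)).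
  by case: (sP J (mem_head _ _)).
have [wJ sJ] := sP J (mem_head _ _).
apply: cvgD; first exact: pairing_average_pure.
by apply: IH => K Ks; apply: sP; rewrite inE Ks orbT.
Qed.

End moment_limit.

(** * The limit of a sequence of non-commutative probability spaces *)

Section sequence_algebra.
Variables (R : realType) (B : nat -> ncp R).

(** Sequences of elements, with pointwise operations: a product of algebras,
    in which identities holding in each factor hold. *)
Definition seq_alg : Type := forall n, B n.

HB.instance Definition _ := gen_eqMixin seq_alg.
HB.instance Definition _ := gen_choiceMixin seq_alg.

Implicit Types X Y Z : seq_alg.

Let add X Y : seq_alg := fun n => X n + Y n.
Let opp X : seq_alg := fun n => - X n.
Let zero : seq_alg := fun=> 0.
Let mul X Y : seq_alg := fun n => X n * Y n.
Let one : seq_alg := fun=> 1.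
Let scale (c : R[i]) X : seq_alg := fun n => c *: X n.

Let ext X Y : (forall n, X n = Y n) -> X = Y.
Proof. exact: functional_extensionality_dep. Qed.

Let addA : associative add. Proof. by move=> X Y Z; apply: ext => n; exact: addrA. Qed.
Let addC : commutative add. Proof. by move=> X Y; apply: ext => n; exact: addrC. Qed.
Let add0 : left_id zero add. Proof. by move=> X; apply: ext => n; exact: add0r. Qed.
Let addN : left_inverse zero opp add.
Proof. by move=> X; apply: ext => n; exact: addNr. Qed.

HB.instance Definition _ := GRing.isZmodule.Build seq_alg addA addC add0 addN.

Let mulA : associative mul. Proof. by move=> X Y Z; apply: ext => n; exact: mulrA. Qed.
Let mul1 : left_id one mul. Proof. by move=> X; apply: ext => n; exact: mul1r. Qed.
Let mulr1' : right_id one mul. Proof. by move=> X; apply: ext => n; exact: mulr1. Qed.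
Let mulDl : left_distributive mul +%R.
Proof. by move=> X Y Z; apply: ext => n; exact: mulrDl. Qed.
Let mulDr : right_distributive mul +%R.
Proof. by move=> X Y Z; apply: ext => n; exact: mulrDr. Qed.
Let one_neq0 : one != 0.
Proof.
by apply/eqP => /(congr1 (fun X : seq_alg => X 0%N)) /eqP; rewrite oner_eq0.
Qed.

HB.instance Definition _ :=
  GRing.Zmodule_isNzRing.Build seq_alg mulA mul1 mulr1' mulDl mulDr one_neq0.

Let scaleA a b X : scale a (scale b X) = scale (a * b) X.
Proof. by apply: ext => n; exact: scalerA. Qed.
Let scale1 : left_id 1 scale.
Proof. by move=> X; apply: ext => n; exact: scale1r. Qed.
Let scaleDr : right_distributive scale +%R.
Proof. by move=> c X Y; apply: ext => n; exact: scalerDr. Qed.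
Let scaleDl X : {morph scale^~ X : a b / a + b}.
Proof. by move=> a b; apply: ext => n; exact: scalerDl. Qed.

HB.instance Definition _ :=
  GRing.Zmodule_isLmodule.Build R[i] seq_alg scaleA scale1 scaleDr scaleDl.

Let scaleAl c X Y : c *: (X * Y) = c *: X * Y.
Proof. by apply: ext => n; exact: scalerAl. Qed.

HB.instance Definition _ := GRing.Lmodule_isLalgebra.Build R[i] seq_alg scaleAl.

Let scaleAr c X Y : c *: (X * Y) = X * (c *: Y).
Proof. by apply: ext => n; exact: scalerAr. Qed.

HB.instance Definition _ := GRing.Lalgebra_isAlgebra.Build R[i] seq_alg scaleAr.

Variables (I : Type) (x : forall n, I -> B n).
Variable mu : seq (I * bool) -> R[i].
Hypothesis x_cvg : forall w,
  (fun n => joint_moment (x n) w : R[i]^o) @ \oo --> (mu w : R[i]^o).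

Definition seq_word (w : seq (I * bool)) : seq_alg := fun n => star_word (x n) w.

Let seq_word1 : seq_word [::] = 1.
Proof. by apply: ext => n; rewrite /seq_word /star_word big_nil. Qed.

Let seq_wordM v w : seq_word v * seq_word w = seq_word (v ++ w).
Proof. by apply: ext => n; rewrite /seq_word /star_word big_cat. Qed.

Definition word_span (X : seq_alg) : Prop :=
  exists s : seq (R[i] * seq (I * bool)), X = \sum_(p <- s) p.1 *: seq_word p.2.

Definition word_span_pred : pred seq_alg := fun X => `[< word_span X >].

Lemma word_span_subalg : subalg_closed word_span_pred.
Proof.
split.
- by apply/asboolP; exists [:: (1, [::])]; rewrite big_seq1 scale1r seq_word1.
- move=> c X Y /asboolP[s ->] /asboolP[t ->]; apply/asboolP.
  exists ([seq (c * p.1, p.2) | p <- s] ++ t).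
  rewrite big_cat big_map scaler_sumr; congr (_ + _).
  by apply: eq_bigr => p _; rewrite scalerA.
- move=> X Y /asboolP[s ->] /asboolP[t ->]; apply/asboolP.
  exists [seq (p.1 * q.1, p.2 ++ q.2) | p <- s, q <- t].
  rewrite big_allpairs_dep mulr_suml; apply: eq_bigr => p _.
  rewrite mulr_sumr; apply: eq_bigr => q _ /=.
  by rewrite -seq_wordM -scalerAl -scalerAr scalerA.
Qed.

HB.instance Definition _ :=
  GRing.isSubalgClosed.Build R[i] seq_alg word_span_pred word_span_subalg.

(** The limit functional is defined on linear combinations of words only, since
    moments of arbitrary sequences need not converge. *)
Record limit_alg := LimitAlg {
  limit_val :> seq_alg ;
  limit_valP : word_span_pred limit_val }.

HB.instance Definition _ := [isSub for limit_val].
HB.instance Definition _ := [Choice of limit_alg by <:].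
HB.instance Definition _ := [SubChoice_isSubAlgebra of limit_alg by <:].

Let seq_star X : seq_alg := fun n => ncp_star (X n).

Let ncp_star0 (A : ncp R) : ncp_star (0 : A) = 0.
Proof.
by have := ncp_starZ (0 : R[i]) (0 : A); rewrite scale0r rmorph0 scale0r.
Qed.

Let ncp_star1 (A : ncp R) : ncp_star (1 : A) = 1.
Proof.
rewrite -[RHS](@ncp_starK _ A) -[in RHS](mul1r (ncp_star (1 : A))).
by rewrite ncp_starM ncp_starK mul1r.
Qed.

(** The word of the adjoint. *)
Let flip (w : seq (I * bool)) := rev [seq (l.1, ~~ l.2) | l <- w].

Let seq_star_word w : seq_star (seq_word w) = seq_word (flip w).
Proof.
apply: ext => n; rewrite /seq_star /seq_word /star_word /flip.
elim: w => [|l w IH]; first by rewrite !big_nil ncp_star1.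
rewrite big_cons ncp_starM IH/= rev_cons -cats1 big_cat big_seq1/=.
by congr (_ * _); case: l.2; rewrite /= ?ncp_starK.
Qed.

Lemma limit_star_proof (X : limit_alg) : word_span_pred (seq_star X).
Proof.
have /asboolP[s ->] := limit_valP X; apply/asboolP.
exists [seq (p.1^*, flip p.2) | p <- s].
rewrite big_map; elim: s => [|p s IH].
  by rewrite !big_nil; apply: ext => n; exact: ncp_star0.
rewrite !big_cons -IH -seq_star_word; apply: ext => n.
by apply: etrans (ncp_starD _ _) _; congr (_ + _); exact: ncp_starZ.
Qed.

Definition limit_star (X : limit_alg) : limit_alg := LimitAlg (limit_star_proof X).

Definition limit_phi (X : limit_alg) : R[i] :=
  lim ((fun n => ncp_phi (B n) (limit_val X n) : R[i]^o) @ \oo).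

Let limit_phi_cvg (X : limit_alg) :
  (fun n => ncp_phi (B n) (limit_val X n) : R[i]^o) @ \oo --> (limit_phi X : R[i]^o).
Proof.
suff [l Xl] : exists l : R[i]^o, (fun n => ncp_phi (B n) (limit_val X n) : R[i]^o) @ \oo --> l.
  by apply: (cvgP l).
have /asboolP[s ->] := limit_valP X.
elim: s => [|p s [l IH]].
  exists 0; rewrite big_nil.
  rewrite (_ : (fun n => _) = cst (0 : R[i]^o)); first exact: cvg_cst.
  by apply/funext => n; exact: linear0.
exists (p.1 *: (mu p.2 : R[i]^o) + l); rewrite big_cons.
rewrite (_ : (fun n => _) = (fun n => p.1 *: (joint_moment (x n) p.2 : R[i]^o) +
  (ncp_phi (B n) ((\sum_(p <- s) p.1 *: seq_word p.2) n) : R[i]^o))).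
  by apply: cvgD => //; apply: cvgZl_tmp; exact: x_cvg.
by apply/funext => n; exact: linearP.
Qed.

Let limit_phi_eq (X : limit_alg) (l : R[i]) :
  (fun n => ncp_phi (B n) (limit_val X n) : R[i]^o) @ \oo --> (l : R[i]^o) ->
  limit_phi X = l.
Proof. exact: (@cvg_lim R[i]^o). Qed.

Lemma limit_phi_linear : scalar limit_phi.
Proof.
move=> c X Y; apply: limit_phi_eq.
rewrite (_ : (fun n => _) = (fun n => c *: (ncp_phi (B n) (limit_val X n) : R[i]^o) +
  (ncp_phi (B n) (limit_val Y n) : R[i]^o))).
  apply: cvgD; last exact: limit_phi_cvg.
  by apply: cvgZl_tmp; exact: limit_phi_cvg.
by apply/funext => n; exact: linearP.
Qed.

HB.instance Definition _ :=
  GRing.isLinear.Build R[i] limit_alg R[i] *%R limit_phi limit_phi_linear.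

Lemma limit_phi1 : limit_phi 1 = 1.
Proof.
apply: limit_phi_eq; rewrite (_ : (fun n => _) = cst (1 : R[i]^o)); first exact: cvg_cst.
by apply/funext => n; exact: ncp_phi1.
Qed.

Lemma limit_starD (X Y : limit_alg) : limit_star (X + Y) = limit_star X + limit_star Y.
Proof. by apply/val_inj/ext => n; exact: ncp_starD. Qed.

Lemma limit_starZ (c : R[i]) (X : limit_alg) : limit_star (c *: X) = c^* *: limit_star X.
Proof. by apply/val_inj/ext => n; exact: ncp_starZ. Qed.

Lemma limit_starM (X Y : limit_alg) : limit_star (X * Y) = limit_star Y * limit_star X.
Proof. by apply/val_inj/ext => n; exact: ncp_starM. Qed.

Lemma limit_starK (X : limit_alg) : limit_star (limit_star X) = X.
Proof. by apply/val_inj/ext => n; exact: ncp_starK. Qed.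

Definition limit_ncp : ncp R :=
  @NCP R limit_alg limit_star limit_starD limit_starZ limit_starM limit_starK
    limit_phi limit_phi1.

Lemma limit_gen_proof i : word_span_pred (fun n => x n i).
Proof.
apply/asboolP; exists [:: (1, [:: (i, false)])]; rewrite big_seq1 scale1r.
by apply: ext => n; rewrite /seq_word /star_word big_seq1.
Qed.

Definition limit_gen i : limit_ncp := LimitAlg (limit_gen_proof i).

Lemma limit_star_wordE w n : limit_val (star_word limit_gen w : limit_alg) n = star_word (x n) w.
Proof.
rewrite /star_word; elim: w => [|l w IH]; first by rewrite !big_nil.
by rewrite !big_cons -IH; case: l.2.
Qed.

Lemma limit_joint_moment w : joint_moment limit_gen w = mu w.
Proof.
apply: limit_phi_eq.
by under eq_fun do rewrite limit_star_wordE; exact: x_cvg.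
Qed.

End sequence_algebra.

(** The limit moments are realised on the algebra spanned by words inside the
    product of the given spaces rather than on free words: there the variables
    satisfy the relations that hold at each index, normality in particular. *)
Lemma ncp_limit (R : realType) (B : nat -> ncp R) (I : Type)
    (x : forall n, I -> B n) (mu : seq (I * bool) -> R[i]) :
  (forall w, (fun n => joint_moment (x n) w : R[i]^o) @ \oo --> (mu w : R[i]^o)) ->
  exists (A : ncp R) (a : I -> A),
    (forall w, joint_moment a w = mu w) /\
    (forall i, (forall n, x n i * ncp_star (x n i) = ncp_star (x n i) * x n i) ->
      a i * ncp_star (a i) = ncp_star (a i) * a i).
Proof.
move=> x_cvg; exists (limit_ncp x_cvg), (limit_gen x_cvg); split.
  exact: limit_joint_moment.
move=> i xn; apply/val_inj/functional_extensionality_dep => n.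
exact: xn.
Qed.

(** * Moments of real Gaussian laws *)

Section gaussian_moments.
Variable R : realType.
Notation mu := (@lebesgue_measure R).

Lemma integral_derive_eq0 (F f : R -> R) :
  (forall x : R, is_derive x 1 F (f x)) -> continuous f ->
  mu.-integrable setT (EFin \o f) ->
  F n.+1%:R @[n --> \oo] --> (0 : R) -> F (- n.+1%:R) @[n --> \oo] --> (0 : R) ->
  (\int[mu]_x (f x)%:E = 0)%E.
Proof.
move=> dF cf fi Fp Fn.
have Fc : continuous F.
  by move=> x; apply: differentiable_continuous; apply/derivable1_diffP; case: (dF x).
have mf : measurable_fun setT f by exact: continuous_measurable_fun.
pose I n := `[- n.+1%:R : R, n.+1%:R]%classic.
have FTC n : (\int[mu]_(x in I n) (f x)%:E = (F n.+1%:R)%:E - (F (- n.+1%:R))%:E)%E.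
  apply: continuous_FTC2.
  - by rewrite (lt_trans (_ : _ < 0)) ?oppr_lt0.
  - exact: continuous_subspaceT.
  - split.
    + by move=> x _; case: (dF x).
    + exact/cvg_at_right_filter/Fc.
    + exact/cvg_at_left_filter/Fc.
  - by move=> x _; rewrite derive1E; case: (dF x).
have L1 : (\int[mu]_(x in I n) (f x)%:E)%E @[n --> \oo] --> (0 : R)%:E.
  under eq_fun do rewrite FTC -EFinB.
  apply: cvg_EFin; first by apply: nearW.
  by rewrite -[X in _ --> X]subr0; exact: cvgB.
have mI n : measurable (I n) by exact: measurable_itv.
have L2 : (\int[mu]_(x in I n) (f x)%:E)%E @[n --> \oo] --> (\int[mu]_x (f x)%:E)%E.
  under eq_fun do rewrite integral_mkcond.
  pose g n : R -> \bar R := (EFin \o f) \_ (I n).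
  have mg n : measurable_fun setT (g n).
    apply/(measurable_restrictT (EFin \o f) (mI n)); apply/measurable_EFinP.
    exact: measurable_funTS.
  have mEf : measurable_fun setT (EFin \o f) by exact/measurable_EFinP.
  have gf : {ae mu, forall x, setT x -> g ^~ x @ \oo --> (EFin \o f) x}.
    apply: aeW => x _.
    rewrite (_ : nbhs ((EFin \o f) x) = nbhs (f x)%:E)//.
    apply: cvg_near_cst; near=> n.
    rewrite /g patchE ifT// inE /I /= in_itv/= -ler_norml.
    apply: le_trans (ltW (truncnS_gt _)) _.
    by rewrite ler_nat ltnS; near: n; exists (Num.truncn `|x|).
  have gle : {ae mu, forall x n, setT x -> (`|g n x| <= (abse \o (EFin \o f)) x)%E}.
    apply: aeW => x n _; rewrite /g patchE; case: ifP => //= _.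
    by rewrite normr0 lee_fin.
  by have [_ _] := @dominated_convergence _ _ R mu setT measurableT g (EFin \o f)
    (abse \o (EFin \o f)) mg mEf gf (integrable_abse fi) gle.
exact: (cvg_unique _ L2 L1).
Unshelve. all: by end_near. Qed.

Variable s : R.
Hypothesis s0 : 0 < s.

Let gauss x : R := normal_fun 0 s x.

(** Half of the exponent absorbs the power: the Gaussian is the square of a wider
    one, and the exponential dominates every term of its series. *)
Let powM_le k : exists2 K : R, 0 <= K & forall x,
  `|x| ^+ k * gauss x <= K * normal_fun 0 (s * Num.sqrt 2) x.
Proof.
have s20 : 0 < s ^+ 2 by rewrite exprn_gt0.
pose K : R := 1 + (4 * s ^+ 2) ^+ k.+1 * (k.+1)`!%:R.
exists K; first by rewrite addr_ge0// mulr_ge0// exprn_ge0// mulr_ge0// ltW.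
move=> x; pose y := x ^+ 2 / (4 * s ^+ 2).
have y0 : 0 <= y by rewrite divr_ge0 ?sqr_ge0// mulr_ge0// sqr_ge0.
have -> : gauss x = expR (- y) * expR (- y).
  rewrite -expRD /gauss /normal_fun subr0 /y; congr expR; field.
  by rewrite gt_eqF.
have -> : normal_fun 0 (s * Num.sqrt 2) x = expR (- y).
  rewrite /normal_fun subr0 exprMn sqr_sqrtr// /y; congr expR; field.
  by rewrite gt_eqF.
rewrite mulrA ler_wpM2r ?expR_ge0// expRN ler_pdivrMr ?expR_gt0//.
have E1 : 1 <= expR y by rewrite -expR0 ler_expR.
have E2 : (x ^+ 2) ^+ k.+1 <= (4 * s ^+ 2) ^+ k.+1 * (k.+1)`!%:R * expR y.
  rewrite (_ : x ^+ 2 = 4 * s ^+ 2 * y); last first.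
    by rewrite /y; field; rewrite gt_eqF.
  have A0 : 0 <= (4 * s ^+ 2) ^+ k.+1 by rewrite exprn_ge0// mulr_ge0// ltW.
  rewrite [in leLHS]exprMn -mulrA ler_wpM2l//.
  rewrite mulrC -ler_pdivrMr ?ltr0n ?fact_gt0//.
  by apply: le_trans (expR_ge1Dxn k y0); rewrite lerDr.
have E3 : `|x| ^+ k <= 1 + (x ^+ 2) ^+ k.+1.
  rewrite -(real_normK (num_real x)); move: `|x| (normr_ge0 x) => z z0.
  have [z1|z1] := leP z 1.
    by rewrite (le_trans (exprn_ile1 _ z0 z1))// lerDl !exprn_ge0.
  rewrite -exprM (le_trans (_ : _ <= z ^+ (2 * k.+1)))//.
    by rewrite ler_weXn2l ?(ltW z1)//; lia.
  by rewrite lerDr.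
by rewrite /K mulrDl mul1r (le_trans E3)// lerD.
Qed.

Let gauss_ge0 x : 0 <= gauss x. Proof. exact: normal_fun_ge0. Qed.

Let wide_neq0 : s * Num.sqrt 2 != 0.
Proof. by rewrite gt_eqF// mulr_gt0// sqrtr_gt0. Qed.

Let integrable_wide :
  mu.-integrable setT (EFin \o normal_fun 0 (s * Num.sqrt 2)).
Proof.
have := integrable_normal_pdf 0 (s * Num.sqrt 2).
rewrite normal_pdfE// => /(integrableZl measurableT (normal_peak (s * Num.sqrt 2))^-1).
rewrite (_ : (fun x => _) = (EFin \o normal_fun 0 (s * Num.sqrt 2)))//.
apply/funext => x /=; rewrite -EFinM mulKf// gt_eqF//.
exact: normal_peak_gt0.
Qed.

Let integrable_powM k : mu.-integrable setT (fun x => (x ^+ k * gauss x)%:E).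
Proof.
have [K K0 KP] := powM_le k.
apply: (le_integrable measurableT _ _ (integrableZl measurableT K integrable_wide)).
  apply/measurable_EFinP; apply: measurable_funM; first exact: measurable_funX.
  exact: measurable_normal_fun.
move=> x _ /=; rewrite lee_fin normrM normrX (ger0_norm (gauss_ge0 _)).
by apply: le_trans (KP x) _; exact: ler_norm.
Qed.

Let powM_cvg0 k (u : nat -> R) : (forall n, `|u n| = n.+1%:R) ->
  u n ^+ k * gauss (u n) @[n --> \oo] --> (0 : R).
Proof.
move=> un; have [K K0 KP] := powM_le k.+1.
have KP' n : `|u n ^+ k * gauss (u n)| <= K / n.+1%:R.
  rewrite ler_pdivlMr// mulrC -un -{1}(normr_id (u n)) -normrM normrM normrM.
  rewrite !normr_id normrX mulrA -exprS (ger0_norm (gauss_ge0 _)).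
  apply: le_trans (KP _) _; rewrite ler_piMr// /normal_fun.
  rewrite -[leRHS]expR0 ler_expR mulNr oppr_le0 divr_ge0 ?sqr_ge0//.
  by rewrite mulrn_wge0// sqr_ge0.
apply/cvgrPdist_lt => e e0; near=> n.
rewrite sub0r normrN; apply: le_lt_trans (KP' n) _.
rewrite ltr_pdivrMr ?ltr0n// mulrC -ltr_pdivrMr//.
rewrite (@lt_le_trans _ _ (Num.truncn (K / e)).+1%:R) ?truncnS_gt// ler_nat ltnS.
by near: n; exists (Num.truncn (K / e)).
Unshelve. all: by end_near. Qed.

(** The derivative of [x ^+ k * gauss x] has zero integral. *)
Let stein k : (\int[mu]_x (x ^+ k.+1 * gauss x)%:E =
  (k%:R * s ^+ 2)%:E * \int[mu]_x (x ^+ k.-1 * gauss x)%:E)%E.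
Proof.
have s2 : s ^+ 2 != 0 by rewrite expf_neq0// gt_eqF.
pose f x : R := k%:R * (x ^+ k.-1 * gauss x) - (s ^+ 2)^-1 * (x ^+ k.+1 * gauss x).
have dg (x : R) : is_derive x 1 gauss (gauss x * (- (s ^+ 2)^-1 * x)).
  rewrite /gauss /normal_fun.
  rewrite (_ : (fun x => _) =
    expR \o ((- (s ^+ 2 *+ 2)^-1) \*: ((@id R) ^+ 2))); last first.
    apply/funext => z /=; congr expR; rewrite exprfctE subr0 /=.
    by rewrite /GRing.scale/= !mulNr mulrC.
  apply: is_derive_eq => /=; rewrite exprfctE /= subr0.
  rewrite (_ : - _ *: x ^+ 2 = - x ^+ 2 / (s ^+ 2 *+ 2)); last first.
    by rewrite /GRing.scale/= !mulNr mulrC.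
  congr (_ * _); rewrite /GRing.scale/=; field.
  by rewrite gt_eqF.
have df (x : R) : is_derive x 1 ((@id R) ^+ k * gauss) (f x).
  apply: is_derive_eq; rewrite exprfctE/= /f /GRing.scale/= [x ^+ k.+1]exprS.
  ring.
have hE x : ((@id R) ^+ k * gauss) x = x ^+ k * gauss x.
  by rewrite !fctE.
have i1 : mu.-integrable setT (fun x => k%:R%:E * (x ^+ k.-1 * gauss x)%:E)%E.
  exact: (integrableZl measurableT k%:R (integrable_powM _)).
have i2 : mu.-integrable setT (fun x => ((s ^+ 2)^-1)%:E * (x ^+ k.+1 * gauss x)%:E)%E.
  exact: (integrableZl measurableT (s ^+ 2)^-1 (integrable_powM _)).
have fE : EFin \o f = (fun x => k%:R%:E * (x ^+ k.-1 * gauss x)%:E -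
    ((s ^+ 2)^-1)%:E * (x ^+ k.+1 * gauss x)%:E)%E.
  by apply/funext => x /=; rewrite /f EFinB !EFinM.
have gc : continuous gauss.
  by move=> x; apply: differentiable_continuous; apply/derivable1_diffP; case: (dg x).
have fc : continuous f.
  move=> x; apply: cvgB; apply: cvgM; try exact: cvg_cst.
    by apply: cvgM; [exact: exprn_continuous|exact: gc].
  by apply: cvgM; [exact: exprn_continuous|exact: gc].
have F0 (u : nat -> R) : (forall n, `|u n| = n.+1%:R) ->
    ((@id R) ^+ k * gauss) (u n) @[n --> \oo] --> (0 : R).
  by move=> un; under eq_fun do rewrite hE; exact: powM_cvg0.
have := integral_derive_eq0 df fc.
rewrite fE => /(_ (integrableB measurableT i1 i2)).
move=> /(_ (F0 _ _) (F0 _ _)) I0.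
have {}I0 := I0 (fun n => ger0_norm (ler0n _ _)).
have := I0 (fun n => etrans (normrN _) (ger0_norm (ler0n _ _))).
under eq_integral do rewrite /f EFinB !(EFinM _ (_ * _)).
rewrite integralB// !integralZl//; try exact: integrable_powM.
have fin1 j : (\int[mu]_x (x ^+ j * gauss x)%:E \is a fin_num)%E.
  exact: (integrable_fin_num measurableT (integrable_powM j)).
rewrite -(fineK (fin1 k.-1)) -(fineK (fin1 k.+1)) -!EFinM -EFinB => -[E].
congr (_%:E); move/eqP: E; rewrite subr_eq0 => /eqP E.
by rewrite mulrAC E mulrC mulrA divff// mul1r.
Qed.

Let pdf_ge0 x : 0 <= normal_pdf 0 s x. Proof. exact: normal_pdf_ge0. Qed.

Let ge0_normal_integral (f : R -> R) : measurable_fun setT f ->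
  (forall x, 0 <= f x) ->
  (\int[normal_prob 0 s]_x (f x)%:E = \int[mu]_x (f x * normal_pdf 0 s x)%:E)%E.
Proof.
move=> mf f0; rewrite -[LHS]mule1; apply/esym.
apply: (@ge0_integral_density _ _ _ _ _ mu (normal_prob 0 s) id (normal_pdf 0 s) 1%E f) => //.
  exact: measurable_normal_pdf.
move=> B mB; rewrite mule1 /= /normal_prob [RHS]integral_mkcond.
apply: eq_integral => x _; rewrite patchE indicE.
by case: (x \in B); rewrite ?mul1r ?mul0r.
Qed.

Let normal_integral (f : R -> R) : measurable_fun setT f ->
  (\int[normal_prob 0 s]_x (f x)%:E = \int[mu]_x (f x * normal_pdf 0 s x)%:E)%E.
Proof.
move=> mf; rewrite integralE [RHS]integralE.
rewrite (_ : (fun x => (f x)%:E) = EFin \o f)//.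
rewrite (_ : (fun x => (f x * normal_pdf 0 s x)%:E) =
  EFin \o (fun x => f x * normal_pdf 0 s x))// !funerpos !funerneg.
rewrite !ge0_normal_integral//; last 2 first.
- exact: measurable_funrneg.
- exact: measurable_funrpos.
congr (_ - _)%E; apply: eq_integral => x _ /=; congr (_%:E).
  by rewrite /funrpos maxr_pMl// mul0r.
by rewrite /funrneg maxr_pMl// mul0r mulNr.
Qed.

Let peakE x k : x ^+ k * normal_pdf 0 s x = normal_peak s * (x ^+ k * gauss x).
Proof. by rewrite normal_pdfE ?gt_eqF// mulrCA. Qed.

Lemma normal_integrable_powM k :
  (normal_prob 0 s).-integrable setT (fun x : R => (x ^+ k)%:E).
Proof.
apply/integrableP; split; first exact/measurable_EFinP/measurable_funX.
rewrite (_ : (\int[_]_x _)%E = \int[normal_prob 0 s]_x (`|x ^+ k|)%:E)%E//.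
rewrite ge0_normal_integral//; last exact/measurableT_comp/measurable_funX.
have /integrableP[_] := integrableZl measurableT (normal_peak s) (integrable_powM k).
apply: le_lt_trans; rewrite le_eqVlt; apply/orP; left; apply/eqP.
apply: eq_integral => x _ /=; rewrite -peakE; congr (_%:E).
by rewrite normrM (ger0_norm (pdf_ge0 _)).
Qed.

Definition normal_moment k : R := \int[normal_prob 0 s]_x (x ^+ k).

Lemma normal_moment0 : normal_moment 0 = 1.
Proof.
rewrite /normal_moment; under eq_Rintegral do rewrite expr0.
by rewrite Rintegral_cst//= /normal_prob integral_normal_pdf mulr1.
Qed.

Lemma normal_momentS k : normal_moment k.+1 = k%:R * s ^+ 2 * normal_moment k.-1.
Proof.
have E j : (\int[normal_prob 0 s]_x (x ^+ j)%:E =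
    (normal_peak s)%:E * \int[mu]_x (x ^+ j * gauss x)%:E)%E.
  rewrite normal_integral; last exact: measurable_funX.
  rewrite -(integralZl measurableT (integrable_powM j)).
  by apply: eq_integral => x _; rewrite peakE.
have fin1 j : (\int[mu]_x (x ^+ j * gauss x)%:E \is a fin_num)%E.
  exact: (integrable_fin_num measurableT (integrable_powM j)).
rewrite /normal_moment /Rintegral !E stein.
rewrite -(fineK (fin1 k.-1)) -!EFinM /=; ring.
Qed.

End gaussian_moments.

Lemma normal_moment_even (R : realType) m : normal_moment (1 : R) m.*2 = (odd_fact m)%:R.
Proof.
elim: m => [|m IH]; first by rewrite normal_moment0.
by rewrite doubleS normal_momentS// expr1n mulr1 IH natrM.
Qed.

(** * Moments of the complex Gaussian law *)

Section product_probability.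
Context d1 d2 (T1 : measurableType d1) (T2 : measurableType d2) (R : realType).
Variables (P1 : probability T1 R) (P2 : probability T2 R).

(** A name for the product measure that carries the structure of a probability
    measure. *)
Definition product_probability : set (T1 * T2) -> \bar R := (P1 \x P2)%E.

HB.instance Definition _ := Measure.on product_probability.

Let product_probability_setT : product_probability setT = 1%E.
Proof.
rewrite /product_probability -setXTT [LHS]product_measure1E//.
by rewrite -[RHS]mule1; congr (_ * _)%E; exact: probability_setT.
Qed.

HB.instance Definition _ :=
  Measure_isProbability.Build _ _ R product_probability product_probability_setT.

Lemma product_integral_mul (f : T1 -> R) (g : T2 -> R) :
  P1.-integrable setT (EFin \o f) -> P2.-integrable setT (EFin \o g) ->
  (product_probability : probability _ R).-integrable setT
    (fun z => (f z.1 * g z.2)%:E) /\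
  \int[product_probability]_z (f z.1 * g z.2) =
  (\int[P1]_x f x) * (\int[P2]_y g y).
Proof.
move=> fi gi; have mf : measurable_fun setT f by apply/measurable_EFinP/(measurable_int _ fi).
have mg : measurable_fun setT g by apply/measurable_EFinP/(measurable_int _ gi).
have mfg : measurable_fun setT (fun z : T1 * T2 => (f z.1 * g z.2)%:E).
  apply/measurable_EFinP; apply: measurable_funM.
    exact: measurableT_comp mf measurable_fst.
  exact: measurableT_comp mg measurable_snd.
have ffin := integrable_fin_num measurableT fi.
have gfin := integrable_fin_num measurableT gi.
have int : (P1 \x P2)%E.-integrable setT (fun z => (f z.1 * g z.2)%:E).
  apply/integrable12ltyP => //=.
  have -> : (\int[P1]_x \int[P2]_y `|(f x * g y)%:E| =
      \int[P1]_x (`|(f x)%:E| * \int[P2]_y `|(g y)%:E|))%E.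
    apply: eq_integral => x _; rewrite -ge0_integralZl//.
    - by apply: eq_integral => y _; rewrite /= normrM.
    - exact/measurable_EFinP/measurableT_comp.
  rewrite ge0_integralZr//; last 2 first.
    exact/measurable_EFinP/measurableT_comp.
    exact: integral_ge0.
  have /integrableP[_ fl] := fi; have /integrableP[_ gl] := gi.
  by rewrite lte_mul_pinfty// ?integral_ge0// ge0_fin_numE// integral_ge0.
split => //; rewrite /Rintegral.
rewrite (_ : (\int[product_probability]_z _)%E = (\int[P1 \x P2]_z (f z.1 * g z.2)%:E)%E)//.
rewrite -integral12_prod_meas1//.
have -> : (\int[P1]_x \int[P2]_y (f (x, y).1 * g (x, y).2)%:E =
    \int[P1]_x ((f x)%:E * \int[P2]_y (g y)%:E))%E.
  apply: eq_integral => x _; rewrite /= -integralZl//.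
have gE : (\int[P2]_y (g y)%:E = (fine (\int[P2]_y (g y)%:E))%:E)%E by rewrite fineK.
rewrite gE integralZr// fineM//.
Qed.

End product_probability.

(** [m] stands for the moments of a centered real Gaussian law of variance [1 / 2]
    and [K a b k l] for the expectation of [x^a y^b z^k zbar^l], [z = x + i y];
    the argument is a purely algebraic consequence of the relations assumed. *)
Section complex_stein.
Variables (R : realType) (m : nat -> R[i]) (K : nat -> nat -> nat -> nat -> R[i]).
Hypothesis mS : forall k, 2 * m k.+1 = k%:R * m k.-1.
Hypothesis K0 : forall a b, K a b 0 0 = m a * m b.
Hypothesis Kz : forall a b k l, K a b k.+1 l = K a.+1 b k l + 'i * K a b.+1 k l.
Hypothesis Kzbar : forall a b k l, K a b k l.+1 = K a.+1 b k l - 'i * K a b.+1 k l.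

(** Gaussian integration by parts in each real coordinate, for the monomials
    x^a y^b z^k zbar^l. *)
Let stein2 k l : (forall a b,
  2 * K a.+1 b k l = a%:R * K a.-1 b k l + k%:R * K a b k.-1 l + l%:R * K a b k l.-1) /\
  (forall a b,
  2 * K a b.+1 k l = b%:R * K a b.-1 k l + 'i * (k%:R * K a b k.-1 l)
     - 'i * (l%:R * K a b k l.-1)).
Proof.
have Za a b k' l' : a%:R * K a.-1 b k'.+1 l' =
    a%:R * (K a b k' l' + 'i * K a.-1 b.+1 k' l').
  by case: a => [|a]; rewrite ?mul0r// Kz.
have Zb a b k' l' : b%:R * K a b.-1 k'.+1 l' =
    b%:R * (K a.+1 b.-1 k' l' + 'i * K a b k' l').
  by case: b => [|b]; rewrite ?mul0r// Kz.
have Zk a b k' l' : k'%:R * K a b k' l' =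
    k'%:R * (K a.+1 b k'.-1 l' + 'i * K a b.+1 k'.-1 l').
  by case: k' => [|k']; rewrite ?mul0r// Kz.
have Wa a b k' l' : a%:R * K a.-1 b k' l'.+1 =
    a%:R * (K a b k' l' - 'i * K a.-1 b.+1 k' l').
  by case: a => [|a]; rewrite ?mul0r// Kzbar.
have Wb a b k' l' : b%:R * K a b.-1 k' l'.+1 =
    b%:R * (K a.+1 b.-1 k' l' - 'i * K a b k' l').
  by case: b => [|b]; rewrite ?mul0r// Kzbar.
have Wl a b k' l' : l'%:R * K a b k' l' =
    l'%:R * (K a.+1 b k' l'.-1 - 'i * K a b.+1 k' l'.-1).
  by case: l' => [|l']; rewrite ?mul0r// Kzbar.
elim: k l => [|k IHk] l.
  elim: l => [|l [IHx IHy]].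
    split => a b; rewrite !mulr0n !mul0r ?mulr0 ?subr0 !addr0 !K0.
      by rewrite mulrA mS mulrA.
    by rewrite mulrCA mS mulrCA.
  split => a b.
    rewrite Kzbar mulrBr mulrCA !IHx Wa [l.+1.-1]/= -[l.+1%:R]natr1 mulrDl Wl.
    by rewrite -natr1; ring.
  rewrite Kzbar mulrBr mulrCA !IHy Wb [l.+1.-1]/= -[l.+1%:R]natr1 mulrDl Wl.
  by rewrite -natr1; ring.
have [IHx IHy] := IHk l; split => a b.
  rewrite Kz mulrDr mulrCA !IHx Za [k.+1.-1]/= -[k.+1%:R]natr1 [(k%:R + 1) * _]mulrDl Zk Kz.
  by rewrite -natr1; ring.
rewrite Kz mulrDr mulrCA !IHy Zb [k.+1.-1]/= -[k.+1%:R]natr1 [(k%:R + 1) * _]mulrDl Zk Kz.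
by rewrite -natr1; ring.
Qed.

(** In the sum of the two integrations by parts, the derivatives of [z] cancel
    because [i i = -1], and those of [zbar] add up. *)
Lemma complex_stein_z k l : K 0 0 k.+1 l = l%:R * K 0 0 k l.-1.
Proof.
have ii : 'i * 'i = -1 :> R[i] by rewrite -expr2 sqrCi.
have [Ex Ey] := stein2 k l.
apply: (@mulfI _ (2 : R[i])); first by rewrite pnatr_eq0.
rewrite Kz mulrDr mulrCA Ex Ey !mul0r !add0r mulrBr !mulrA ii; ring.
Qed.

Lemma complex_stein_zbar k l : K 0 0 k l.+1 = k%:R * K 0 0 k.-1 l.
Proof.
have ii : 'i * 'i = -1 :> R[i] by rewrite -expr2 sqrCi.
have [Ex Ey] := stein2 k l.
apply: (@mulfI _ (2 : R[i])); first by rewrite pnatr_eq0.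
rewrite Kzbar mulrBr mulrCA Ex Ey !mul0r !add0r mulrBr !mulrA ii; ring.
Qed.

End complex_stein.

Section standard_gaussian_moments.
Variable R : realType.

Let s : R := Num.sqrt 2^-1.
Let s0 : 0 < s. Proof. by rewrite sqrtr_gt0 invr_gt0. Qed.
Let s2 : s ^+ 2 = 2^-1. Proof. by rewrite sqr_sqrtr. Qed.

Let G : probability _ R := normal_prob (0 : R) s.
Let G2 : probability _ R := product_probability G G.

Let mono_int a b : G2.-integrable setT (fun z => (z.1 ^+ a * z.2 ^+ b)%:E).
Proof.
by have [] := product_integral_mul (normal_integrable_powM s0 a)
  (normal_integrable_powM s0 b).
Qed.

Let mono_value a b : \int[G2]_z (z.1 ^+ a * z.2 ^+ b) =
  normal_moment s a * normal_moment s b.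
Proof.
by have [] := product_integral_mul (normal_integrable_powM s0 a)
  (normal_integrable_powM s0 b).
Qed.

Let cfin_mono a b : cfinite_moments G2 (fun z => (z.1 ^+ a * z.2 ^+ b)%:C).
Proof.
apply: cfin_real.
  by apply/measurable_EFinP; exact: (measurable_int _ (mono_int a b)).
move=> p; have /integrableP[_] := mono_int (a * p) (b * p).
rewrite unlock; apply: le_lt_trans; rewrite le_eqVlt; apply/orP; left; apply/eqP.
by apply: eq_integral => z _; rewrite /= -normrX exprMn !exprM.
Qed.

Let Z (z : R * R) : R[i] := z.1 +i* z.2.

Let ZE z : Z z = (z.1 ^+ 1 * z.2 ^+ 0)%:C + 'i * (z.1 ^+ 0 * z.2 ^+ 1)%:C.
Proof. by rewrite !expr0 !expr1 mulr1 mul1r [LHS]complexE. Qed.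

Let ZbarE z : conjc (Z z) = (z.1 ^+ 1 * z.2 ^+ 0)%:C - 'i * (z.1 ^+ 0 * z.2 ^+ 1)%:C.
Proof.
rewrite !expr0 !expr1 mulr1 mul1r [LHS]complexE /=.
by rewrite rmorphN mulrN.
Qed.

Let cfin_exp (W : R * R -> R[i]) k : cfinite_moments G2 W ->
  cfinite_moments G2 (fun z => W z ^+ k).
Proof.
move=> fW; elim: k => [|k IH].
  by under eq_fun do rewrite expr0; exact: cfin_cst.
by under eq_fun do rewrite exprS; exact: cfin_mul.
Qed.

Let cfin_Z : cfinite_moments G2 Z.
Proof.
have -> : Z = (fun z => (z.1 ^+ 1 * z.2 ^+ 0)%:C + 'i * (z.1 ^+ 0 * z.2 ^+ 1)%:C).
  by apply/funext => z; exact: ZE.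
exact: (cfin_add (cfin_mono 1 0) (cfin_mul (cfin_cst G2 'i) (cfin_mono 0 1))).
Qed.

Let term a b k l (z : R * R) : R[i] :=
  (z.1 ^+ a * z.2 ^+ b)%:C * (Z z ^+ k * conjc (Z z) ^+ l).

Let cfin_term a b k l : cfinite_moments G2 (term a b k l).
Proof.
exact: (cfin_mul (cfin_mono a b)
  (cfin_mul (cfin_exp k cfin_Z) (cfin_exp l (cfin_conj cfin_Z)))).
Qed.

Let K a b k l : R[i] := cintegral G2 setT (term a b k l).

Let K0 a b : K a b 0 0 = (normal_moment s a)%:C * (normal_moment s b)%:C.
Proof.
rewrite -rmorphM -mono_value /K /cintegral.
rewrite (_ : term a b 0 0 = fun z => (z.1 ^+ a * z.2 ^+ b)%:C); last first.
  by apply/funext => z; rewrite /term !expr0 !mulr1.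
by rewrite /= Rintegral_cst// mul0r.
Qed.

Let Kz a b k l : K a b k.+1 l = K a.+1 b k l + 'i * K a b.+1 k l.
Proof.
rewrite /K -cintegralZ// -cintegralD//; last first.
  by apply: cfin_mul => //; exact: cfin_cst.
congr cintegral; apply/funext => z; rewrite /term exprS ZE.
rewrite !expr0 !expr1 mulr1 mul1r [z.1 ^+ a.+1]exprS [z.2 ^+ b.+1]exprS !rmorphM; ring.
Qed.

Let Kzbar a b k l : K a b k l.+1 = K a.+1 b k l - 'i * K a b.+1 k l.
Proof.
rewrite -mulNr /K -cintegralZ// -cintegralD//; last first.
  by apply: cfin_mul => //; exact: cfin_cst.
congr cintegral; apply/funext => z; rewrite /term [conjc _ ^+ l.+1]exprS {1}ZbarE.
rewrite !expr0 !expr1 mulr1 mul1r [z.1 ^+ a.+1]exprS [z.2 ^+ b.+1]exprS !rmorphM; ring.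
Qed.

Let mS k : 2 * (normal_moment s k.+1)%:C = k%:R * (normal_moment s k.-1)%:C :> R[i].
Proof.
have natC j : j%:R = (j%:R : R)%:C :> R[i] by rewrite rmorph_nat.
rewrite normal_momentS// s2 !natC -!rmorphM; congr (_%:C).
set x := normal_moment s _.
rewrite (_ : 2%:R * _ = (2%:R / 2%:R) * (k%:R * x)); last by ring.
by rewrite divff ?mul1r// pnatr_eq0.
Qed.

Let m0 : (normal_moment s 0)%:C = 1 :> R[i].
Proof. by rewrite normal_moment0. Qed.

Let KE k l : std_cgauss_moment R k l = K 0 0 k l.
Proof.
rewrite /std_cgauss_moment /K; congr cintegral.
by apply/funext => z; rewrite /term !expr0 mulr1 mul1r.
Qed.

Lemma std_cgauss_moment0 : std_cgauss_moment R 0 0 = 1.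
Proof. by rewrite KE K0 m0 mulr1. Qed.

Lemma std_cgauss_momentS k l :
  std_cgauss_moment R k.+1 l = l%:R * std_cgauss_moment R k l.-1.
Proof.
by rewrite !KE; exact: (@complex_stein_z R (fun j => (normal_moment s j)%:C) K mS K0).
Qed.

Lemma std_cgauss_moment_bar l : std_cgauss_moment R 0 l.+1 = 0.
Proof. by rewrite KE (@complex_stein_zbar R (fun j => (normal_moment s j)%:C) K mS K0 Kz Kzbar) mul0r. Qed.

End standard_gaussian_moments.

(** * Integrals of exponential type *)

Section exponential_integrals.
Variable R : realType.
Notation mu := (@lebesgue_measure R).

Let unit_itv_measure : fine (mu (`[0, 1]%classic : set R)) = 1.
Proof. by rewrite lebesgue_measure_itv/= lte_fin ltr01 oppr0 adde0. Qed.

Let cintegral_unit_cst (c : R[i]) :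
  cintegral mu `[0, 1] (fun=> c) = c.
Proof.
rewrite /cintegral !Rintegral_cst//= unit_itv_measure !mulr1.
by case: c.
Qed.

Let Rintegral_FTC (F f : R -> R) : (forall x : R, is_derive x 1 F (f x)) ->
  continuous f -> \int[mu]_(x in `[0, 1]) f x = F 1 - F 0.
Proof.
move=> dF cf; have Fc : continuous F.
  by move=> x; apply: differentiable_continuous; apply/derivable1_diffP; case: (dF x).
rewrite /Rintegral (@continuous_FTC2 _ f F)//.
- exact: continuous_subspaceT.
- split.
  + by move=> x _; case: (dF x).
  + exact/cvg_at_right_filter/Fc.
  + exact/cvg_at_left_filter/Fc.
- by move=> x _; rewrite derive1E; case: (dF x).
Qed.

Let wave (s : R) : R[i] := (sin s / s) +i* ((1 - cos s) / s).

Let integral_wave (s : R) : s != 0 ->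
  cintegral mu `[0, 1] (fun x => cexpi (s * x)) = wave s.
Proof.
move=> s0; rewrite /cintegral /wave /cexpi /=.
have dl (x : R) : is_derive x 1 (s \*: (@id R)) s.
  by apply: is_derive_eq; rewrite /GRing.scale/= mulr1.
have cl : continuous (fun x : R => s * x).
  by move=> x; apply: cvgM; [exact: cvg_cst|exact: cvg_id].
congr (_ +i* _).
- have dF (x : R) : is_derive x 1 (s^-1 \*: (@sin R \o (s \*: (@id R)))) (cos (s * x)).
    apply: is_derive_eq; rewrite /GRing.scale/=.
    by rewrite mulrCA mulVf// mulr1.
  have cf : continuous (fun x : R => cos (s * x)).
    by move=> x; apply: continuous_comp; [exact: cl|exact: continuous_cos].
  have -> := Rintegral_FTC dF cf.
  have sc (u v : R) : u *: (v : R^o) = u * v by [].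
  by rewrite /= !sc mulr1 mulr0 sin0 mulr0 subr0 mulrC.
- have dF (x : R) : is_derive x 1 ((- s^-1) \*: (@cos R \o (s \*: (@id R)))) (sin (s * x)).
    apply: is_derive_eq; rewrite /GRing.scale/=.
    rewrite -[s *: x]/(s * x); field; exact: s0.
  have cf : continuous (fun x : R => sin (s * x)).
    by move=> x; apply: continuous_comp; [exact: cl|exact: continuous_sin].
  have -> := Rintegral_FTC dF cf.
  have sc (u v : R) : u *: (v : R^o) = u * v by [].
  by rewrite /= !sc mulr1 mulr0 cos0; field; exact: s0.
Qed.

Let wave_exp (s : R) : s != 0 -> `|s| <= 2 * pi -> exp_type_integral (wave s).
Proof.
(* The frequency 2 lets [s] reach [2 pi] although the angle is at most [pi]; the
   second variable has frequency 0 and integrates to 1. *)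
move=> s0 s2; exists 1%N, (s / 2), (fun i : 'I_2 => if i == ord0 then 2 else 0).
split=> //; first by move: s2; rewrite ler_norml => /andP[h1 h2]; apply/andP; split; lra.
left; rewrite /exp_integral1 /= -integral_wave//.
congr cintegral; apply/funext => x.
rewrite (_ : (fun y => _) = fun=> cexpi (s * x)) ?cintegral_unit_cst//.
apply/funext => y; congr cexpi; rewrite /int_form !big_ord_recl big_ord0 /=.
rewrite !(tnth_nth 0)/= mul0r !addr0 mulrA; congr (_ * _); by field.
Qed.

Definition exp_sum (z : R[i]) : Prop :=
  exists s : seq R[i], (forall x, x \in s -> exp_type_integral x) /\
    z = \sum_(x <- s) x.

Let exp_sum1 z : exp_type_integral z -> exp_sum z.
Proof.
move=> ez; exists [:: z]; rewrite big_seq1; split => // x.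
by rewrite inE => /eqP ->.
Qed.

Let exp_sumD z z' : exp_sum z -> exp_sum z' -> exp_sum (z + z').
Proof.
move=> [s [sP ->]] [t [tP ->]]; exists (s ++ t); rewrite big_cat; split => // x.
by rewrite mem_cat => /orP[/sP|/tP].
Qed.

Let exp_sum_mulrn z n : exp_sum z -> exp_sum (z *+ n).
Proof.
move=> ez; elim: n => [|n IH]; last by rewrite mulrS; exact: exp_sumD.
by exists [::]; rewrite big_nil mulr0n; split.
Qed.

Let pi0 : 0 < pi :> R. Proof. exact: pi_gt0. Qed.

Let small_real (r : R) : `|r| <= pi^-1 -> exp_sum (r%:C).
Proof.
rewrite ler_norml => /andP[r1 r2].
have pn0 : (pi : R) != 0 by rewrite gt_eqF.
have v1 : 2 * (sin (pi / 2) / (pi / 2)) = 4 / pi :> R.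
  by rewrite sin_pihalf; move: (pi : R) pn0 => p pn0; field.
have v2 : 2 * (sin (pi + pi / 2) / (pi + pi / 2)) = - (4 / 3 / pi) :> R.
  rewrite addrC sinDpi sin_pihalf; move: (pi : R) pn0 => p pn0.
  by rewrite (_ : p / 2 + p = 3 / 2 * p); field.
have ipi : 0 < (pi : R)^-1 by rewrite invr_gt0.
(* [2 sin t / t] is the sum of the waves at [t] and [- t]; its values at the end
   points of this interval have opposite signs and modulus above [1 / pi]. *)
have [|||t] := @IVT R (fun s => 2 * (sin s / s)) (pi / 2) (pi + pi / 2) r.
- by rewrite lerDr ltW.
- apply: continuous_in_subspaceT => x.
  rewrite inE/= in_itv/= => /andP[px _].
  have x0 : x != 0 by rewrite gt_eqF// (lt_le_trans _ px)// divr_gt0.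
  apply: cvgM; first exact: cvg_cst.
  by apply: cvgM; [exact: continuous_sin|apply: cvgV => //; exact: cvg_id].
- rewrite v1 v2 ge_min le_max; apply/andP; split; apply/orP; [right|left]; nra.
rewrite in_itv/= => /andP[t1 t2] <-.
have t0 : 0 < t by rewrite (lt_le_trans _ t1)// divr_gt0.
rewrite (_ : _%:C = wave t + wave (- t)); last first.
  rewrite /wave sinN cosN !invrN !mulrNN mulrN.
  by simpc; congr (_ +i* _); ring.
by apply: exp_sumD; apply: exp_sum1; apply: wave_exp;
  rewrite ?oppr_eq0 ?gt_eqF ?normrN ?gtr0_norm//; lra.
Qed.

Let small_imaginary (y : R) : 0 <= y <= pi^-1 ->
  exp_sum (0 +i* y) /\ exp_sum (0 +i* (- y)).
Proof.
move=> /andP[y0 y1].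
have pn0 : (pi : R) != 0 by rewrite gt_eqF.
have ipi : 0 < (pi : R)^-1 by rewrite invr_gt0.
have v1 : (1 - cos pi) / pi = 2 / pi :> R by rewrite cospi; move: (pi : R) pn0 => p pn0; field.
have v2 : (1 - cos (pi + pi)) / (pi + pi) = 0 :> R.
  by rewrite cosDpi cospi opprK subrr mul0r.
(* The imaginary part of the wave at [t] goes from [2 / pi] to [0] on this
   interval, while its real part is at most [1 / pi] and can be removed. *)
have [|||t] := @IVT R (fun s => (1 - cos s) / s) pi (pi + pi) y.
- by rewrite lerDr ltW.
- apply: continuous_in_subspaceT => x.
  rewrite inE/= in_itv/= => /andP[px _].
  have x0 : x != 0 by rewrite gt_eqF// (lt_le_trans _ px).
  apply: cvgM; last by apply: cvgV => //; exact: cvg_id.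
  by apply: cvgB; [exact: cvg_cst|exact: continuous_cos].
- rewrite v1 v2 ge_min le_max; apply/andP; split; apply/orP; [right|left]; nra.
rewrite in_itv/= => /andP[t1 t2] ty.
have t0 : 0 < t by rewrite (lt_le_trans _ t1).
have tn0 : t != 0 by rewrite gt_eqF.
have st : `|sin t / t| <= pi^-1.
  rewrite normrM (gtr0_norm (_ : 0 < t^-1)) ?invr_gt0//.
  apply: (@le_trans _ _ (1 * t^-1)).
    by rewrite ler_wpM2r ?invr_ge0 ?(ltW t0)// ler_norml sin_geN1 sin_le1.
  by rewrite mul1r lef_pV2.
have ->: 0 +i* y = wave t + (- (sin t / t))%:C.
  by rewrite /wave ty; simpc; congr (_ +i* _); ring.
have ->: 0 +i* (- y) = wave (- t) + (- (sin t / t))%:C.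
  rewrite /wave sinN cosN !invrN !mulrNN mulrN ty; simpc; congr (_ +i* _); ring.
by split; apply: exp_sumD; try (apply: small_real; rewrite normrN//);
  apply: exp_sum1; apply: wave_exp; rewrite ?oppr_eq0 ?normrN ?gtr0_norm//; lra.
Qed.

(** The integrals over two variables with frequencies 2 and 0 are the values
    [(exp (i s) - 1) / (i s)] for [0 < |s| <= 2 pi]. Adding those at [s] and
    [- s] gives all small reals, correcting one of them by a small real gives
    all small imaginary numbers, and repeating summands gives everything. *)
Lemma exp_sum_any (z : R[i]) : exp_sum z.
Proof.
case: z => a b.
have [n n0 nle] : exists2 n : nat, 0 < n%:R :> R & (`|a| + `|b|) * pi < n%:R.
  by exists (Num.truncn ((`|a| + `|b|) * pi)).+1; rewrite ?ltr0n ?truncnS_gt.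
have nn0 : n%:R != 0 :> R by rewrite gt_eqF.
have sm (c : R) : `|c| <= `|a| + `|b| -> `|c / n%:R| <= pi^-1.
  move=> cab; rewrite normrM normfV (ger0_norm (ltW n0)).
  rewrite ler_pdivrMr// mulrC -ler_pdivrMr ?invr_gt0// invrK.
  apply: le_trans (ltW nle); exact: ler_wpM2r (ltW pi0) _ _ _.
have -> : a +i* b = ((a / n%:R)%:C + (0 +i* (b / n%:R))) *+ n.
  have mulnE (u v : R) k : (u +i* v) *+ k = (u *+ k) +i* (v *+ k).
    by elim: k => [//|k IH]; rewrite !mulrS IH.
  have addE (u v : R) : u%:C + (0 +i* v) = u +i* v.
    by apply/eqP; rewrite eq_complex /= addr0 add0r !eqxx.
  by rewrite addE mulnE -(mulr_natr (a / n%:R)) -(mulr_natr (b / n%:R)) !divfK.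
apply/exp_sum_mulrn/exp_sumD; first by apply/small_real/sm; rewrite lerDl.
have bn : `|b / n%:R| <= pi^-1 by apply: sm; rewrite lerDr.
have [b0|b0] := leP 0 (b / n%:R).
  by apply: (small_imaginary _).1; rewrite b0 -[b / n%:R]ger0_norm.
rewrite -[b / n%:R]opprK; apply: (small_imaginary _).2.
by rewrite oppr_ge0 (ltW b0) -ltr0_norm.
Qed.

End exponential_integrals.

(** * The limit theorem *)

Lemma cvg_real_complex (R : realType) (u : nat -> R) (l : R) :
  u n @[n --> \oo] --> l ->
  (fun n => (u n)%:C : R[i]^o) @ \oo --> (l%:C : R[i]^o).
Proof.
move=> ul; apply/cvgrPdist_lt => -[e e'] /=; rewrite ltcE /= => /andP[/eqP -> e0].
near=> n; rewrite -rmorphB /= normc_def /= expr0n addr0 sqrtr_sqr ltcR.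
by near: n; move/cvgrPdist_lt: ul; exact.
Unshelve. all: by end_near. Qed.

Section balanced_words.
Variable R : realType.

(** The word of the moments that characterise a Gaussian variable. *)
Definition power_word (b : bool) k l : seq (bool * bool) :=
  nseq k (b, false) ++ nseq l (b, true).

Lemma power_word_pure b k l : all (fun x => x.1 == b) (power_word b k l).
Proof. by rewrite all_cat !all_nseq /= eqxx !orbT. Qed.

(** The first letter is plain, hence paired with one of the [l] adjoint letters,
    and removing any of them leaves the same word. *)
Lemma wick_power_wordS b k l :
  wick (opposite R) (power_word b k.+1 l) =
  l%:R * wick (opposite R) (power_word b k l.-1).
Proof.
rewrite /power_word /= wick_cons size_cat !size_nseq iotaD big_cat /= add0n.
rewrite big_seq big1 ?add0r => [|j]; last first.
  rewrite mem_iota add0n => /andP[_ jk].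
  by rewrite nth_cat size_nseq jk nth_nseq jk /opposite eqxx mul0r.
rewrite big_seq (eq_bigr (fun=> wick (opposite R) (power_word b k l.-1))).
  by rewrite -big_seq big_const_seq count_predT size_iota iter_addr_0 mulr_natl.
move=> j; rewrite mem_iota => /andP[kj jkl].
have jl : (j - k < l)%N by rewrite ltn_subLR.
rewrite nth_cat size_nseq ltnNge kj /= nth_nseq jl /opposite mul1r.
congr wick; rewrite /remove take_cat drop_cat !size_nseq ltnNge kj /=.
rewrite ltnNge (leqW kj) /= subSn// -catA; congr (_ ++ _).
have -> : nseq l (b, true) = nseq (j - k) (b, true) ++ nseq (l - (j - k)) (b, true).
  by rewrite -nseqD subnKC// ltnW.
rewrite take_size_cat ?size_nseq// -add1n -drop_drop drop_size_cat ?size_nseq//.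
case: l {jkl} jl => // l jl.
by rewrite subSn//= ?drop0 -nseqD subnKC.
Qed.

Lemma wick_power_word_bar b l : wick (opposite R) (power_word b 0 l.+1) = 0.
Proof.
rewrite /power_word /= wick_cons big_seq big1// => j.
rewrite size_nseq mem_iota => /andP[_ jl].
by rewrite nth_nseq jl /opposite eqxx mul0r.
Qed.

Lemma wick_power_word b k l :
  (wick (opposite R) (power_word b k l))%:C = std_cgauss_moment R k l.
Proof.
elim: k l => [|k IH] [|l].
- by rewrite std_cgauss_moment0 /wick /= big_seq1.
- by rewrite std_cgauss_moment_bar wick_power_word_bar.
- by rewrite std_cgauss_momentS wick_power_wordS !mul0r.
- by rewrite std_cgauss_momentS wick_power_wordS -IH rmorphM rmorph_nat.
Qed.

End balanced_words.

Lemma star_word_power (R : realType) (A : ncp R) (a : bool -> A) b k l :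
  star_word a (power_word b k l) = a b ^+ k * ncp_star (a b) ^+ l.
Proof. by rewrite /star_word big_cat !big_nseq !iter_mulr_1. Qed.

(** The word list [S] depends on [w] only, so that the same expansion serves
    the matrices and their limits. *)
Lemma star_word_sum (R : realType) (w : seq (unit * bool)) :
  exists S : seq (seq (bool * bool)),
  forall (A : ncp R) (x : bool -> A) (c : R),
    star_word (fun=> c%:C *: (x true + x false)) w =
    (c ^+ size w)%:C *: \sum_(v <- S) star_word x v.
Proof.
elim: w => [|l w [S IH]].
  by exists [:: [::]] => A x c; rewrite /star_word big_seq1 !big_nil scale1r.
exists ([seq (true, l.2) :: v | v <- S] ++ [seq (false, l.2) :: v | v <- S]).
move=> A x c; rewrite [LHS]big_cons.
rewrite -[X in _ * X]/(star_word (fun=> c%:C *: (x true + x false)) w) IH.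
pose y b := if l.2 then ncp_star (x b) else x b.
rewrite (_ : (if l.2 then _ else _) = c%:C *: (y true + y false)); last first.
  rewrite /y; case: l.2 => //; rewrite ncp_starZ ncp_starD.
  by congr (_ *: _); exact: conjc_real.
rewrite -scalerAl -scalerAr scalerA -rmorphM -exprS; congr (_ *: _).
rewrite big_cat !big_map mulrDl !mulr_sumr; congr (_ + _);
  by apply: eq_bigr => v _; rewrite /star_word big_cons.
Qed.

Section gaussian_bound.
Variable R : realType.

Let gauss : probability _ R := normal_prob (0 : R) 1.

Let coordinate (x : measurableTypeR R) : R := x.

Let measurable_coordinate : measurable_fun setT coordinate.
Proof. by move=> _ B mB; rewrite setTI. Qed.

HB.instance Definition _ :=
  isMeasurableFun.Build _ _ _ _ coordinate measurable_coordinate.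

Let id_var : {RV gauss >-> R} := coordinate.

(** The number of pairings of [2 m] points is realised as a moment by the
    coordinate on the real line under the standard normal law. *)
Lemma gaussian_even_moments :
  exists (d' : measure_display) (T' : measurableType d')
         (P' : probability T' R) (G : {RV P' >-> R}),
    centered_gaussian G /\
    forall m, ('E_P'[(fun t => G t ^+ (2 * m))%R] = (odd_fact m)%:R%:E)%E.
Proof.
exists _, _, gauss, id_var; split; first by exists 1.
move=> m; rewrite unlock -(normal_moment_even R m) mul2n /normal_moment /Rintegral.
rewrite fineK//.
exact: (integrable_fin_num measurableT (normal_integrable_powM ltr01 _)).
Qed.

End gaussian_bound.

Theorem theorem4p1 (R : realType) (d : measure_display) (T : measurableType d)
    (P : probability T R) (tau : int -> {RV P >-> R})
    (tau_indep : mutually_independent tau)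
    (tau_ident : identically_distributed tau)
    (tau_mean : forall j : int, ('E_P[tau j] = 0)%E)
    (tau_var : forall j : int, ('V_P[tau j] = 1)%E)
    (tau_fin : forall j : int, finite_moments P (tau j)) :
  exists (A : ncp R) (N N' : A),
    [/\ standard_complex_gaussian N,
        standard_complex_gaussian N',
        cvg_star_distribution
          (fun n => ((Num.sqrt n.+1%:R)^-1)%:C *: toeplitz tau_fin n)
          (((Num.sqrt 2)^-1)%:C *: (N + N')),
        (forall w : seq (bool * bool),
           exists s : seq R[i],
             (forall z, z \in s -> exp_type_integral z) /\
             joint_moment (fun b : bool => if b then N else N') w =
               \sum_(z <- s) z) &
        exists (d' : measure_display) (T' : measurableType d')
               (P' : probability T' R) (G : {RV P' >-> R}),
          centered_gaussian G /\
          forall (m : nat) (w : seq (bool * bool)),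
            (1 <= m)%N -> size w = (2 * m)%N ->
            ((cabs (joint_moment (fun b : bool => if b then N else N') w))%:E
               <= 'E_P'[(fun t => G t ^+ (2 * m))%R])%E].
Proof.
have lim w : (fun n => joint_moment (circulant_var tau_fin n) w : R[i]^o) @ \oo -->
    ((limit_moment R w)%:C : R[i]^o).
  under eq_fun do rewrite (circulant_joint_moment _ _ _ tau_indep).
  exact/cvg_real_complex/circulant_moment_lim.
have [A [a [aE a_normal]]] := ncp_limit lim.
have gaussian b : standard_complex_gaussian (a b).
  split; first by apply: a_normal => n; exact: circulant_normal.
  move=> k l; rewrite -star_word_power -[LHS]/(joint_moment a _) aE.
  by rewrite (limit_moment_pure R (power_word_pure b k l)) wick_power_word.
exists A, (a true), (a false); split => //.
- move=> w; have [S SE] := star_word_sum R w.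
  pose c : R := (Num.sqrt 2)^-1.
  have momE (B : ncp R) (x : bool -> B) :
      joint_moment (fun=> c%:C *: (x true + x false)) w =
      (c ^+ size w)%:C * \sum_(v <- S) joint_moment x v.
    by rewrite /joint_moment SE linearZ linear_sum.
  under eq_fun do rewrite -circulant_sum momE.
  rewrite momE; apply: (@cvgZl_tmp _ R[i]^o); elim: S {SE momE} => [|v S IH].
    by under eq_fun do rewrite big_nil; rewrite big_nil; exact: cvg_cst.
  under eq_fun do rewrite big_cons; rewrite big_cons aE.
  exact: cvgD (lim v) IH.
- by move=> w; exact: exp_sum_any.
- have aif : (fun b : bool => if b then a true else a false) = a.
    by apply/funext => -[].
  have [d' [T' [P' [G [gG Gm]]]]] := gaussian_even_moments R.
  exists d', T', P', G; split => // m w _ wm; rewrite aif aE Gm lee_fin.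
  rewrite -size_codes -mul2n -wm /cabs normc_def /= expr0n addr0 sqrtr_sqr.
  exact: limit_moment_norm.
Qed.
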